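(* Let $n\ge3$, $0<s<1$, $\gamma>0$, let $\Omega\subset\mathbb{R}^n$ be a bounded $C^{1,1}$ domain, let $w\in H^{-1}(\Omega)$ and $u\in H^1_{\mathrm{loc}}(\Omega)\cap L^1(\Omega)$. Consider the following two problems. $(\mathcal{G})$: $u>0$ in $\Omega$ and $u^{-\gamma}\in L^1_{\mathrm{loc}}(\Omega)$; $$\int_\Omega\nabla u\cdot\nabla\varphi\,dx+\iint_{\mathbb{R}^{2n}}\mathcal{B}(u)(x,y)\mathcal{B}(\varphi)(x,y)\,d\nu-\int_\Omega u^{-\gamma}\varphi\,dx=\langle w,\varphi\rangle\quad\forall\varphi\in C_c^\infty(\Omega);$$ and $u\le0$ on $\partial\Omega$. $(\mathcal{H})$: $u>0$ in $\Omega$ and $u^{-\gamma}\in L^1_{\mathrm{loc}}(\Omega)$; $$\int_\Omega\nabla u\cdot\nabla(v-u)\,dx+\iint_{\mathbb{R}^{2n}}\mathcal{B}(u)(x,y)\mathcal{B}(v-u)(x,y)\,d\nu-\int_\Omega u^{-\gamma}(v-u)\,dx\ge\langle w,v-u\rangle$$ for all $v\in u+(H_0^1(\Omega)\cap L_c^\infty(\Omega))$ with $v\ge0$ in $\Omega$; and $u\le0$ on $\partial\Omega$. Then $(\mathcal{G})$ implies $(\mathcal{H})$. Moreover, if $w\in L^1_{\mathrm{loc}}(\Omega)$, then $(\mathcal{H})$ implies $(\mathcal{G})$.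
   Context: $H_0^1(\Omega)=\{u\in H^1(\mathbb{R}^n):u=0\text{ in }\mathbb{R}^n\setminus\Omega\}$, with dual $H^{-1}(\Omega)$; $H^1_{\mathrm{loc}}(\Omega)$ is the set of $u$ with $u\in H^1(K)$ for all $K\Subset\Omega$; $L^\infty_c(\Omega)$ is the set of $L^\infty$ functions with compact support in $\Omega$. Write $\mathcal{B}(u)(x,y)=u(x)-u(y)$ and $d\nu=|x-y|^{-n-2s}\,dx\,dy$. When $w\in L^1_{\mathrm{loc}}(\Omega)$, $\langle w,\varphi\rangle=\int_\Omega w\varphi\,dx$ for $\varphi\in C_c^\infty(\Omega)$. Boundary condition: $u\le 0$ on $\partial\Omega$ means that $u=0$ in $\mathbb{R}^n\setminus\Omega$ and $(u-\varepsilon)^+\in H_0^1(\Omega)$ for every $\varepsilon>0$. *)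

(* Defs.v *)
From HB Require Import structures.
From mathcomp Require Import all_boot all_order all_algebra.
From mathcomp Require Import all_classical all_reals all_analysis.

Set Implicit Arguments.
Unset Strict Implicit.
Unset Printing Implicit Defensive.

Import Order.TTheory GRing.Theory Num.Theory.
Import numFieldNormedType.Exports.

Local Open Scope classical_set_scope.
Local Open Scope ring_scope.

(* R^n is 'rV[R]_n. Its sigma-algebra is the product of the Borel
   sigma-algebras of the n coordinates, as for the library's n.-tuple, i.e. the
   Borel sigma-algebra of R^n. *)

Definition measure_rV_display : measure_display -> measure_display.
Proof. exact. Qed.

Section measurable_rV.
Context {d} {T : measurableType d} (n : nat).

Let coors : 'I_n -> 'rV[T]_n -> T := fun i x => x ord0 i.

Let rV_set0 : g_sigma_preimage coors set0.
Proof. exact: sigma_algebra0. Qed.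

Let rV_setC A : g_sigma_preimage coors A -> g_sigma_preimage coors (~` A).
Proof. exact: sigma_algebraC. Qed.

Let rV_bigcup (F : _^nat) : (forall i, g_sigma_preimage coors (F i)) ->
  g_sigma_preimage coors (\bigcup_i (F i)).
Proof. exact: sigma_algebra_bigcup. Qed.

HB.instance Definition _ := @isMeasurable.Build (measure_rV_display d)
  'rV[T]_n (g_sigma_preimage coors) rV_set0 rV_setC rV_bigcup.

End measurable_rV.

Lemma measurable_coord d (T : measurableType d) n (i : 'I_n) :
  measurable_fun [set: 'rV[T]_n] (fun x => x ord0 i).
Proof.
move=> _ Y mY; rewrite setTI; apply: sub_sigma_algebra => /=.
rewrite -bigcup_seq/=; exists i => /=; first by rewrite mem_index_enum.
by exists Y => //; rewrite setTI.
Qed.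

Lemma measurable_fun_rVP d d' (S : measurableType d') (T : measurableType d) n
    (f : S -> 'rV[T]_n) :
  measurable_fun [set: S] f <->
  forall i, measurable_fun [set: S] (fun x => f x ord0 i).
Proof.
split=> [mf i|mf].
  exact: (measurableT_comp (measurable_coord i) mf).
have : g_sigma_preimage (fun i x => f x ord0 i) `<=` (measurable : set (set S)).
  apply: smallest_sub; first exact: sigma_algebra_measurable.
  move=> A; rewrite -bigcup_seq => -[i /= _ [B mB <-]].
  exact: mf.
rewrite (g_sigma_preimage_comp (fun i (x : 'rV[T]_n) => x ord0 i) f) => sub.
by move=> _ A mA; apply: sub; exists A.
Qed.

(* Lebesgue measure on R^n, by induction on n: the Lebesgue measure on R^(1+n)
   is the image of the product of those on R and on R^n. *)

Section lebesgue_measure_rV.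
Context {R : realType}.

Definition cons_rV n (x : R * 'rV[R]_n) : 'rV[R]_n.+1 :=
  \row_i oapp (fun j => x.2 ord0 j) x.1 (unlift ord0 i).

Lemma measurable_cons_rV n : measurable_fun [set: R * 'rV[R]_n] (@cons_rV n).
Proof.
apply/measurable_fun_rVP => i.
under eq_fun do rewrite mxE.
case: unliftP => [j _|_] /=; last exact: measurable_fst.
exact: (measurableT_comp (measurable_coord j) measurable_snd).
Qed.

Section succ.
Variables (n : nat) (mu : {sigma_finite_measure set 'rV[R]_n -> \bar R}).

Local Notation prodmu := (@lebesgue_measure R \x mu)%E.

Definition lebesgue_succ : set 'rV[R]_n.+1 -> \bar R :=
  pushforward prodmu (@cons_rV n).

Let lebesgue_succ0 : lebesgue_succ set0 = 0%E.
Proof. by rewrite /lebesgue_succ /pushforward preimage_set0 measure0. Qed.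

Let mpre A : measurable A -> measurable (@cons_rV n @^-1` A).
Proof.
by move=> mA; rewrite -[X in measurable X]setTI; exact: measurable_cons_rV.
Qed.

Let lebesgue_succ_ge0 A : (0 <= lebesgue_succ A)%E.
Proof. by rewrite /lebesgue_succ /pushforward; exact: measure_ge0. Qed.

Let lebesgue_succ_sigma_additive : semi_sigma_additive lebesgue_succ.
Proof.
move=> F mF tF mUF; rewrite /lebesgue_succ /pushforward preimage_bigcup.
apply: measure_semi_sigma_additive.
- by move=> k; exact: mpre.
- apply/trivIsetP => /= i j _ _ ij; rewrite -preimage_setI.
  by move/trivIsetP : tF => /(_ _ _ _ _ ij) ->//; rewrite preimage_set0.
- by rewrite -preimage_bigcup; exact: mpre.
Qed.

HB.instance Definition _ := isMeasure.Build _ _ _ lebesgue_succ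
  lebesgue_succ0 lebesgue_succ_ge0 lebesgue_succ_sigma_additive.

Let lebesgue_succ_sigma_finite : sigma_finite setT lebesgue_succ.
Proof.
have /sigma_finiteP[F1 [TF1 ndF1 F1oo]] :=
  sigma_finiteT (@lebesgue_measure R).
have /sigma_finiteP[F2 [TF2 ndF2 F2oo]] := sigma_finiteT mu.
pose F k := F1 k `*` F2 k.
have TF : [set: R * 'rV[R]_n] = \bigcup_k F k.
  apply/seteqP; split=> // -[x y] _.
  have [k _ F1x] : (\bigcup_k F1 k) x by rewrite -TF1.
  have [l _ F2y] : (\bigcup_k F2 k) y by rewrite -TF2.
  exists (maxn k l) => //; split.
  - by move: x F1x; exact/subsetPset/ndF1/leq_maxl.
  - by move: y F2y; exact/subsetPset/ndF2/leq_maxr.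
have Foo k : measurable (F k) /\ (prodmu (F k) < +oo)%E.
  have [? ?] := F1oo k; have [? ?] := F2oo k.
  split; first exact: measurableX.
  by rewrite product_measure1E// lte_mul_pinfty// ge0_fin_numE.
pose unc (y : 'rV[R]_n.+1) : R * 'rV[R]_n :=
  (y ord0 ord0, \row_j y ord0 (lift ord0 j)).
have munc : measurable_fun setT unc.
  apply/measurable_fun_pair; first exact: measurable_coord.
  apply/measurable_fun_rVP => i.
  by under eq_fun do rewrite mxE; exact: measurable_coord.
have consK : cancel (@cons_rV n) unc.
  move=> [x y]; congr (_, _); first by rewrite mxE unlift_none.
  by apply/rowP => j; rewrite !mxE liftK.
exists (fun k => unc @^-1` F k).
  by rewrite -preimage_bigcup -TF preimage_setT.
move=> k; have [mF Fk] := Foo k; split.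
  by rewrite -[X in measurable X]setTI; exact: munc.
rewrite /lebesgue_succ /pushforward -comp_preimage.
by rewrite (_ : unc \o _ = id)//; apply/funext => x /=; rewrite consK.
Qed.

HB.instance Definition _ := Measure_isSigmaFinite.Build _ _ _ lebesgue_succ
  lebesgue_succ_sigma_finite.

End succ.

Fixpoint lebesgue_rV n : {sigma_finite_measure set 'rV[R]_n -> \bar R} :=
  match n with
  | 0 => \d_(0 : 'rV[R]_0)
  | n'.+1 => lebesgue_succ (lebesgue_rV n')
  end.

Lemma lebesgue_rV_box n (A : 'I_n -> set R) : (forall i, measurable (A i)) ->
  (lebesgue_rV n [set x : 'rV[R]_n | forall i, A i (x ord0 i)] =
   \prod_(i < n) lebesgue_measure (A i))%E.
Proof.
elim: n A => [|n IH] A mA /=.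
  by rewrite big_ord0 diracE mem_set//= => -[].
have mbox m (B : 'I_m -> set R) : (forall i, measurable (B i)) ->
    measurable [set x : 'rV[R]_m | forall i, B i (x ord0 i)].
  move=> mB; rewrite (_ : [set _ | _] =
      \bigcap_(i in [set: 'I_m]) ((fun x : 'rV[R]_m => x ord0 i) @^-1` B i)).
    apply: fin_bigcap_measurable => // i _.
    by rewrite -[X in measurable X]setTI; exact: measurable_coord.
  by apply/seteqP; split=> x /= h i; [move=> _|]; exact: h.
rewrite big_ord_recl -IH//.
rewrite -(@product_measure1E _ _ _ _ R lebesgue_measure (lebesgue_rV n)
  _ _ (mA ord0) (mbox _ _ (fun i => mA (lift ord0 i)))).
rewrite /lebesgue_succ /pushforward; congr (_ _).
apply/seteqP; split => [[x y] /= h|[x y] /= [hx hy] i].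
  split; first by have := h ord0; rewrite mxE unlift_none.
  by move=> i; have := h (lift ord0 i); rewrite mxE liftK.
by rewrite mxE; case: unliftP => [j ->|->] /=.
Qed.

End lebesgue_measure_rV.

Local Notation leb := (lebesgue_rV _).

Section function_spaces.
Context {R : realType} {n : nat}.
Implicit Types (U : set 'rV[R]_n) (f g phi : 'rV[R]_n -> R).

Definition partial (i : 'I_n) f : 'rV[R]_n -> R :=
  fun x => 'D_(delta_mx ord0 i) f x.

Fixpoint Ck (k : nat) f : Prop :=
  match k with
  | 0 => continuous f
  | k'.+1 => [/\ continuous f,
                 forall i x, derivable f x (delta_mx ord0 i) &
                 forall i, Ck k' (partial i f)]
  end.

Definition C11 f : Prop :=
  Ck 1 f /\ exists L : R, forall i, L.-lipschitz (partial i f).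

Definition Cc_infty U : set ('rV[R]_n -> R) :=
  [set phi | [/\ forall k, Ck k phi,
                 compact (closure [set x | phi x != 0]) &
                 closure [set x | phi x != 0] `<=` U]].

Definition L1_loc U : set ('rV[R]_n -> R) :=
  [set f | measurable_fun U f /\
    forall K, compact K -> K `<=` U -> leb.-integrable K (EFin \o f)].

Definition L2 U : set ('rV[R]_n -> R) := [set f | f \_ U \in Lfun leb 2%:E].

(* Essentially bounded functions vanishing a.e. outside a compact subset of U. *)
Definition Linfty_c U : set ('rV[R]_n -> R) :=
  [set f | f \in Lfun leb +oo%E /\
    exists K, [/\ compact K, K `<=` U & {ae leb, forall x, ~ K x -> f x = 0}]].

Definition is_wpartial U (i : 'I_n) f g : Prop :=
  [/\ L1_loc U f, L1_loc U g &
      forall phi, Cc_infty U phi ->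
        \int[leb]_(x in U) (f x * partial i phi x) =
        - \int[leb]_(x in U) (g x * phi x)].

(* The weak partial derivative, unique up to a null set; 0 if there is none. *)
Definition wpartial U (i : 'I_n) f : 'rV[R]_n -> R :=
  xget (fun=> 0) [set g | is_wpartial U i f g].

Definition H1 U : set ('rV[R]_n -> R) :=
  [set f | L2 U f /\ forall i, exists2 g, is_wpartial U i f g & L2 U g].

Definition H1_loc U : set ('rV[R]_n -> R) :=
  [set f | forall K, open K -> compact (closure K) -> closure K `<=` U ->
    H1 K f].

Definition H10 U : set ('rV[R]_n -> R) :=
  [set f | H1 setT f /\ {ae leb, forall x, ~ U x -> f x = 0}].

Definition H1_norm f : R :=
  Num.sqrt (\int[leb]_x (f x ^+ 2)
            + \sum_(i < n) \int[leb]_x (wpartial setT i f x ^+ 2)).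

(* Continuous linear functionals on H10 U, as functions on representatives;
   boundedness makes them invariant under a.e. equality. The values outside
   H10 U are irrelevant. *)
Definition Hm1 U : set (('rV[R]_n -> R) -> R) :=
  [set w | (forall a f g, H10 U f -> H10 U g ->
              w (a \*o f \+ g) = a * w f + w g) /\
           exists C : R, forall f, H10 U f -> `|w f| <= C * H1_norm f].

(* The distribution phi |-> w phi is given by a locally integrable function. *)
Definition in_L1_loc U (w : ('rV[R]_n -> R) -> R) : Prop :=
  exists2 f, L1_loc U f &
    forall phi, Cc_infty U phi -> w phi = \int[leb]_(x in U) (f x * phi x).

End function_spaces.

Section problems.
Context {R : realType} {n : nat}.
Implicit Types (Omega : set 'rV[R]_n) (f phi u v : 'rV[R]_n -> R).

(* Near each boundary point, after an orthogonal change of coordinates, Omega is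
   the strict epigraph over the j-th coordinate hyperplane of a C^{1,1}
   function of the n - 1 other coordinates. *)
Definition C11_boundary Omega : Prop :=
  forall x0, closure Omega x0 -> ~ interior Omega x0 ->
  exists (Q : 'M[R]_n) (j : 'I_n) (psi : 'rV[R]_n.-1 -> R),
    [/\ Q *m Q^T = 1%:M, C11 psi &
        \forall x \near x0,
          Omega x <-> psi (col' j (x *m Q)) < (x *m Q) ord0 j].

Definition bounded_C11_domain Omega : Prop :=
  [/\ Omega !=set0, open Omega, connected Omega, bounded_set Omega &
      C11_boundary Omega].

Definition enorm (x : 'rV[R]_n) : R := Num.sqrt (\sum_(i < n) x ord0 i ^+ 2).

Definition energy (s : R) Omega f phi : R :=
  \int[leb]_(x in Omega)
    (\sum_(i < n) wpartial Omega i f x * wpartial Omega i phi x)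
  + \int[(leb \x leb)%E]_z ((f z.1 - f z.2) * (phi z.1 - phi z.2)
      * enorm (z.1 - z.2) `^ (- (n%:R + 2 * s))).

Definition nonpos_on_boundary Omega u : Prop :=
  {ae leb, forall x, ~ Omega x -> u x = 0} /\
  forall e : R, 0 < e -> H10 Omega (fun x => Num.max (u x - e) 0).

Definition positive_singular (gamma : R) Omega u : Prop :=
  {ae leb, forall x, Omega x -> 0 < u x} /\
  L1_loc Omega (fun x => u x `^ (- gamma)).

Definition problemG (s gamma : R) Omega (w : ('rV[R]_n -> R) -> R) u : Prop :=
  [/\ positive_singular gamma Omega u,
      forall phi, Cc_infty Omega phi ->
        energy s Omega u phi
        - \int[leb]_(x in Omega) (u x `^ (- gamma) * phi x)
        = w phi &
      nonpos_on_boundary Omega u].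

Definition problemH (s gamma : R) Omega (w : ('rV[R]_n -> R) -> R) u : Prop :=
  [/\ positive_singular gamma Omega u,
      forall v, (H10 Omega `&` Linfty_c Omega) (v \- u) ->
        {ae leb, forall x, Omega x -> 0 <= v x} ->
        energy s Omega u (v \- u)
        - \int[leb]_(x in Omega) (u x `^ (- gamma) * (v x - u x))
        >= w (v \- u) &
      nonpos_on_boundary Omega u].

End problems.

(* Main.v *)
Require Import Defs.
From mathcomp Require Import all_boot all_order all_algebra.
From mathcomp Require Import all_classical all_reals all_analysis.
From mathcomp Require Import measurable_realfun.
From mathcomp Require Import ring lra.
Import Order.TTheory GRing.Theory Num.Theory.
Import numFieldNormedType.Exports.
Local Open Scope classical_set_scope.
Local Open Scope ring_scope.
Set Implicit Arguments.
Unset Strict Implicit.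
Unset Printing Implicit Defensive.

(* Let Lam psi = E(u, psi) - <w, psi>. On the functions of H_0^1 supported in a fixed compact
   subset of Omega, Lam is bounded for the H^1 norm: near the support, u may be replaced by a
   cut-off eta u in H^1(R^n), whose fractional seminorm is finite by the L^2 translation estimate,
   and the remaining part of u interacts only at distances bounded below, where the kernel is
   bounded. By mollification, an identity Lam psi = int a psi with a locally integrable extends
   from test functions to the bounded compactly supported psi in H_0^1: this gives (G) => (H).
   Conversely, (H) is tested with v = u + t phi + (t phi + u)^-. Completing the square gives
   E(u, (t phi + u)^-) <= (t^2 / 4) E(phi, phi), the singular term has a sign, and w, which extends
   by the same density argument, contributes o(t) by dominated convergence, because
   (t phi + u)^- <= t |phi| vanishes for small t wherever u > 0. The inequality obtained for phi
   and - phi is the weak equation. *)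

(** * Square-integrable functions *)

(** [u] is only locally H^1 and integrable, so neither term of the form at (u, psi) is visibly
    finite, and the integral is additive only on integrable functions: each splitting of the energy
    therefore comes with an integrability proof. Writing u = f + g with f = eta u, the product g psi
    vanishes, and only the cross terms g(x) psi(y) survive; the kernel being bounded there, g and
    psi in L^1 suffice.

    The test function in the converse is the truncation (u + t phi)^+. It is forced by the fact that
    [u] need not have a positive lower bound on the support of phi, so that u + t phi may take
    negative values for every t > 0. The constant t^2 / 4 comes from the maximum t^2 p^2 / 4 over q
    of - q (q + t p), where q stands for a difference or derivative of u and p for that of phi. For
    w merely in H^{-1}, the contribution of (t phi + u)^- is controlled only by its H^1 norm, which
    by itself gives no o(t); the density of w is what allows dominated convergence. *)

Section integrable_toolkit.
Context d (T : measurableType d) (R : realType).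
Variable mu : {measure set T -> \bar R}.
Implicit Types f g h : T -> R.

Definition intg f := mu.-integrable setT (EFin \o f).

Lemma intg_measurable f : intg f -> measurable_fun setT f.
Proof. by move=> /integrableP[/measurable_EFinP]. Qed.

Lemma intgD f g : intg f -> intg g -> intg (fun x => f x + g x).
Proof. by move=> hf hg; have := integrableD measurableT hf hg. Qed.

Lemma intgZ c f : intg f -> intg (fun x => c * f x).
Proof. by move=> hf; have := integrableZl measurableT c hf. Qed.

Lemma intgN f : intg f -> intg (fun x => - f x).
Proof. by move=> /(intgZ (-1)); under eq_fun do rewrite mulN1r. Qed.

Lemma intgB f g : intg f -> intg g -> intg (fun x => f x - g x).
Proof. by move=> hf hg; exact: intgD hf (intgN hg). Qed.

Lemma intg_le f g : measurable_fun setT f -> (forall x, `|f x| <= g x) ->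
  intg g -> intg f.
Proof.
move=> mf fg; apply: le_integrable => //; first exact/measurable_EFinP.
by move=> x _ /=; rewrite lee_fin (le_trans (fg x))// ler_norm.
Qed.

Lemma intg_abs f : intg f -> intg (fun x => `|f x|).
Proof.
move=> hf; have := integrable_abse hf.
by apply: eq_integrable.
Qed.

Lemma intg0 : intg (fun=> 0).
Proof. exact: integrable0. Qed.

Lemma intg_indic (A : set T) : measurable A -> (mu A < +oo)%E -> intg \1_A.
Proof.
move=> mA Aoo; apply/integrableP; split.
  by apply/measurable_EFinP; exact: measurable_indic.
under eq_integral => x _ do rewrite gee0_abs ?lee_fin//.
by rewrite integral_indic// setIT.
Qed.

Lemma intg_sum (I : Type) (r : seq I) (F : I -> T -> R) :
  (forall i, intg (F i)) -> intg (fun x => \sum_(i <- r) F i x).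
Proof.
move=> h; elim: r => [|i r IH].
  by under eq_fun do rewrite big_nil; exact: intg0.
by under eq_fun do rewrite big_cons; exact: intgD.
Qed.

Lemma RintD f g : intg f -> intg g ->
  \int[mu]_x (f x + g x) = \int[mu]_x f x + \int[mu]_x g x.
Proof. by move=> hf hg; rewrite RintegralD. Qed.

Lemma RintB f g : intg f -> intg g ->
  \int[mu]_x (f x - g x) = \int[mu]_x f x - \int[mu]_x g x.
Proof. by move=> hf hg; rewrite RintegralB. Qed.

Lemma RintZ c f : intg f -> \int[mu]_x (c * f x) = c * \int[mu]_x f x.
Proof. by move=> hf; rewrite RintegralZl. Qed.

Lemma RintN f : intg f -> \int[mu]_x (- f x) = - \int[mu]_x f x.
Proof.
move=> hf; under eq_Rintegral do rewrite -mulN1r.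
by rewrite RintZ// mulN1r.
Qed.

Lemma Rint_sum (I : Type) (r : seq I) (F : I -> T -> R) :
  (forall i, intg (F i)) ->
  \int[mu]_x (\sum_(i <- r) F i x) = \sum_(i <- r) \int[mu]_x F i x.
Proof.
move=> h; elim: r => [|i r IH].
  rewrite big_nil; under eq_Rintegral do rewrite big_nil.
  by rewrite /Rintegral integral0.
rewrite big_cons -IH -RintD//; last exact: intg_sum.
by apply: eq_Rintegral => x _; rewrite big_cons.
Qed.

Lemma Rint_le f g : intg f -> intg g -> (forall x, f x <= g x) ->
  \int[mu]_x f x <= \int[mu]_x g x.
Proof. by move=> hf hg fg; apply: le_Rintegral. Qed.

Lemma Rint_norm f : intg f -> `|\int[mu]_x f x| <= \int[mu]_x `|f x|.
Proof. by move=> hf; exact: le_normr_Rintegral. Qed.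

Lemma EFin_Rint f : intg f -> (\int[mu]_x f x)%:E = (\int[mu]_x (f x)%:E)%E.
Proof. by move=> hf; rewrite fineK//; exact: integrable_fin_num. Qed.

Lemma Rint_ae_eq f g : measurable_fun setT f -> measurable_fun setT g ->
  {ae mu, forall x, f x = g x} -> \int[mu]_x f x = \int[mu]_x g x.
Proof.
move=> mf mg fg; rewrite /Rintegral; congr fine.
apply: ae_eq_integral => //; [exact/measurable_EFinP|exact/measurable_EFinP|].
by apply: filterS fg => x /= -> _.
Qed.

Lemma intg_ae_eq f g : measurable_fun setT g ->
  {ae mu, forall x, f x = g x} -> intg f -> intg g.
Proof.
move=> mg fg hf; have mf := intg_measurable hf.
apply/integrableP; split; first exact/measurable_EFinP.
move: hf => /integrableP[_]; congr (_ < _)%E.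
apply: ae_eq_integral => //;
  try by apply: measurableT_comp => //; exact/measurable_EFinP.
by apply: filterS fg => x /= -> _.
Qed.

(** The inequality is made pointwise by replacing [g] with [max f g], which equals it almost
    everywhere. *)
Lemma Rint_ae_le f g : intg f -> intg g ->
  {ae mu, forall x, f x <= g x} -> \int[mu]_x f x <= \int[mu]_x g x.
Proof.
move=> hf hg fg.
have [mf mg] := (intg_measurable hf, intg_measurable hg).
pose h x := Num.max (f x) (g x).
have gh : {ae mu, forall x, g x = h x}.
  by apply: filterS fg => x fg; rewrite /h max_r.
have mh : measurable_fun setT h by exact: measurable_maxr.
rewrite (Rint_ae_eq mg mh gh); apply: Rint_le => //.
  exact: intg_ae_eq gh hg.
by move=> x; rewrite /h le_max lexx.
Qed.

Lemma Rint_dct (f_ : nat -> T -> R) f g :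
  (forall k, measurable_fun setT (f_ k)) -> measurable_fun setT f ->
  {ae mu, forall x, f_ k x @[k --> \oo] --> f x} ->
  intg g -> {ae mu, forall x, forall k, `|f_ k x| <= g x} ->
  intg f /\ (\int[mu]_x f_ k x) @[k --> \oo] --> \int[mu]_x f x.
Proof.
move=> mf_ mf cvf ig fg.
have a1 k : measurable_fun setT (EFin \o f_ k) by exact/measurable_EFinP.
have a2 : measurable_fun setT (EFin \o f) by exact/measurable_EFinP.
have a3 : {ae mu, forall x, setT x -> (EFin \o f_ k) x @[k --> \oo] --> (EFin \o f) x}.
  by apply: filterS cvf => x cv _; apply: cvg_EFin => //; exact: nearW.
have a4 : {ae mu, forall x, forall k, setT x -> (`|(EFin \o f_ k) x| <= (EFin \o g) x)%E}.
  by apply: filterS fg => x le k _ /=; rewrite lee_fin.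
have [h1 _ h2] := dominated_convergence measurableT a1 a2 a3 ig a4.
split => //; apply: fine_cvg.
by rewrite EFin_Rint//.
Qed.

Lemma Rint_in (D : set T) f : \int[mu]_(x in D) f x = \int[mu]_x (f \_ D) x.
Proof. exact: Rintegral_mkcond. Qed.

Lemma intg_in (D : set T) f : measurable D ->
  mu.-integrable D (EFin \o f) <-> intg (f \_ D).
Proof.
move=> mD; rewrite /intg.
have -> : EFin \o f \_ D = (EFin \o f) \_ D by rewrite restrict_EFin.
by split => [|]; rewrite -(integrable_mkcond _ mD).
Qed.

Definition sqi f := measurable_fun setT f /\ intg (fun x => f x ^+ 2).

(** The squared L2 norm. Keeping the square avoids square roots; the price is the factor 2 in
    [nrm2D] and [nrm2B]. *)
Definition nrm2 f := \int[mu]_x (f x ^+ 2).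

Lemma nrm2_ge0 f : 0 <= nrm2 f.
Proof. by apply: Rintegral_ge0 => x _; exact: sqr_ge0. Qed.

Lemma sqi_le f g : measurable_fun setT f -> (forall x, `|f x| <= `|g x|) ->
  sqi g -> sqi f.
Proof.
move=> mf fg [mg ig]; split => //; apply: intg_le ig; first exact: measurable_funX.
by move=> x; rewrite normrX -[leRHS]real_normK ?num_real// lerXn2r ?nnegrE.
Qed.

Lemma sqi_bound f g : measurable_fun setT f -> (forall x, f x ^+ 2 <= g x) ->
  intg g -> sqi f.
Proof.
move=> mf fg ig; split => //; apply: intg_le ig; first exact: measurable_funX.
by move=> x; rewrite ger0_norm// sqr_ge0.
Qed.

Lemma sqi_mul f g : sqi f -> sqi g -> intg (fun x => f x * g x).
Proof.
move=> [mf jf] [mg jg]; apply: intg_le (intgD jf jg); first exact: measurable_funM.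
move=> x; rewrite ler_norml; apply/andP; split.
  by have := sqr_ge0 (f x + g x); nra.
by have := sqr_ge0 (f x - g x); nra.
Qed.

Lemma sqiZ c f : sqi f -> sqi (fun x => c * f x).
Proof.
move=> [mf jf]; split; first exact: measurable_funM.
by under eq_fun do rewrite exprMn; exact: intgZ.
Qed.

Lemma sqiN f : sqi f -> sqi (fun x => - f x).
Proof. by move=> /(sqiZ (-1)); under eq_fun do rewrite mulN1r. Qed.

Lemma sqiD f g : sqi f -> sqi g -> sqi (fun x => f x + g x).
Proof.
move=> [mf jf] [mg jg]; apply: sqi_bound (intgD (intgZ 2 jf) (intgZ 2 jg)).
  exact: measurable_funD.
by move=> x; have := sqr_ge0 (f x - g x); nra.
Qed.

Lemma sqiB f g : sqi f -> sqi g -> sqi (fun x => f x - g x).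
Proof. by move=> hf hg; exact: sqiD hf (sqiN hg). Qed.

Lemma sqi0 : sqi (fun=> 0).
Proof. by split => //; under eq_fun do rewrite expr0n; exact: intg0. Qed.

Lemma sqi_sum (I : Type) (r : seq I) (F : I -> T -> R) :
  (forall i, sqi (F i)) -> sqi (fun x => \sum_(i <- r) F i x).
Proof.
move=> h; elim: r => [|i r IH].
  by under eq_fun do rewrite big_nil; exact: sqi0.
by under eq_fun do rewrite big_cons; exact: sqiD.
Qed.

Lemma sqi_ae_eq f g : measurable_fun setT g ->
  {ae mu, forall x, f x = g x} -> sqi f -> sqi g.
Proof.
move=> mg fg [mf jf]; split => //; apply: intg_ae_eq jf; first exact: measurable_funX.
by apply: filterS fg => x ->.
Qed.

Lemma nrm2_ae_eq f g : measurable_fun setT f -> measurable_fun setT g ->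
  {ae mu, forall x, f x = g x} -> nrm2 f = nrm2 g.
Proof.
move=> mf mg fg; apply: Rint_ae_eq; try exact: measurable_funX.
by apply: filterS fg => x ->.
Qed.

Lemma nrm2Z c f : sqi f -> nrm2 (fun x => c * f x) = c ^+ 2 * nrm2 f.
Proof.
move=> [mf jf]; rewrite /nrm2 -RintZ//.
by apply: eq_Rintegral => x _; rewrite exprMn.
Qed.

Lemma nrm2D f g : sqi f -> sqi g ->
  nrm2 (fun x => f x + g x) <= 2 * nrm2 f + 2 * nrm2 g.
Proof.
move=> hf hg; have [_ hfg] := sqiD hf hg; move: hf hg => [mf jf] [mg jg].
rewrite /nrm2 -!RintZ// -RintD; [|exact: intgZ|exact: intgZ].
apply: Rint_le => //; first by apply: intgD; exact: intgZ.
by move=> x; have := sqr_ge0 (f x - g x); nra.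
Qed.

Lemma nrm2B f g : sqi f -> sqi g ->
  nrm2 (fun x => f x - g x) <= 2 * nrm2 f + 2 * nrm2 g.
Proof.
move=> hf hg; apply: (le_trans (nrm2D hf (sqiN hg))).
suff -> : nrm2 (fun x => - g x) = nrm2 g by [].
by apply: eq_Rintegral => x _; rewrite sqrrN.
Qed.

Lemma nrm2_le f g : measurable_fun setT f -> sqi g ->
  (forall x, `|f x| <= `|g x|) -> nrm2 f <= nrm2 g.
Proof.
move=> mf hg fg; have [_ jf] := sqi_le mf fg hg; have [_ jg] := hg.
apply: Rint_le => // x.
by rewrite -real_normK ?num_real// -[leRHS]real_normK ?num_real// lerXn2r ?nnegrE.
Qed.

Lemma nrm2_trunc_sum m (F : nat -> T -> R) : (forall i, sqi (F i)) ->
  nrm2 (fun x => \sum_(i < m) F i x) <= m%:R * \sum_(i < m) nrm2 (F i).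
Proof.
move=> h.
(* Cauchy-Schwarz: the right side minus the left side is half the double sum of (a_i - a_j)^2. *)
have cs (a : nat -> R) : (\sum_(i < m) a i) ^+ 2 <= m%:R * \sum_(i < m) a i ^+ 2.
  have : 0 <= \sum_(i < m) \sum_(j < m) (a i - a j) ^+ 2.
    by apply: sumr_ge0 => i _; apply: sumr_ge0 => j _; exact: sqr_ge0.
  have -> : \sum_(i < m) \sum_(j < m) (a i - a j) ^+ 2 =
      2 * (m%:R * \sum_(i < m) a i ^+ 2) - 2 * (\sum_(i < m) a i) ^+ 2.
    transitivity (\sum_(i < m) \sum_(j < m) a i ^+ 2 +
        \sum_(i < m) \sum_(j < m) a j ^+ 2 -
        2 * \sum_(i < m) \sum_(j < m) a i * a j).
      rewrite mulr_sumr -big_split/= -sumrB; apply: eq_bigr => i _.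
      rewrite mulr_sumr -big_split/= -sumrB; apply: eq_bigr => j _.
      by ring.
    have -> : \sum_(i < m) \sum_(j < m) a i * a j = (\sum_(i < m) a i) ^+ 2.
      by rewrite expr2 mulr_suml; apply: eq_bigr => i _; rewrite mulr_sumr.
    have -> : \sum_(i < m) \sum_(j < m) a i ^+ 2 = m%:R * \sum_(i < m) a i ^+ 2.
      by rewrite mulr_sumr; apply: eq_bigr => i _; rewrite sumr_const card_ord mulr_natl.
    by rewrite sumr_const card_ord mulr_natl; lra.
  by lra.
rewrite /nrm2 -Rint_sum; last by move=> i; have [] := h i.
rewrite -RintZ; last by apply: intg_sum => i; have [] := h i.
apply: Rint_le.
- by have [] := @sqi_sum _ (index_enum 'I_m) (fun i : 'I_m => F i) (fun i => h i).
- by apply: intgZ; apply: intg_sum => i; have [] := h i.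
- by move=> x; exact: (cs (F ^~ x)).
Qed.

(** Young's inequality with a free parameter replaces Cauchy-Schwarz, so that several such bounds
    can be added before the parameter is optimised. *)
Lemma ip_bound f g e : 0 < e -> sqi f -> sqi g ->
  `|\int[mu]_x (f x * g x)| <= e * nrm2 f + e^-1 * nrm2 g.
Proof.
move=> e0 hf hg; have fg := sqi_mul hf hg.
apply: (le_trans (Rint_norm fg)).
move: hf hg => [mf jf] [mg jg]; rewrite /nrm2 -!RintZ//.
rewrite -RintD; [|exact: intgZ..].
apply: Rint_le; [exact: intg_abs|by apply: intgD; exact: intgZ|].
move=> x; have ei : e * e^-1 = 1 by rewrite divff// gt_eqF.
have ei0 : 0 < e^-1 by rewrite invr_gt0.
suff : 2 * `|f x * g x| <= e * f x ^+ 2 + e^-1 * g x ^+ 2.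
  by have := normr_ge0 (f x * g x); lra.
have -> : 2 * `|f x * g x| = 2 * `|f x| * `|g x| by rewrite normrM mulrA.
rewrite -[f x ^+ 2]real_normK ?num_real// -[g x ^+ 2]real_normK ?num_real//.
have := mulr_ge0 (ltW ei0) (sqr_ge0 (e * `|f x| - `|g x|)).
suff -> : e^-1 * (e * `|f x| - `|g x|) ^+ 2 =
  (e * e^-1) * e * `|f x| ^+ 2 - 2 * (e * e^-1) * `|f x| * `|g x| + e^-1 * `|g x| ^+ 2.
  by rewrite ei; lra.
by ring.
Qed.

Lemma ip_cvg f g (g_ : nat -> T -> R) : sqi f -> sqi g ->
  (forall k, sqi (g_ k)) ->
  nrm2 (fun x => g_ k x - g x) @[k --> \oo] --> 0 ->
  \int[mu]_x (f x * g_ k x) @[k --> \oo] --> \int[mu]_x (f x * g x).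
Proof.
move=> hf hg hg_ /cvgrPdist_le cv; apply/cvgrPdist_le => e e0.
have N0 := nrm2_ge0 f.
(* Chosen so that [c * nrm2 f] is at most e / 2; the [+ 1] covers [nrm2 f = 0]. *)
pose c := e / (2 * (nrm2 f + 1)).
have c0 : 0 < c by rewrite divr_gt0// mulr_gt0// ltr_wpDl.
have ce : c * nrm2 f <= e / 2.
  rewrite /c invfM mulrA -mulrA ler_piMr//; first by rewrite divr_ge0// ltW.
  by rewrite mulrC ler_pdivrMr ?ltr_wpDl// mul1r lerDl.
have ce2 : 0 < c * (e / 2) by rewrite mulr_gt0// divr_gt0.
near=> k.
have hk : sqi (fun x => g_ k x - g x) by exact: sqiB.
rewrite distrC -RintB; [|exact: sqi_mul..].
under eq_Rintegral do rewrite -mulrBr.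
apply: (le_trans (ip_bound c0 hf hk)).
have : nrm2 (fun x => g_ k x - g x) <= c * (e / 2).
  near: k; apply: filterS (cv _ ce2) => k; rewrite sub0r normrN ger0_norm//.
  exact: nrm2_ge0.
move=> h; have : c^-1 * nrm2 (fun x => g_ k x - g x) <= e / 2.
  by rewrite mulrC ler_pdivrMr// mulrC.
by lra.
Unshelve. all: by end_near. Qed.

Lemma cvg_pow2 : (2^-1 ^+ k : R) @[k --> \oo] --> 0.
Proof. by apply: cvg_expr; rewrite ger0_norm ?invr_ge0// invf_lt1 ?ltr1n. Qed.

(** The sum of the squares has integral at most 2, hence is finite almost everywhere, and the terms
    of a convergent series tend to 0. With summable errors no subsequence has to be extracted. *)
Lemma ae_cvg0_summable (h_ : nat -> T -> R) : (forall k, sqi (h_ k)) ->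
  (forall k, nrm2 (h_ k) <= 2^-1 ^+ k) ->
  {ae mu, forall x, h_ k x @[k --> \oo] --> 0}.
Proof.
move=> hh hk.
pose F k x := ((h_ k x) ^+ 2)%:E.
have mF k : measurable_fun setT (F k).
  by apply/measurable_EFinP; apply: measurable_funX; have [] := hh k.
have F0 k x : (0 <= F k x)%E by rewrite lee_fin sqr_ge0.
pose S x := (\sum_(0 <= k <oo) F k x)%E.
have mS : measurable_fun setT S by apply: ge0_emeasurable_sum => //.
have S0 x : (0 <= S x)%E by apply: nneseries_ge0.
have iS : (\int[mu]_x S x < +oo)%E.
  rewrite integral_nneseries//.
  apply: (@le_lt_trans _ _ (\sum_(0 <= k <oo) (2^-1 ^+ k)%:E)%E).
    apply: lee_nneseries => [k _ _|k _]; first exact: integral_ge0.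
    rewrite -EFin_Rint ?lee_fin//; last by have [] := hh k.
    exact: hk.
  have p0 k : 0 <= 2^-1 ^+ k :> R by rewrite exprn_ge0 ?invr_ge0.
  apply: (@le_lt_trans _ _ 2%:E); last by rewrite ltry.
  apply: lime_le; first by apply: is_cvg_nneseries => k _ _; rewrite lee_fin.
  apply: nearW => k; rewrite sumEFin lee_fin.
  suff -> : \sum_(0 <= i < k) (2^-1 ^+ i : R) = 2 - 2 * 2^-1 ^+ k.
    by rewrite gerBl mulr_ge0.
  elim: k => [|k IH]; first by rewrite big_geq// expr0; lra.
  by rewrite big_nat_recr//= IH exprS; lra.
have iS' : mu.-integrable setT S.
  apply/integrableP; split => //.
  by under eq_integral => x _ do rewrite gee0_abs//.
have := integrable_ae measurableT iS'; apply: filterS => x /(_ I) fx.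
have c0 : h_ k x ^+ 2 @[k --> \oo] --> 0.
  apply: cvg_series_cvg_0; apply: nondecreasing_is_cvgn.
    apply/nondecreasing_seqP => k; rewrite /series /= big_nat_recr//= lerDl.
    exact: sqr_ge0.
  exists (fine (S x)) => _ [k _ <-]; rewrite -lee_fin fineK//.
  rewrite /series /= -sumEFin; apply: nneseries_lim_ge => i _ _.
  exact: F0.
apply/cvgrPdist_le => e e0.
have e20 : 0 < e ^+ 2 by rewrite exprn_gt0.
move/cvgrPdist_le : c0 => /(_ _ e20).
apply: filterS => k /=; rewrite !sub0r !normrN normrX.
by rewrite ler_sqr ?nnegrE// ltW.
Qed.

Import HBNNSimple.

Lemma simple_approximation f : measurable_fun setT f -> (forall x, 0 <= f x) ->
  exists F : nat -> T -> R, [/\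
    forall k, exists (r : seq R) (A : R -> set T),
      (forall c, measurable (A c)) /\ F k = (fun x => \sum_(c <- r) c * \1_(A c) x),
    forall k x, 0 <= F k x <= f x &
    forall x, F k x @[k --> \oo] --> f x].
Proof.
move=> mf f0.
have mEf : measurable_fun setT (EFin \o f) by exact/measurable_EFinP.
have Ef0 x : setT x -> (0 <= (EFin \o f) x)%E by rewrite lee_fin.
pose g_ := nnsfun_approx measurableT mEf.
exists (fun k => g_ k : T -> R); split => [k|k x|x].
- exists (finmap.enum_fset (fset_set (range (g_ k)))), (fun c => g_ k @^-1` [set c]); split.
    by move=> c; exact: measurable_sfunP.
  by apply/funext => x; rewrite [in LHS](fimfunE (g_ k)) fsbig_finite.
- apply/andP; split; first exact: fun_ge0.
  by rewrite -lee_fin /g_ nnsfun_approxE; exact: (le_approx k Ef0 I).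
- by have /fine_cvgP[_] := cvg_nnsfun_approx measurableT mEf Ef0 (x := x) I.
Qed.

End integrable_toolkit.

(** * Lebesgue measure on R^n *)

Section rV_topology.
Context {R : realType} {n : nat}.
Implicit Types (x y h : 'rV[R]_n) (U : set 'rV[R]_n).

(** The norm on row vectors is the sup norm: balls are cubes and are handled one coordinate at a
    time. *)
Lemma rV_norm_le x r : 0 <= r -> (forall i, `|x ord0 i| <= r) -> `|x| <= r.
Proof.
move=> r0 xr; rewrite -[`|x|]/(mx_norm x) mx_normrE.
apply/bigmax_leP; split => // -[i j] _ /=.
by rewrite ord1.
Qed.

Lemma rV_norm_lt x r : 0 < r -> (forall i, `|x ord0 i| < r) -> `|x| < r.
Proof.
move=> r0 xr; rewrite -[`|x|]/(mx_norm x) mx_normrE.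
apply/bigmax_ltP; split => // -[i j] _ /=.
by rewrite ord1.
Qed.

Lemma rV_coord_le x i : `|x ord0 i| <= `|x|.
Proof.
rewrite -[`|x|]/(mx_norm x) mx_normrE.
exact: (le_bigmax_cond _ (fun ij : 'I_1 * 'I_n => `|x ij.1 ij.2|) (j := (ord0, i))).
Qed.

Lemma measurable_cball x r : measurable [set y : 'rV[R]_n | `|y - x| <= r].
Proof.
have [r0|r0] := ltP r 0.
  rewrite (_ : [set _ | _] = set0)//; apply/seteqP; split => // y /= yr.
  by have := le_lt_trans yr r0; rewrite normr_lt0.
rewrite (_ : [set _ | _] = \bigcap_(i in [set: 'I_n])
    (fun y : 'rV[R]_n => y ord0 i) @^-1` `[x ord0 i - r, x ord0 i + r]%classic).
  apply: fin_bigcap_measurable => // i _.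
  by rewrite -[X in measurable X]setTI; exact: measurable_coord.
apply/seteqP; split => y /= h.
  move=> i _ /=; rewrite in_itv/= -ler_distl distrC.
  by rewrite distrC; have := le_trans (rV_coord_le (y - x) i) h; rewrite !mxE distrC.
apply: rV_norm_le => // i; have := h i I; rewrite /= in_itv/= -ler_distl !mxE.
by rewrite distrC.
Qed.

(** A countable family of closed cubes, used both for the measurability of open sets and for
    exhausting an open set by compact sets. *)
Definition rat_ball (p : 'rV[rat]_n * nat) : set 'rV[R]_n :=
  [set y | `|y - map_mx ratr p.1| <= p.2.+1%:R^-1].

Lemma rat_approx x e : 0 < e -> exists q : 'rV[rat]_n, `|x - map_mx ratr q| < e.
Proof.
move=> e0.
have /choice[q qP] (i : 'I_n) : exists q : rat, `|x ord0 i - ratr q| < e.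
  have : x ord0 i - e < x ord0 i + e by lra.
  move=> /rat_in_itvoo[q]; rewrite in_itv/= => qi; exists q.
  by rewrite distrC ltr_distl.
exists (\row_i q i); apply: rV_norm_lt => // i; rewrite !mxE; exact: qP.
Qed.

Lemma open_rat_ball U x : open U -> U x ->
  exists p, rat_ball p `<=` U /\ nbhs x (rat_ball p).
Proof.
move=> oU Ux; have : nbhs x U by exact: open_nbhs_nbhs.
move=> /nbhs_ballP[e /= e0 eU].
have [k ke] : exists k, (k.+1%:R^-1 : R) < e / 2.
  have e20 : 0 < e / 2 by lra.
  have [k _ kP] := near_infty_natSinv_lt (PosNum e20).
  by exists k; apply: (kP k) => /=.
have k0 : 0 < (k.+1%:R^-1 : R) by rewrite invr_gt0.
have k20 : 0 < (k.+1%:R^-1 : R) / 2 by rewrite divr_gt0.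
(* A centre within half the radius makes the cube a neighbourhood of [x]; a radius below e / 2 keeps
   it inside [U]. *)
have [q qx] := rat_approx x k20.
exists (q, k); split => [y|]; rewrite /rat_ball /=.
  move=> yq; apply: eU; rewrite -ball_normE /=.
  have := ler_distD (map_mx ratr q) x y; rewrite (distrC _ y).
  rewrite (distrC y x) (distrC _ y); move: yq qx ke.
  by rewrite (distrC _ y); move: (k.+1%:R^-1 : R) => c; lra.
apply/nbhs_ballP; exists (k.+1%:R^-1 / 2); first by rewrite /= divr_gt0.
move=> y; rewrite -ball_normE /= => xy.
have := ler_distD x y (map_mx ratr q); rewrite (distrC y x); move: xy qx.
by move: (k.+1%:R^-1 : R) => c; lra.
Qed.

(** The sigma-algebra is generated by the coordinates, so an open set has to be exhibited as a
    countable union of rational cubes. Indices that do not encode a cube inside [U] contribute the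
    empty set. *)
Lemma open_measurable_rV U : open U -> measurable U.
Proof.
move=> oU.
pose B k : set 'rV[R]_n := if unpickle k is Some p then
  (if `[< rat_ball p `<=` U >] then rat_ball p else set0) else set0.
rewrite (_ : U = \bigcup_k B k).
  apply: bigcup_measurable => k _; rewrite /B; case: unpickle => // p.
  by case: asboolP => // _; exact: measurable_cball.
apply/seteqP; split => [x Ux|x [k _]].
  have [p [pU /nbhs_singleton xp]] := open_rat_ball oU Ux.
  by exists (pickle p) => //; rewrite /B pickleK asboolT.
by rewrite /B; case: unpickle => // p; case: asboolP => // pU; exact: pU.
Qed.

Lemma closed_measurable_rV U : closed U -> measurable U.
Proof.
by move=> cU; rewrite -[U]setCK; apply: measurableC; apply: open_measurable_rV; exact: closed_openC.
Qed.

Lemma compact_measurable_rV U : compact U -> measurable U.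
Proof. by move=> cU; apply: closed_measurable_rV; apply: compact_closed. Qed.

Lemma continuous_measurable_rV (f : 'rV[R]_n -> R) : continuous f ->
  measurable_fun setT f.
Proof.
move=> cf; apply: (measurability _ (RGenOInfty.measurableE R)).
move=> _ [_ [a ->] <-]; rewrite setTI; apply: open_measurable_rV.
by move/continuousP : cf => /(_ _ (@open_gt R a)); rewrite set_itvE.
Qed.

Lemma rV_cball_compact x r : compact [set y : 'rV[R]_n | `|y - x| <= r].
Proof.
apply: bounded_closed_compact.
  exists (`|x| + `|r|); split; first exact: num_real.
  move=> M MB y /= yr; apply: ltW; apply: le_lt_trans MB.
  rewrite -(subrK x y); apply: (le_trans (ler_normD _ _)).
  by rewrite addrC lerD2l (le_trans yr)// ler_norm.
rewrite (_ : [set _ | _] = (fun y => `|y - x|) @^-1` [set t | t <= r])//.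
apply: closed_comp; last exact: closed_le.
move=> y _.
have h : (fun y : 'rV[R]_n => y - x) z @[z --> y] --> y - x.
  exact: (cvgB (@cvg_id _ (nbhs y)) (cvg_cst x)).
exact: (cvg_norm h).
Qed.

Lemma measurable_translate h : measurable_fun setT (fun x : 'rV[R]_n => x + h).
Proof.
apply/measurable_fun_rVP => i; under eq_fun do rewrite mxE.
by apply: measurable_funD => //; exact: measurable_coord.
Qed.

End rV_topology.

(** * Translation invariance of the Lebesgue measure and of the integral *)

Section translation.
Context {R : realType}.

(** The image measure under a translation agrees with Lebesgue measure on half-open intervals, and
    these determine it. *)
Lemma lebesgue_translate (a : R) (A : set R) : measurable A ->
  lebesgue_measure ((fun x => x + a) @^-1` A) = lebesgue_measure A.
Proof.
have ma : measurable_fun [set: measurableTypeR R] (fun x : measurableTypeR R => x + a : measurableTypeR R).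
  have h : measurable_fun [set: R] (fun x : R => x + a) by exact: measurable_funD.
  exact h.
pose m' := measure_function_pushforward__canonical__measure_function_Measure
  (@lebesgue_measure R) ma.
move=> mA; apply/esym; change (lebesgue_measure A = m' A).
suff H : forall X : set R, ocitv X -> lebesgue_measure X = m' X.
  exact (lebesgue_measure_unique H mA).
move=> X [[b c] _ <-] /=; rewrite /m' /= /pushforward.
rewrite (_ : _ @^-1` _ = `]b - a, c - a]%classic); last first.
  by apply/seteqP; split => x /=; rewrite !in_itv/= ltrBlDr lerBrDr.
rewrite !lebesgue_measure_itv /= !lte_fin ltrD2r; case: ifP => // _.
by rewrite -!EFinD; congr (_%:E); ring.
Qed.

(** Through [cons_rV] a translation splits into one of the first coordinate and one of the others; a
    product measure is determined by its values on rectangles. *)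
Lemma lebesgue_rV_translate n (h : 'rV[R]_n) (A : set 'rV[R]_n) : measurable A ->
  lebesgue_rV n ((fun x => x + h) @^-1` A) = lebesgue_rV n A.
Proof.
elim: n h A => [|n IH] h A mA.
  by congr (_ _); apply/seteqP; split => x /=; rewrite (_ : x + h = x)//; apply/rowP => -[].
rewrite /= /lebesgue_succ /pushforward.
pose a := h ord0 ord0; pose h' : 'rV[R]_n := \row_j h ord0 (lift ord0 j).
pose tau (z : measurableTypeR R * 'rV[R]_n) : measurableTypeR R * 'rV[R]_n :=
  (z.1 + a, z.2 + h').
have mtau : measurable_fun setT tau.
  apply/measurable_fun_pair.
    have ma : measurable_fun [set: R] (fun x : R => x + a) by exact: measurable_funD.
    exact: (measurableT_comp (f := (fun x : R => x + a) : measurableTypeR R -> measurableTypeR R) ma (@measurable_fst _ _ (measurableTypeR R) 'rV[R]_n)).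
  exact: (measurableT_comp (measurable_translate h') measurable_snd).
have -> : @cons_rV R n @^-1` ((fun x => x + h) @^-1` A) = tau @^-1` (@cons_rV R n @^-1` A).
  have E z : cons_rV z + h = cons_rV (tau z).
    apply/rowP => i; rewrite !mxE; case: unliftP => [j ->|->] /=; rewrite ?mxE//.
  by apply/seteqP; split => z /=; rewrite E.
have mcA : measurable (@cons_rV R n @^-1` A : set (measurableTypeR R * 'rV[R]_n)).
  by rewrite -[X in measurable X]setTI; exact: measurable_cons_rV.
pose m' := measure_function_pushforward__canonical__measure_function_Measure
  (lebesgue_measure \x lebesgue_rV n)%E mtau.
apply/esym; change ((lebesgue_measure \x lebesgue_rV n)%E (@cons_rV R n @^-1` A) =
  m' (@cons_rV R n @^-1` A)).
suff H : forall (X : set (measurableTypeR R)) (Y : set 'rV[R]_n),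
    measurable X -> measurable Y ->
    m' (X `*` Y) = (lebesgue_measure X * lebesgue_rV n Y)%E.
  exact (product_measure_unique H mcA).
move=> X Y mX mY; rewrite /m' /= /pushforward.
rewrite (_ : tau @^-1` (X `*` Y) = ((fun x => x + a) @^-1` X) `*` ((fun x => x + h') @^-1` Y))//.
have mX' : measurable ((fun x : R => x + a) @^-1` X).
  have ma : measurable_fun [set: R] (fun x : R => x + a) by exact: measurable_funD.
  by rewrite -[Z in measurable Z]setTI; exact: ma.
have mY' : measurable ((fun x => x + h') @^-1` Y).
  by rewrite -[X in measurable X]setTI; exact: measurable_translate.
by rewrite product_measure1E// IH//; congr (_ * _)%E; exact: lebesgue_translate.
Qed.

Context {n : nat}.
Local Notation mu := (lebesgue_rV n).
Local Open Scope ereal_scope.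

Lemma ge0_integral_translate (h : 'rV[R]_n) (f : 'rV[R]_n -> \bar R) :
  measurable_fun setT f -> (forall x, 0 <= f x) ->
  \int[mu]_x f (x + h)%R = \int[mu]_x f x.
Proof.
move=> mf f0.
have := @ge0_integral_pushforward _ _ _ _ R _ (measurable_translate h) mu setT f
  measurableT mf (fun x _ => f0 x).
rewrite preimage_setT => <-.
apply: (@eq_measure_integral _ _ _ _ mu
  (measure_function_pushforward__canonical__measure_function_Measure
  mu (measurable_translate h))) => A mA _.
exact: lebesgue_rV_translate.
Qed.

Lemma intg_translate (h : 'rV[R]_n) (f : 'rV[R]_n -> R) : intg mu f ->
  intg mu (fun x => f (x + h)%R).
Proof.
move=> /integrableP[mf fi]; apply/integrableP; split.
  exact: (measurableT_comp mf (measurable_translate h)).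
move: fi; rewrite -(ge0_integral_translate h)//; exact: measurableT_comp.
Qed.

(** The positive and negative parts are translated separately, so the identity also covers
    non-integrable functions, whatever value the integral then takes. *)
Lemma Rint_translate (h : 'rV[R]_n) (f : 'rV[R]_n -> R) : measurable_fun setT f ->
  (\int[mu]_x f (x + h) = \int[mu]_x f x)%R.
Proof.
move=> /measurable_EFinP mf; rewrite /Rintegral; congr fine.
rewrite -[LHS]/(\int[mu]_x ((EFin \o f) \o (fun x => x + h)%R) x).
rewrite [LHS]integralE [RHS]integralE funepos_comp funeneg_comp; congr (_ - _).
- exact (ge0_integral_translate h (measurable_funepos mf) (funepos_ge0 _)).
- exact (ge0_integral_translate h (measurable_funeneg mf) (funeneg_ge0 _)).
Qed.

Lemma sqi_translate (h : 'rV[R]_n) (f : 'rV[R]_n -> R) : sqi mu f ->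
  sqi mu (fun x => f (x + h)%R).
Proof.
move=> [mf fi]; split; first exact: (measurableT_comp mf (measurable_translate h)).
exact: intg_translate fi.
Qed.

Lemma nrm2_translate (h : 'rV[R]_n) (f : 'rV[R]_n -> R) : measurable_fun setT f ->
  nrm2 mu (fun x => f (x + h)%R) = nrm2 mu f.
Proof.
by move=> mf; apply: (Rint_translate h (f := fun x => (f x ^+ 2)%R)); exact: measurable_funX.
Qed.

Lemma measure_cball (x : 'rV[R]_n) (r : R) : (0 <= r)%R ->
  mu [set y : 'rV[R]_n | (`|y - x| <= r)%R] = ((2 * r) ^+ n)%:E.
Proof.
move=> r0.
rewrite (_ : [set _ | _] =
  [set y : 'rV[R]_n | forall i, `[(x ord0 i - r)%R, (x ord0 i + r)%R]%classic (y ord0 i)]).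
  rewrite (@lebesgue_rV_box R n
    (fun i => `[(x ord0 i - r)%R, (x ord0 i + r)%R]%classic)) => [|i]; last exact: measurable_itv.
  transitivity (\prod_(i < n) (2 * r)%:E).
    apply: eq_bigr => i _; rewrite lebesgue_measure_itv /= lte_fin.
    case: ltP => h; rewrite -?EFinB; congr (_%:E); lra.
  elim: (n) => [|m IH]; first by rewrite big_ord0.
  by rewrite big_ord_recl IH exprS -EFinM.
apply/seteqP; split => y /= h.
  move=> i; rewrite in_itv/= -ler_distl.
  by have := le_trans (rV_coord_le (y - x)%R i) h; rewrite !mxE.
apply: rV_norm_le => // i; have := h i; rewrite in_itv/= -ler_distl !mxE.
by [].
Qed.

Lemma bounded_measure_fin (A : set 'rV[R]_n) (r : R) : measurable A ->
  (forall x, A x -> `|x| <= r)%R -> mu A < +oo.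
Proof.
move=> mA Ar; have [[x Ax]|A0] := pselect (A !=set0); last first.
  by rewrite (_ : A = set0) ?measure0//; apply/seteqP; split => // x Ax; apply: A0; exists x.
have r0 : (0 <= r)%R by exact: le_trans (Ar _ Ax).
apply: (@le_lt_trans _ _ (mu [set y : 'rV[R]_n | (`|y - 0| <= r)%R])); last first.
  by rewrite measure_cball// ltry.
apply: le_measure; rewrite ?inE//; first exact: measurable_cball.
by move=> y Ay /=; rewrite subr0; exact: Ar.
Qed.

Lemma intg_bounded (f : 'rV[R]_n -> R) (r M : R) :
  measurable_fun setT f ->
  (forall x, `|f x| <= M)%R -> (forall x, f x != 0 -> `|x| <= r)%R ->
  intg mu f.
Proof.
move=> mf fM fr.
pose B := [set y : 'rV[R]_n | (`|y - 0| <= `|r|)%R].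
have mB : measurable B by exact: measurable_cball.
have iB : intg mu (\1_B : _ -> R).
  apply: intg_indic => //; apply: (bounded_measure_fin (r := `|r|)) => // x.
  by rewrite /B /= subr0.
apply: (intg_le mf _ (intgZ M iB)) => x.
have [->|fx] := eqVneq (f x) 0%R.
  by rewrite normr0 mulr_ge0// ?indicE// (le_trans _ (fM x)).
rewrite indicE mem_set ?mulr1//= /B /= subr0.
by rewrite (le_trans (fr _ fx))// ler_norm.
Qed.

Lemma sqi_bounded (f : 'rV[R]_n -> R) (r M : R) :
  measurable_fun setT f ->
  (forall x, `|f x| <= M)%R -> (forall x, f x != 0 -> `|x| <= r)%R ->
  sqi mu f.
Proof.
move=> mf fM fr; split => //.
apply: (@intg_bounded _ r (M ^+ 2)); first exact: measurable_funX.
- by move=> x; rewrite normrX lerXn2r ?nnegrE// (le_trans _ (fM x)).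
- by move=> x fx; apply: fr; apply: contra_neq fx => ->; rewrite expr0n.
Qed.

End translation.

(** * Continuity of translations in L2 *)

Section translation_continuity.
Context {R : realType} {n : nat}.
Local Notation mu := (lebesgue_rV n).
Implicit Types (f g : 'rV[R]_n -> R) (h : 'rV[R]_n).

(** Stated with sequences, the form to which dominated convergence applies; [L2_translate_small]
    returns to a uniform statement on a ball. *)
Definition L2_translation_continuous f := sqi mu f /\
  forall h_ : nat -> 'rV[R]_n, h_ k @[k --> \oo] --> (0 : 'rV[R]_n) ->
    nrm2 mu (fun x => f (x + h_ k) - f x) @[k --> \oo] --> 0.

Local Notation tc := L2_translation_continuous.

Lemma sqi_diff_translate f h : sqi mu f -> sqi mu (fun x => f (x + h) - f x).
Proof. by move=> hf; apply: sqiB => //; exact: sqi_translate. Qed.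

Lemma cvg0_le (u v : nat -> R) : (forall k, 0 <= u k <= v k) ->
  v k @[k --> \oo] --> 0 -> u k @[k --> \oo] --> 0.
Proof.
move=> uv cv; apply: (squeeze_cvgr _ (cvg_cst 0) cv).
exact: nearW.
Qed.

Lemma cvg_sqr_sub (u : nat -> R) a : u k @[k --> \oo] --> a ->
  (a - u k) ^+ 2 @[k --> \oo] --> 0.
Proof.
move=> ua; have h : a - u k @[k --> \oo] --> 0.
  by rewrite -(subrr a); apply: cvgB => //; exact: cvg_cst.
by rewrite -(mulr0 0); under eq_fun do rewrite expr2; exact: cvgM.
Qed.

Lemma continuousM_rV f g : continuous f -> continuous g ->
  continuous (fun x => f x * g x).
Proof. by move=> cf cg x; apply: continuousM; [exact: cf|exact: cg]. Qed.

Lemma tcD f g : tc f -> tc g -> tc (fun x => f x + g x).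
Proof.
move=> [hf cf] [hg cg]; split; first exact: sqiD.
move=> h_ h0.
apply: (@cvg0_le _ (fun k => 2 * nrm2 mu (fun x => f (x + h_ k) - f x) +
  2 * nrm2 mu (fun x => g (x + h_ k) - g x))) => [k|].
  rewrite nrm2_ge0 /=.
  rewrite (_ : (fun x => _) = (fun x => (f (x + h_ k) - f x) + (g (x + h_ k) - g x))).
    by apply: nrm2D; exact: sqi_diff_translate.
  by apply/funext => x; ring.
rewrite -[X in _ --> X](_ : 2 * 0 + 2 * 0 = 0 :> R); last by ring.
by apply: cvgD; apply: cvgMr; [exact: cf|exact: cg].
Qed.

Lemma tcZ c f : tc f -> tc (fun x => c * f x).
Proof.
move=> [hf cf]; split; first exact: sqiZ.
move=> h_ h0; under eq_fun => k.
  rewrite (_ : (fun x => _) = (fun x => c * (f (x + h_ k) - f x))); last first.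
    by apply/funext => x; ring.
  rewrite nrm2Z; last exact: sqi_diff_translate.
  over.
by rewrite -(mulr0 (c ^+ 2)); apply: cvgMr; exact: cf.
Qed.

Lemma tc0 : tc (fun=> 0).
Proof.
split; first exact: sqi0.
move=> h_ _; apply: (@cvg0_le _ (fun=> 0)); last exact: cvg_cst.
move=> k; rewrite nrm2_ge0 /= /nrm2 subrr expr0n /=.
by rewrite /Rintegral integral0.
Qed.

Lemma tcB f g : tc f -> tc g -> tc (fun x => f x - g x).
Proof.
move=> hf /(tcZ (-1)) hg.
rewrite (_ : (fun x => _) = (fun x => f x + -1 * g x)); last by apply/funext => x; ring.
exact: tcD.
Qed.

Lemma tc_sum (I : Type) (r : seq I) (F : I -> 'rV[R]_n -> R) :
  (forall i, tc (F i)) -> tc (fun x => \sum_(i <- r) F i x).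
Proof.
move=> hF; elim: r => [|i r IH].
  by under eq_fun do rewrite big_nil; exact: tc0.
by under eq_fun do rewrite big_cons; exact: tcD.
Qed.

(** The increment of the product is f(x + h) (g(x + h) - g(x)) + g(x) (f(x + h) - f(x)). The lemma
    serves for indicators of intersections, whence the bounds by 1. *)
Lemma tcM f g : (forall x, `|f x| <= 1) -> (forall x, `|g x| <= 1) ->
  tc f -> tc g -> tc (fun x => f x * g x).
Proof.
move=> f1 g1 [hf cf] [hg cg].
have [mf mg] := (hf.1, hg.1).
have bnd (a b : R) : `|a| <= 1 -> `|a * b| <= `|b| by move=> a1; rewrite normrM ler_piMl.
split.
  apply: (sqi_le _ _ hg) => [|x]; first exact: measurable_funM.
  exact: bnd.
move=> h_ h0.
apply: (@cvg0_le _ (fun k => 2 * nrm2 mu (fun x => g (x + h_ k) - g x) +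
  2 * nrm2 mu (fun x => f (x + h_ k) - f x))) => [k|]; last first.
  rewrite -[X in _ --> X](_ : 2 * 0 + 2 * 0 = 0 :> R); last by ring.
  by apply: cvgD; apply: cvgMr; [exact: cg|exact: cf].
rewrite nrm2_ge0 /=.
have df := sqi_diff_translate (h_ k) hf; have dg := sqi_diff_translate (h_ k) hg.
have mfh : measurable_fun setT (fun x : 'rV[R]_n => f (x + h_ k)).
  exact: (measurableT_comp mf (measurable_translate _)).
have m1 : measurable_fun setT (fun x : 'rV[R]_n => f (x + h_ k) * (g (x + h_ k) - g x)).
  by apply: measurable_funM => //; exact: dg.1.
have m2 : measurable_fun setT (fun x : 'rV[R]_n => g x * (f (x + h_ k) - f x)).
  by apply: measurable_funM => //; exact: df.1.
rewrite (_ : (fun x => _) = (fun x => f (x + h_ k) * (g (x + h_ k) - g x) +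
  g x * (f (x + h_ k) - f x))); last by apply/funext => x; ring.
have b1 x : `|f (x + h_ k) * (g (x + h_ k) - g x)| <= `|g (x + h_ k) - g x| by exact: bnd.
have b2 x : `|g x * (f (x + h_ k) - f x)| <= `|f (x + h_ k) - f x| by exact: bnd.
apply: (le_trans (nrm2D (sqi_le m1 b1 dg) (sqi_le m2 b2 df))).
by apply: lerD; rewrite ler_pM2l//; apply: nrm2_le.
Qed.

Lemma tc_approx f : sqi mu f ->
  (forall e, 0 < e -> exists g, tc g /\ nrm2 mu (fun x => f x - g x) <= e) -> tc f.
Proof.
move=> hf ap; split => // h_ h0; apply/cvgrPdist_le => e e0.
(* The shares are such that 2 (e / 12) + 2 (2 (e / 8) + 2 (e / 12)) = e; the error f - g is counted
   twice because its translate has the same norm. *)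
have e12 : 0 < e / 12 by rewrite divr_gt0.
have e8 : 0 < e / 8 by rewrite divr_gt0.
have [g [[hg cg] fg]] := ap _ e12.
move/cvgrPdist_le : (cg _ h0) => /(_ _ e8); apply: filterS => k.
rewrite !sub0r !normrN ger0_norm ?nrm2_ge0// ger0_norm ?nrm2_ge0// => ge8.
pose D x := f x - g x.
have hD : sqi mu D by exact: sqiB.
rewrite (_ : (fun x => _) = (fun x => D (x + h_ k) + ((g (x + h_ k) - g x) - D x))); last first.
  by apply/funext => x; rewrite /D; ring.
have hDh := sqi_translate (h_ k) hD.
have dg := sqi_diff_translate (h_ k) hg.
apply: (le_trans (nrm2D hDh (sqiB dg hD))).
rewrite (nrm2_translate _ hD.1).
apply: (@le_trans _ _ (2 * (e / 12) + 2 * (2 * (e / 8) + 2 * (e / 12)))); last by lra.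
by apply: lerD; rewrite ler_pM2l//; apply: (le_trans (nrm2B dg hD)); apply: lerD; rewrite ler_pM2l.
Qed.

(** The pointwise limit is also an L2 limit, since (f - f_k)^2 is dominated by 4 g^2, and
    [tc_approx] applies. *)
Lemma tc_dominated (f_ : nat -> 'rV[R]_n -> R) f g : (forall k, tc (f_ k)) ->
  measurable_fun setT f -> sqi mu g ->
  (forall k x, `|f_ k x| <= g x) -> (forall x, f_ k x @[k --> \oo] --> f x) -> tc f.
Proof.
move=> hf_ mf hg fg cf.
have fg' x : `|f x| <= g x.
  by apply: (cvgr_to_le (cvg_norm (cf x))); apply: nearW => k; exact: fg.
have hf : sqi mu f.
  by apply: (sqi_le mf _ hg) => x; apply: (le_trans (fg' x)); exact: ler_norm.
apply: tc_approx => // e e0.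
have mfk k : measurable_fun setT (f_ k) by have [[]] := hf_ k.
have [|||||_ cv] := @Rint_dct _ _ _ mu (fun k x => (f x - f_ k x) ^+ 2) (fun=> 0)
  (fun x => 4 * g x ^+ 2).
- by move=> k; apply: measurable_funX; exact: measurable_funB.
- exact: measurable_cst.
- by apply: aeW => x; apply: cvg_sqr_sub; exact: cf.
- by apply: intgZ; exact: hg.2.
- apply: aeW => x k; rewrite ger0_norm ?sqr_ge0//.
  have := fg' x; have := fg k x; rewrite !ler_norml => /andP[? ?] /andP[? ?].
  by nra.
move: cv; rewrite /Rintegral integral0 => /cvgrPdist_le/(_ _ e0)[N _ NP].
exists (f_ N); split => //; have := NP N (leqnn N).
by rewrite /= sub0r normrN ger0_norm ?nrm2_ge0//; exact: nrm2_ge0.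
Qed.

Lemma tc_continuous f r M : continuous f -> (forall x, `|f x| <= M) ->
  (forall x, f x != 0 -> `|x| <= r) -> tc f.
Proof.
move=> cf fM fr.
have mf := continuous_measurable_rV cf.
have hf := sqi_bounded mf fM fr.
split => // h_ h0.
(* Dropping the first [N] terms leaves translations of length at most 1, so that all the functions
   involved vanish outside one fixed cube. *)
have [N _ NP] : \forall k \near \oo, `|h_ k| <= 1.
  move/cvgrPdist_le : h0 => /(_ 1 ltr01); apply: filterS => k.
  by rewrite sub0r normrN.
rewrite -(cvg_shiftn N).
pose B := [set y : 'rV[R]_n | `|y - 0| <= `|r| + 1].
have mB : measurable B by exact: measurable_cball.
have iB : intg mu \1_B.
  apply: intg_indic => //; apply: (bounded_measure_fin (r := `|r| + 1)) => // x.
  by rewrite /B /= subr0.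
have [|||||_ cv] := @Rint_dct _ _ _ mu (fun k x => (f (x + h_ (k + N)%N) - f x) ^+ 2) (fun=> 0)
  (fun x => (4 * M ^+ 2) * \1_B x).
- move=> k; apply: measurable_funX; apply: measurable_funB => //.
  exact: (measurableT_comp mf (measurable_translate _)).
- exact: measurable_cst.
- apply: aeW => x; under eq_fun do rewrite -sqrrN opprB; apply: cvg_sqr_sub.
  have hx : x + h_ (k + N)%N @[k --> \oo] --> x.
    rewrite -[X in _ --> X]addr0; apply: cvgD; first exact: cvg_cst.
    by rewrite (cvg_shiftn N h_).
  exact: (continuous_cvg _ (cf x) hx).
- exact: intgZ.
- apply: aeW => x k; rewrite ger0_norm ?sqr_ge0// indicE.
  have [xB|xB] := boolP (x \in B).
    rewrite mulr1; have := fM x; have := fM (x + h_ (k + N)%N).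
    by rewrite !ler_norml => /andP[? ?] /andP[? ?]; nra.
  have {}xB : `|r| + 1 < `|x|.
    by move: xB; rewrite notin_setE /B /= subr0 => /negP; rewrite -ltNge.
  have h1 : `|h_ (k + N)%N| <= 1 by apply: NP; exact: leq_addl.
  have rr := ler_norm r.
  have -> : f x = 0.
    by apply/eqP; apply/negPn/negP => /fr; lra.
  have -> : f (x + h_ (k + N)%N) = 0.
    apply/eqP; apply/negPn/negP => /fr.
    have := ler_normB (x + h_ (k + N)%N) (h_ (k + N)%N); rewrite addrK.
    by lra.
  by rewrite subrr expr0n mulr0.
by move: cv; rewrite /Rintegral integral0.
Qed.

(** Continuous ramps converging to the indicator of t > 0: they produce the indicators of
    half-spaces and of balls as limits of continuous functions. *)
Lemma cvg_ramp (t : R) :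
  Num.min 1 (k%:R * Num.max t 0) @[k --> \oo] --> ((0 < t)%R%:R : R).
Proof.
have [t0|t0] := ltP 0 t; last first.
  rewrite (_ : (fun k => _) = (fun=> 0)); first exact: cvg_cst.
  by apply/funext => k; rewrite mulr0 min_r.
apply: cvg_near_cst; near=> k.
rewrite min_l// -ler_pdivrMr//.
by near: k; exact: nbhs_infty_ger.
Unshelve. all: by end_near. Qed.

Definition ramp (k : nat) (t : R) := Num.min 1 (k%:R * Num.max t 0).

Lemma ramp_bound k t : 0 <= ramp k t <= 1.
Proof.
rewrite /ramp le_min ler01 ge_min lexx /= andbT mulr_ge0// le_max lexx orbT//.
Qed.

Lemma ramp_le0 k t : t <= 0 -> ramp k t = 0.
Proof. by move=> t0; rewrite /ramp max_r// mulr0 min_r. Qed.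

Lemma continuous_ramp k : continuous (ramp k).
Proof.
move=> t; apply: (@continuous_min R R (fun=> 1) (fun t => k%:R * Num.max t 0)).
  exact: cst_continuous.
apply: continuousM; first exact: cst_continuous.
apply: (@continuous_max R R id (fun=> 0)); first exact: cvg_id.
exact: cst_continuous.
Qed.

Lemma continuous_ball_ramp (N k : nat) :
  continuous (fun x : 'rV[R]_n => ramp k (N%:R - `|x|)).
Proof.
move=> x; apply: (continuous_comp (f := fun y : 'rV[R]_n => N%:R - `|y|) (g := ramp k)).
  by apply: continuousB; [exact: cst_continuous|exact: norm_continuous].
exact: continuous_ramp.
Qed.

Lemma continuous_coord_ramp (i : 'I_n) (a : R) (k : nat) :
  continuous (fun x : 'rV[R]_n => ramp k (x ord0 i - a)).
Proof.
move=> x; apply: (continuous_comp (f := fun y : 'rV[R]_n => y ord0 i - a) (g := ramp k)).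
  by apply: continuousB; [exact: coord_continuous|exact: cst_continuous].
exact: continuous_ramp.
Qed.

Let uball (N : nat) : set 'rV[R]_n := [set x | `|x| < N%:R].
(** A measurable set may have infinite measure; cutting by a ball puts its indicator in L2. *)
Let ind (A : set 'rV[R]_n) N : 'rV[R]_n -> R := \1_(A `&` uball N).

Let m_uball N : measurable (uball N).
Proof.
apply: open_measurable_rV.
rewrite (_ : uball N = (fun x => `|x|) @^-1` [set t | t < N%:R])//.
by apply: open_comp; [move=> x _; exact: norm_continuous|exact: open_lt].
Qed.

Let ind_bound A N x : `|ind A N x| <= 1.
Proof. by rewrite /ind indicE; case: (_ \in _); rewrite ?normr1 ?normr0. Qed.

Let ind_dom A N x : `|ind A N x| <= \1_(uball N) x.
Proof.
rewrite /ind !indicE; have [/set_mem[_ h]|_] := boolP (x \in A `&` uball N).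
  by rewrite (mem_set h) normr1.
by rewrite normr0.
Qed.

Let sqi_uball N : sqi mu \1_(uball N).
Proof.
apply: (@sqi_bounded _ _ _ N%:R 1).
- exact: measurable_indic.
- by move=> x; rewrite indicE; case: (_ \in _); rewrite ?normr1 ?normr0.
- move=> x; rewrite indicE; have [/set_mem/= h _|] := boolP (x \in uball N).
    exact: ltW.
  by rewrite eqxx.
Qed.

Let tc_halfspace N (i : 'I_n) (a : R) :
  tc (ind ((fun x => x ord0 i) @^-1` `]a, +oo[%classic) N).
Proof.
apply: (@tc_dominated (fun k x => ramp k (x ord0 i - a) * ramp k (N%:R - `|x|)) _ (\1_(uball N))).
- move=> k; apply: (@tc_continuous _ N%:R 1).
  + apply: continuousM_rV; first exact: continuous_coord_ramp.
    exact: continuous_ball_ramp.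
  + move=> x; have /andP[? ?] := ramp_bound k (x ord0 i - a).
    have /andP[? ?] := ramp_bound k (N%:R - `|x|).
    by rewrite ger0_norm ?mulr_ge0// mulr_ile1.
  + move=> x; apply: contraNT; rewrite -ltNge => Nx.
    by rewrite [X in _ * X]ramp_le0 ?mulr0// subr_le0 ltW.
- apply: measurable_indic; apply: measurableI => //.
  by rewrite -[X in measurable X]setTI; apply: measurable_coord => //; exact: measurable_itv.
- exact: sqi_uball.
- move=> k x; rewrite indicE; have /andP[? ?] := ramp_bound k (x ord0 i - a).
  have /andP[? ?] := ramp_bound k (N%:R - `|x|).
  have [_|] := boolP (x \in uball N).
    by rewrite ger0_norm ?mulr_ge0// mulr_ile1.
  rewrite notin_setE /uball /= => /negP; rewrite -leNgt => Nx.
  by rewrite [X in _ * X]ramp_le0 ?mulr0 ?normr0// subr_le0.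
- move=> x; rewrite /ind (_ : \1_(_ `&` _) x = (0 < x ord0 i - a)%R%:R * (0 < N%:R - `|x|)%R%:R :> R).
    by apply: cvgM; exact: cvg_ramp.
  rewrite indicE in_setI -natrM mulnb; congr (_%:R).
  by congr nat_of_bool; rewrite !subr_gt0; congr (_ && _);
    apply/idP/idP; rewrite inE /= ?in_itv /= ?andbT.
Qed.

Let tc_ball N : tc (ind setT N).
Proof.
apply: (@tc_dominated (fun k x => ramp k (N%:R - `|x|)) _ (\1_(uball N))).
- move=> k; apply: (@tc_continuous _ N%:R 1).
  + exact: continuous_ball_ramp.
  + move=> x; have /andP[? ?] := ramp_bound k (N%:R - `|x|).
    by rewrite ger0_norm.
  + move=> x; apply: contraNT; rewrite -ltNge => Nx.
    by rewrite ramp_le0 ?mulr0// subr_le0 ltW.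
- by apply: measurable_indic; apply: measurableI.
- exact: sqi_uball.
- move=> k x; rewrite indicE; have /andP[? ?] := ramp_bound k (N%:R - `|x|).
  have [_|] := boolP (x \in uball N); first by rewrite ger0_norm.
  rewrite notin_setE /uball /= => /negP; rewrite -leNgt => Nx.
  by rewrite ramp_le0 ?mulr0 ?normr0// subr_le0.
- move=> x; rewrite /ind setTI indicE (_ : x \in uball N = (0 < N%:R - `|x|)).
    exact: cvg_ramp.
  by rewrite subr_gt0; apply/idP/idP; rewrite inE.
Qed.

(** The good sets form a sigma-algebra containing the half-spaces, hence contain every measurable
    set. This replaces an approximation of measurable sets by open or compact ones. *)
Let good (A : set 'rV[R]_n) := measurable A /\ forall N, tc (ind A N).

Let good_setC A : good A -> good (~` A).
Proof.
move=> [mA tA]; split; first exact: measurableC.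
move=> N; rewrite (_ : ind _ N = (fun x => ind setT N x - ind A N x)); first by apply: tcB; [exact: tc_ball|exact: tA].
apply/funext => x; rewrite /ind !indicE !in_setI in_setT in_setC /=.
by case: (x \in A); case: (x \in uball N); rewrite /= ?subr0 ?subrr.
Qed.

Let good_setU A B : good A -> good B -> good (A `|` B).
Proof.
move=> [mA tA] [mB tB]; split; first exact: measurableU.
(* Inclusion-exclusion, the indicator of the intersection being the product. *)
move=> N; rewrite (_ : ind _ N = (fun x => ind A N x + (ind B N x - ind A N x * ind B N x))).
  by apply: tcD => //; apply: tcB => //; apply: tcM.
apply/funext => x; rewrite /ind !indicE !in_setI in_setU.
by case: (x \in A); case: (x \in B); case: (x \in uball N); rewrite /=; ring.
Qed.

Let good0 : good set0.
Proof.
split => // N; rewrite /ind set0I.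
by rewrite (_ : \1__ = (fun=> 0)); [exact: tc0|apply/funext => x; rewrite indicE in_set0].
Qed.

Let good_bigcup (F : nat -> set 'rV[R]_n) : (forall k, good (F k)) -> good (\bigcup_k F k).
Proof.
move=> gF; have mF k := (gF k).1; split; first exact: bigcup_measurable.
have gU k : good (\bigcup_(i < k) F i).
  elim: k => [|k IH]; first by rewrite bigcup_mkord big_ord0; exact: good0.
  by rewrite bigcup_mkord big_ord_recr /= -bigcup_mkord; exact: good_setU.
move=> N; apply: (@tc_dominated (fun k => ind (\bigcup_(i < k) F i) N) _ (\1_(uball N))).
- by move=> k; exact: (gU k).2.
- by apply: measurable_indic; apply: measurableI => //; exact: bigcup_measurable.
- exact: sqi_uball.
- by move=> k x; exact: ind_dom.
- move=> x; apply: cvg_near_cst; rewrite /ind.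
  have [[k _ Fx]|nF] := pselect ((\bigcup_k F k) x).
    exists k.+1 => // j /= kj; rewrite !indicE !in_setI; congr (_%:R).
    congr (nat_of_bool (_ && _)); rewrite !mem_set//; first by exists k.
    by exists k => //=; exact: leq_trans kj.
  apply: nearW => j; rewrite !indicE !in_setI; congr (_%:R).
  congr (nat_of_bool (_ && _)); rewrite !memNset//.
  by move=> [k _ Fk]; apply: nF; exists k.
Qed.

Lemma good_measurable A : measurable A -> good A.
Proof.
move=> mA.
suff : (measurable : set (set 'rV[R]_n)) `<=` good by apply.
apply: smallest_sub => [|B].
  split; first exact: good0.
  - by move=> B gB; rewrite setTD; exact: good_setC.
  - by move=> F gF; exact: good_bigcup.
rewrite -bigcup_seq => -[i /= _ [Y mY <-]]; rewrite setTI.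
suff : (measurable : set (set R)) `<=` [set Y | good ((fun x : 'rV[R]_n => x ord0 i) @^-1` Y)].
  by apply.
move=> Y' mY'; 
(* The Borel sets of the line are generated by open rays, whose preimages under a coordinate are
   half-spaces. *)
have {mY'} : <<s @RGenOInfty.G R >> Y'.
  have E := RGenOInfty.measurableE R.
  change ((@RGenOInfty.G R).-sigma.-measurable Y'); rewrite -E; exact mY'.
move: Y'; apply: smallest_sub => [|Z [a ->] /=].
  split => /=; first by rewrite preimage_set0; exact: good0.
  - by move=> Z gZ; rewrite setTD preimage_setC; exact: good_setC.
  - by move=> F gF; rewrite preimage_bigcup; exact: good_bigcup.
split; last by move=> N; exact: tc_halfspace.
by rewrite -[X in measurable X]setTI; apply: measurable_coord => //; exact: measurable_itv.
Qed.

(** Simple functions cut to the ball of radius [k] converge pointwise to [f] and are dominated by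
    [f] itself. *)
Lemma tc_ge0 f : sqi mu f -> (forall x, 0 <= f x) -> tc f.
Proof.
move=> hf f0; have mf := hf.1.
have [G [Gs Gb Gc]] := simple_approximation mf f0.
apply: (@tc_dominated (fun k x => G k x * \1_(uball k) x) f f) => //.
- move=> k; have [r [A [mA ->]]] := Gs k.
  rewrite (_ : (fun x => _) = fun x => \sum_(c <- r) (c * ind (A c) k x)).
    by apply: tc_sum => c; apply: tcZ; apply: (good_measurable _).2.
  apply/funext => x; rewrite mulr_suml; apply: eq_bigr => c _; rewrite -mulrA; congr (_ * _).
  by rewrite /ind !indicE in_setI -natrM mulnb.
- move=> k x; have /andP[g0 gf] := Gb k x; rewrite ger0_norm ?mulr_ge0//.
  by apply: le_trans gf; rewrite ler_piMr// indicE; case: (_ \in _).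
- move=> x; rewrite -[X in _ --> X]mulr1; apply: cvgM => //.
  apply: cvg_near_cst; near=> k; rewrite indicE mem_set// /uball /=.
  near: k; exact: nbhs_infty_gtr.
Unshelve. all: by end_near. Qed.

Lemma L2_translate_continuity f : sqi mu f -> tc f.
Proof.
move=> hf; have mf := hf.1.
rewrite (_ : f = (fun x => Num.max (f x) 0 - Num.max (- f x) 0)); last first.
  apply/funext => x; have [h|h] := lerP (f x) 0.
    by rewrite max_l ?sub0r ?opprK// oppr_ge0.
  by rewrite max_r ?subr0// oppr_le0 ltW.
have b (a : R) : `|Num.max a 0| <= `|a|.
  rewrite /Num.max; case: ltP; rewrite ?normr0// => *.
apply: tcB; apply: tc_ge0; try by move=> x; rewrite le_max lexx orbT.
- by apply: (sqi_le _ _ hf) => //; exact: measurable_maxr.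
- apply: (sqi_le _ _ (sqiN hf)) => //.
  by apply: measurable_maxr => //; exact: measurableT_comp.
Qed.

(** Were it false, translations of length at most 1 / (k + 1) violating the bound would contradict
    the sequential continuity. *)
Lemma L2_translate_small f e : sqi mu f -> 0 < e ->
  exists2 d, 0 < d & forall h, `|h| <= d -> nrm2 mu (fun x => f (x + h) - f x) <= e.
Proof.
move=> hf e0; apply: contrapT => nd.
have /choice[h_ hP] (k : nat) : exists h, `|h| <= k.+1%:R^-1 /\
    e < nrm2 mu (fun x => f (x + h) - f x).
  apply: contrapT => nh; apply: nd; exists k.+1%:R^-1; first by rewrite invr_gt0.
  by move=> h hk; rewrite leNgt; apply/negP => eh; apply: nh; exists h.
have h0 : h_ k @[k --> \oo] --> (0 : 'rV[R]_n).
  apply/cvgrPdist_le => d d0; near=> k.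
  rewrite sub0r normrN; apply: (le_trans (hP k).1); apply: ltW.
  by near: k; exact: (near_infty_natSinv_lt (PosNum d0)).
have [_ /(_ _ h0)/cvgrPdist_lt/(_ _ e0)[N _ /(_ N (leqnn N))]] := L2_translate_continuity hf.
rewrite /= sub0r normrN ger0_norm ?nrm2_ge0// => lt.
by have := lt_trans lt (hP N).2; rewrite ltxx.
Unshelve. all: by end_near. Qed.

End translation_continuity.

(** * Smooth functions and mollifiers *)

Section directional_derivatives.
Context {R : realType} {n : nat}.
Implicit Types (f g phi : 'rV[R]_n -> R) (x : 'rV[R]_n) (i j : 'I_n).

Definition evec i : 'rV[R]_n := delta_mx ord0 i.

Lemma evecE i j : evec i ord0 j = (j == i)%:R.
Proof. by rewrite mxE eqxx. Qed.

Lemma norm_scale_evec (r : R) i : `|r *: evec i| <= `|r|.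
Proof.
apply: rV_norm_le => // j; rewrite mxE evecE normrM.
by case: eqP => _; rewrite ?normr1 ?normr0 ?mulr1 ?mulr0.
Qed.

Lemma is_derive_cvg (V : normedModType R) (f : V -> R) (x v : V) d :
  h^-1 *: (f (h *: v + x) - f x) @[h --> 0^'] --> d -> is_derive x v f d.
Proof.
by move=> h; apply: DeriveDef; [apply/cvg_ex; exists d|apply: cvg_lim].
Qed.

Lemma cvg_is_derive (V : normedModType R) (f : V -> R) (x v : V) d :
  is_derive x v f d -> h^-1 *: (f (h *: v + x) - f x) @[h --> 0^'] --> d.
Proof. by move=> [df <-]; exact: df. Qed.

Lemma is_derive_line f i x (t : R) d : is_derive (x + t *: evec i) (evec i) f d ->
  is_derive t 1 (fun r => f (x + r *: evec i)) d.
Proof.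
move=> /cvg_is_derive h; apply: is_derive_cvg.
suff -> : (fun r : R => r^-1 *: (f (x + (r *: (1 : R) + t) *: evec i) - f (x + t *: evec i))) =
  (fun r => r^-1 *: (f (r *: evec i + (x + t *: evec i)) - f (x + t *: evec i))) by [].
by apply/funext => r; rewrite scalerDl addrCA -[r *: 1]/(r * 1) mulr1.
Qed.

Lemma is_derive_coord (g : R -> R) i j x d : is_derive (x ord0 i) 1 g d ->
  is_derive x (evec j) (fun y => g (y ord0 i)) ((i == j)%:R * d).
Proof.
move=> /cvg_is_derive h; apply: is_derive_cvg.
move: h; have [->|ij] := eqVneq i j => h.
  rewrite mul1r.
  suff -> : (fun r : R => r^-1 *: (g ((r *: evec j + x) ord0 j) - g (x ord0 j))) =
    (fun r : R => r^-1 *: (g (r *: 1 + x ord0 j) - g (x ord0 j))) by [].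
  by apply/funext => r; rewrite mxE mxE evecE eqxx.
rewrite mul0r (_ : (fun r => _) = (fun=> 0)); first exact: cvg_cst.
apply/funext => r.
by rewrite mxE mxE evecE (negbTE ij) mulr0 add0r subrr scaler0.
Qed.

Lemma partialE f i x d : is_derive x (evec i) f d -> partial i f x = d.
Proof. by move=> h; exact: derive_val. Qed.

Lemma Ck_continuous k f : Ck k f -> continuous f.
Proof. by case: k => [//|k] []. Qed.

Lemma CkS k f : Ck k.+1 f -> Ck k f.
Proof.
elim: k f => [|k IH] f; first by case.
by move=> [cf df pf]; split => // i; exact: IH.
Qed.

Lemma Ck_is_derive k f i x : Ck k.+1 f -> is_derive x (evec i) f (partial i f x).
Proof. by move=> [_ df _]; apply: DeriveDef. Qed.

Lemma CkP k f (df : 'I_n -> 'rV[R]_n -> R) : continuous f ->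
  (forall i x, is_derive x (evec i) f (df i x)) -> (forall i, Ck k (df i)) ->
  Ck k.+1 f.
Proof.
move=> cf hd hk; split; [exact: cf|by move=> i x; have [] := hd i x|move=> i].
suff -> : partial i f = df i by exact: hk.
by apply/funext => x; apply: partialE.
Qed.

Lemma Ck_cst k (c : R) : Ck k (fun _ : 'rV[R]_n => c).
Proof.
elim: k c => [|k IH] c; first by move=> x; exact: cst_continuous.
have h1 : continuous (fun _ : 'rV[R]_n => c) by exact: cst_continuous.
have h2 i x : is_derive x (evec i) (fun _ : 'rV[R]_n => c) 0 by exact: is_derive_cst.
exact: (@CkP k (fun=> c) (fun _ _ => 0) h1 h2 (fun _ => IH 0)).
Qed.

Lemma CkD k f g : Ck k f -> Ck k g -> Ck k (fun x => f x + g x).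
Proof.
elim: k f g => [|k IH] f g hf hg.
  by move: hf hg => /= hf hg x; apply: continuousD; [exact: hf|exact: hg].
apply: (@CkP _ _ (fun i x => partial i f x + partial i g x)) => [x|i x|i].
- by apply: continuousD; [exact: (Ck_continuous hf)|exact: (Ck_continuous hg)].
- exact: (is_deriveD (Ck_is_derive i x hf) (Ck_is_derive i x hg)).
- by have [_ _ pf] := hf; have [_ _ pg] := hg; apply: IH; [exact: pf|exact: pg].
Qed.

Lemma CkM k f g : Ck k f -> Ck k g -> Ck k (fun x => f x * g x).
Proof.
elim: k f g => [|k IH] f g hf hg; first exact: continuousM_rV.
apply: (@CkP _ _ (fun i x => f x * partial i g x + g x * partial i f x)) => [|i x|i].
- by apply: continuousM_rV; [case: hf|case: hg].
- have df := Ck_is_derive i x hf; have dg := Ck_is_derive i x hg.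
  exact: (is_deriveM (dg := partial i g x) (df := partial i f x)).
- have [_ _ pf] := hf; have [_ _ pg] := hg.
  by apply: CkD; apply: IH; [exact: CkS|exact: pg|exact: CkS|exact: pf].
Qed.

Lemma CkZ k c f : Ck k f -> Ck k (fun x => c * f x).
Proof. by move=> hf; apply: CkM => //; exact: Ck_cst. Qed.

Lemma Ck_prod k (I : Type) (r : seq I) (F : I -> 'rV[R]_n -> R) :
  (forall a, Ck k (F a)) -> Ck k (fun x => \prod_(a <- r) F a x).
Proof.
move=> h; elim: r => [|a r IH].
  by under eq_fun do rewrite big_nil; exact: Ck_cst.
by under eq_fun do rewrite big_cons; exact: CkM.
Qed.

Lemma is_derive_translate f i x h d : is_derive (x + h) (evec i) f d ->
  is_derive x (evec i) (fun y => f (y + h)) d.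
Proof.
move=> /cvg_is_derive H; apply: is_derive_cvg.
by under eq_fun do rewrite -addrA.
Qed.

Lemma continuous_translate f h : continuous f -> continuous (fun x => f (x + h)).
Proof.
move=> cf x; apply: (continuous_comp (f := fun y : 'rV[R]_n => y + h) (g := f)).
  by apply: continuousD; [exact: cvg_id|exact: cst_continuous].
exact: cf.
Qed.

Lemma Ck_translate k f h : Ck k f -> Ck k (fun x => f (x + h)).
Proof.
elim: k f => [|k IH] f hf; first exact: continuous_translate.
apply: (@CkP _ _ (fun i x => partial i f (x + h))) => [|i x|i].
- by apply: continuous_translate; case: hf.
- by apply: is_derive_translate; exact: (Ck_is_derive i _ hf).
- by have [_ _ pf] := hf; apply: (IH (partial i f)); exact: pf.
Qed.

Lemma partial_translate f i h : Ck 1 f ->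
  partial i (fun x => f (x + h)) = (fun x => partial i f (x + h)).
Proof.
by move=> hf; apply/funext => x; apply: partialE; apply: is_derive_translate; exact: (Ck_is_derive i _ hf).
Qed.

Lemma partialD f g i : Ck 1 f -> Ck 1 g ->
  partial i (fun x => f x + g x) = (fun x => partial i f x + partial i g x).
Proof.
move=> hf hg; apply/funext => x; apply: partialE.
exact: (is_deriveD (Ck_is_derive i x hf) (Ck_is_derive i x hg)).
Qed.

Lemma partialM f g i : Ck 1 f -> Ck 1 g ->
  partial i (fun x => f x * g x) = (fun x => f x * partial i g x + g x * partial i f x).
Proof.
move=> hf hg; apply/funext => x; apply: partialE.
have df := Ck_is_derive i x hf; have dg := Ck_is_derive i x hg.
exact: (is_deriveM (dg := partial i g x) (df := partial i f x)).
Qed.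

Lemma partial_off_support f i (K : set 'rV[R]_n) : closed K ->
  (forall x, ~ K x -> f x = 0) -> forall x, ~ K x -> partial i f x = 0.
Proof.
move=> cK fK x Kx; apply: partialE.
apply: (near_eq_is_derive _ (is_derive_cst 0 _ _)).
have oK : open (~` K) by exact: closed_openC.
by near=> y; rewrite /= fK//; near: y; exact: open_nbhs_nbhs.
Unshelve. all: by end_near. Qed.

End directional_derivatives.

(** * Smooth functions on the line that are flat at the origin *)

Section flat_functions.
Context {R : realType}.
Implicit Types (p q : {poly R}) (t : R).

(** The polynomial factor in 1 / t makes the family stable under differentiation, so smoothness
    follows by induction. *)
Definition flat_exp p t : R := if 0 < t then p.[t^-1] * expR (- t^-1) else 0.

Lemma horner_le_pow p y : 1 <= y ->
  `|p.[y]| <= (\sum_(i < size p) `|p`_i|) * y ^+ size p.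
Proof.
move=> y1; have y0 : 0 <= y by lra.
rewrite horner_coef mulr_suml; apply: (le_trans (ler_norm_sum _ _ _)).
apply: ler_sum => i _; rewrite normrM normrX (ger0_norm y0) ler_wpM2l//.
by rewrite ler_weXn2l// ltnW.
Qed.

(** With y = 1 / t >= 1 and m the size of p, |p(y)| is at most a constant times y^m, while e^y >=
    y^(m+2) / (m+2)!. The two spare powers give t^2, enough for a zero derivative at the origin. *)
Lemma flat_exp_quadratic p :
  exists C, 0 <= C /\ forall t, t <= 1 -> `|flat_exp p t| <= C * t ^+ 2.
Proof.
pose m := size p; pose C := \sum_(i < m) `|p`_i|.
have C0 : 0 <= C by apply: sumr_ge0.
exists (C * (m.+2)`!%:R); split; first by rewrite mulr_ge0.
move=> t t1; rewrite /flat_exp; case: ifPn => [t0|_]; last first.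
  by rewrite normr0; apply: mulr_ge0; [exact: mulr_ge0|exact: sqr_ge0].
have y1 : 1 <= t^-1 by rewrite invf_ge1.
have y0 : 0 <= t^-1 by lra.
have f0 : 0 < (m.+2)`!%:R :> R by rewrite ltr0n fact_gt0.
rewrite normrM (ger0_norm (expR_ge0 _)) expRN.
have e0 : 0 < expR t^-1 := expR_gt0 _.
rewrite ler_pdivrMr//; apply: (le_trans (horner_le_pow p y1)).
rewrite -!mulrA; apply: ler_wpM2l => //.
have := expR_ge1Dxn m.+1 y0 => h.
have {}h : t^-1 ^+ m.+2 / (m.+2)`!%:R <= expR t^-1 by lra.
apply: (@le_trans _ _ ((m.+2)`!%:R * (t ^+ 2 * (t^-1 ^+ m.+2 / (m.+2)`!%:R)))).
  rewrite (_ : _ * (_ * _) = t^-1 ^+ m)//.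
  rewrite -addn2 exprD !exprVn.
  have tm : t ^+ m != 0 by rewrite expf_neq0// gt_eqF.
  have t2 : t ^+ 2 != 0 by rewrite expf_neq0// gt_eqF.
  set a := t ^+ m; set b := t ^+ 2; set c := (_ `!%:R).
  by field; rewrite ?tm ?t2 ?gt_eqF.
rewrite [t * (t * _)]mulrA -expr2.
by apply: ler_wpM2l; [exact: ltW|apply: ler_wpM2l => //; exact: sqr_ge0].
Qed.

(** The derivative of p(1/t) e^(-1/t) is t^(-2) (p - p')(1/t) e^(-1/t). *)
Definition flat_deriv p : {poly R} := 'X^2 * (p - p^`()).

Lemma is_derive_flat_exp p t : is_derive t 1 (flat_exp p) (flat_exp (flat_deriv p) t).
Proof.
have [t0|t0|->] := ltgtP t 0.
- rewrite [in X in is_derive _ _ _ X]/flat_exp ltNge (ltW t0) /=.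
  apply: (near_eq_is_derive _ (is_derive_cst 0 _ _)).
  near=> s; rewrite /=  /flat_exp ltNge (_ : s <= 0)//; apply: ltW.
  by near: s; exact: lt_nbhsl.
- rewrite [in X in is_derive _ _ _ X]/flat_exp t0.
  suff D : is_derive t 1 (fun s : R => p.[s^-1] * expR (- s^-1))
      ((flat_deriv p).[t^-1] * expR (- t^-1)).
    apply: (near_eq_is_derive _ D).
    near=> s; rewrite /flat_exp (_ : 0 < s)//.
    by near: s; exact: lt_nbhsr.
  have tn0 : t != 0 by rewrite gt_eqF.
  have dV : is_derive t 1 (fun s : R => s^-1) (- t ^- 2).
    have := @is_deriveV R id t 1 1 tn0 (is_derive_id _ _).
    by rewrite /= -[_ *: _]/(_ * _) mulr1.
  have dp : is_derive t 1 (fun s : R => p.[s^-1]) (p^`().[t^-1] * (- t ^- 2)).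
    exact: (@is_derive1_comp _ (horner p) (fun s => s^-1)).
  have dNV : is_derive t 1 (fun s : R => - s^-1) (t ^- 2).
    by have := is_deriveN dV; rewrite opprK.
  have de : is_derive t 1 (fun s : R => expR (- s^-1)) (expR (- t^-1) * t ^- 2).
    exact: (@is_derive1_comp _ expR (fun s => - s^-1)).
  have -> : (flat_deriv p).[t^-1] * expR (- t^-1) =
      p.[t^-1] *: (expR (- t^-1) * t ^- 2) + expR (- t^-1) *: (p^`().[t^-1] * (- t ^- 2)).
    rewrite /flat_deriv !hornerE /= -exprVn.
    change ((t^-1 ^+ 2 * (p.[t^-1] - p^`().[t^-1])) * expR (- t^-1) =
      p.[t^-1] * (expR (- t^-1) * t^-1 ^+ 2) +
      expR (- t^-1) * (p^`().[t^-1] * (- t^-1 ^+ 2))).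
    by ring.
  exact: (is_deriveM dp de).
(* At the origin the quadratic bound makes the difference quotient at most C |h|. *)
- rewrite [in X in is_derive _ _ _ X]/flat_exp ltxx.
  have [C [C0 CP]] := flat_exp_quadratic p.
  apply: is_derive_cvg; apply/cvgrPdist_le => e e0.
  near=> h.
  have h0 : h != 0 by near: h; exact: nbhs_dnbhs_neq.
  rewrite sub0r normrN addr0 -[h *: 1]/(h * 1) mulr1 /flat_exp ltxx subr0 -/(flat_exp p h).
  rewrite -[_ *: _]/(_ * _) normrM normfV mulrC ler_pdivrMr ?normr_gt0//.
  have h1 : h <= 1.
    by apply: (le_trans (ler_norm h)); near: h; exact: dnbhs0_le.
  have h2 : `|h| <= e / (C + 1) by near: h; apply: dnbhs0_le; rewrite divr_gt0// ltr_wpDl.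
  apply: (le_trans (CP h h1)); rewrite -[h ^+ 2]real_normK ?num_real// expr2 mulrA.
  apply: ler_wpM2r => //; apply: (@le_trans _ _ (C * (e / (C + 1)))); first exact: ler_wpM2l.
  by rewrite mulrA ler_pdivrMr ?ltr_wpDl//; nra.
Unshelve. all: by end_near. Qed.

Lemma continuous_flat_exp p : continuous (flat_exp p).
Proof.
move=> t; apply: differentiable_continuous; apply/derivable1_diffP.
by have [] := is_derive_flat_exp p t.
Qed.

Lemma flat_exp_ge0 t : 0 <= flat_exp 1 t.
Proof. by rewrite /flat_exp; case: ifP => // _; rewrite hornerC mul1r expR_ge0. Qed.

Lemma flat_exp_gt0 t : 0 < t -> 0 < flat_exp 1 t.
Proof. by move=> t0; rewrite /flat_exp t0 hornerC mul1r expR_gt0. Qed.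

Lemma flat_exp_le0 p t : t <= 0 -> flat_exp p t = 0.
Proof. by move=> t0; rewrite /flat_exp ltNge t0. Qed.

Lemma Ck_flat_exp n k p (a c : R) (i : 'I_n) :
  Ck k (fun x : 'rV[R]_n => flat_exp p (a + c * x ord0 i)).
Proof.
elim: k p => [|k IH] p.
  move=> x; apply: (continuous_comp (f := fun y : 'rV[R]_n => a + c * y ord0 i) (g := flat_exp p)).
    apply: continuousD; first exact: cst_continuous.
    by apply: continuousM; [exact: cst_continuous|exact: coord_continuous].
  exact: continuous_flat_exp.
apply: (@CkP _ _ _ _ (fun j x => ((i == j)%:R * c) * flat_exp (flat_deriv p) (a + c * x ord0 i))).
- exact: Ck_continuous (IH p).
- move=> j x; rewrite -mulrA.
  apply: (is_derive_coord (g := fun s => flat_exp p (a + c * s))).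
  rewrite mulrC.
  have da : is_derive (x ord0 i) 1 (fun s : R => a + c * s) c.
    apply: is_derive_cvg; apply: cvg_near_cst; near=> h.
    have h0 : h != 0 by near: h; exact: nbhs_dnbhs_neq.
    rewrite -[h *: 1]/(h * 1) -[_ *: _]/(_ * _); by field.
  exact: (@is_derive1_comp _ (flat_exp p) (fun s => a + c * s) _ _ _ (is_derive_flat_exp p _) da).
- by move=> j; apply: CkZ.
Unshelve. all: by end_near. Qed.

End flat_functions.

(** * Test functions, Taylor bounds and mollifying kernels *)

Section smooth_compact_support.
Context {R : realType} {n : nat}.
Local Notation mu := (lebesgue_rV n).
Implicit Types (f g phi eta : 'rV[R]_n -> R) (x : 'rV[R]_n) (i : 'I_n)
  (K U V : set 'rV[R]_n).

Definition smooth f := forall k, Ck k f.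

(** Any compact set outside which [phi] vanishes may stand for the closure of its support, which
    spares computing that closure for sums, products and derivatives. *)
Lemma Cc_inftyP U phi : Cc_infty U phi <->
  smooth phi /\ exists K, [/\ compact K, K `<=` U & forall x, ~ K x -> phi x = 0].
Proof.
split=> [[sm cK KU]|[sm [K [cK KU phiK]]]].
  split => //; exists (closure [set x | phi x != 0]); split => // x nx.
  by apply/eqP/negPn/negP => px; apply: nx; exact: subset_closure.
have clK : closure [set x | phi x != 0] `<=` K.
  have cK' : closed K by exact: compact_closed.
  rewrite (closure_id K).1//; apply: closure_subset => x /= px.
  by apply: contrapT => /phiK p0; move: px; rewrite p0 eqxx.
split => //; last by move=> x /clK /KU.
by apply: (subclosed_compact _ cK) => //; exact: closed_closure.
Qed.

Lemma Cc_subset U V phi : U `<=` V -> Cc_infty U phi -> Cc_infty V phi.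
Proof.
move=> UV /Cc_inftyP[sm [K [cK KU p0]]]; apply/Cc_inftyP; split => //; exists K; split => //.
by move=> x /KU /UV.
Qed.

Lemma compact_norm_bound K : compact K -> exists2 r, 0 <= r & forall x, K x -> `|x| <= r.
Proof.
move=> /compact_bounded[M [_ MP]]; exists (`|M| + 1) => // x Kx.
by apply: MP => //; rewrite (le_lt_trans (ler_norm M))// ltrDl.
Qed.

Lemma Cc_bounded f r : continuous f -> (forall x, f x != 0 -> `|x| <= r) ->
  exists2 M, 0 <= M & forall x, `|f x| <= M.
Proof.
move=> cf fr.
have cB : compact (f @` [set y : 'rV[R]_n | `|y - 0| <= r]).
  by apply: continuous_compact; [exact: continuous_subspaceT|exact: rV_cball_compact].
have [M [_ MP]] := compact_bounded cB.
have M1 : M < `|M| + 1 by rewrite (le_lt_trans (ler_norm M))// ltrDl.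
exists (`|M| + 1) => // x.
have [->|fx] := eqVneq (f x) 0; first by rewrite normr0.
by apply: (MP _ M1); exists x => //=; rewrite subr0; exact: fr.
Qed.

Lemma Cc_support_bound U phi : Cc_infty U phi ->
  exists2 r, 0 <= r & forall x, phi x != 0 -> `|x| <= r.
Proof.
move=> /Cc_inftyP[_ [K [cK _ p0]]]; have [r r0 rP] := compact_norm_bound cK.
exists r => // x px; apply: rP; apply: contrapT => /p0 p; by rewrite p eqxx in px.
Qed.

Lemma Cc_measurable U phi : Cc_infty U phi -> measurable_fun setT phi.
Proof. by move=> [sm _ _]; apply: continuous_measurable_rV; exact: (Ck_continuous (sm 0)). Qed.

Lemma Cc_sup U phi : Cc_infty U phi -> exists2 M, 0 <= M & forall x, `|phi x| <= M.
Proof.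
move=> h; have [r _ rP] := Cc_support_bound h; case: h => sm _ _.
exact: (Cc_bounded (Ck_continuous (sm 0)) rP).
Qed.

Lemma Cc_intg U phi : Cc_infty U phi -> intg mu phi.
Proof.
move=> h; have [r _ rP] := Cc_support_bound h; have [M _ MP] := Cc_sup h.
exact: (intg_bounded (Cc_measurable h) MP rP).
Qed.

Lemma Cc_sqi U phi : Cc_infty U phi -> sqi mu phi.
Proof.
move=> h; have [r _ rP] := Cc_support_bound h; have [M _ MP] := Cc_sup h.
exact: (sqi_bounded (Cc_measurable h) MP rP).
Qed.

Lemma smooth_partial f i : smooth f -> smooth (partial i f).
Proof. by move=> sm k; have [_ _] := sm k.+1; exact. Qed.

Lemma Cc_partial U phi i : Cc_infty U phi -> Cc_infty U (partial i phi).
Proof.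
move=> /Cc_inftyP[sm [K [cK KU p0]]]; apply/Cc_inftyP.
split; first exact: smooth_partial.
by exists K; split => //; apply: partial_off_support => //; exact: compact_closed.
Qed.

Lemma Cc_mull U eta phi : smooth eta -> Cc_infty U phi -> Cc_infty U (fun x => eta x * phi x).
Proof.
move=> se /Cc_inftyP[sm [K [cK KU p0]]]; apply/Cc_inftyP.
split; first by move=> k; exact: CkM.
by exists K; split => // x /p0 ->; rewrite mulr0.
Qed.

Lemma CcZ U c phi : Cc_infty U phi -> Cc_infty U (fun x => c * phi x).
Proof. by apply: (@Cc_mull _ (fun=> c)) => k; exact: Ck_cst. Qed.

Lemma CcD U phi psi : Cc_infty U phi -> Cc_infty U psi -> Cc_infty U (fun x => phi x + psi x).
Proof.
move=> /Cc_inftyP[sm [K [cK KU p0]]] /Cc_inftyP[sm' [K' [cK' KU' p0']]]; apply/Cc_inftyP.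
split; first by move=> k; exact: CkD.
exists (K `|` K'); split; first exact: compactU.
  by move=> x [/KU|/KU'].
by move=> x /not_orP[/p0 -> /p0' ->]; rewrite addr0.
Qed.

Lemma Cc_translate phi h : Cc_infty setT phi -> Cc_infty setT (fun x => phi (x + h)).
Proof.
move=> H; have [r _ rP] := Cc_support_bound H; case: H => sm _ _.
apply/Cc_inftyP; split; first by move=> k; exact: Ck_translate.
exists [set y | `|y - (- h)| <= r]; split => //; first exact: rV_cball_compact.
move=> x /= nx; apply/eqP/negPn/negP => /rP le; apply: nx.
by rewrite opprK.
Qed.

Lemma mvt_line f i x (r : R) : Ck 1 f -> exists2 c, `|c| <= `|r| &
  f (x + r *: evec i) - f x = r * partial i f (x + c *: evec i).
Proof.
move=> hf.
have dl (t : R) : is_derive t 1 (fun t => f (x + t *: evec i)) (partial i f (x + t *: evec i)).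
  by apply: is_derive_line; exact: (Ck_is_derive i _ hf).
have cl (A : set R) : {within A, continuous (fun t => f (x + t *: evec i))}.
  apply: continuous_subspaceT => t; apply: differentiable_continuous.
  by apply/derivable1_diffP; have [] := dl t.
have [r0|r0] := leP 0 r.
  have [c] := MVT_segment r0 (fun t _ => dl t) (cl _).
  rewrite in_itv/= => /andP[c0 cr] E; exists c; first by rewrite !ger0_norm.
  by rewrite scale0r addr0 subr0 mulrC in E.
have [c] := MVT_segment (ltW r0) (fun t _ => dl t) (cl _).
rewrite in_itv/= => /andP[cr c0] E; exists c; first by rewrite !ler0_norm ?lerN2// ltW.
by move: E; rewrite scale0r addr0 => E; rewrite -opprB E; ring.
Qed.

Lemma difference_quotient_bound f i M x (r : R) : Ck 1 f -> (forall y, `|partial i f y| <= M) ->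
  `|f (x + r *: evec i) - f x| <= M * `|r|.
Proof.
move=> hf fM; have [c _ ->] := mvt_line i x r hf.
by rewrite normrM mulrC ler_wpM2r.
Qed.

(** The mean value theorem applied twice, whence the constant [M] instead of M / 2. *)
Lemma taylor_bound f i M x (r : R) : Ck 2 f -> (forall y, `|partial i (partial i f) y| <= M) ->
  `|f (x + r *: evec i) - f x - r * partial i f x| <= M * r ^+ 2.
Proof.
move=> hf fM; have [c cr ->] := mvt_line i x r (CkS hf).
rewrite -mulrBr normrM -[r ^+ 2]real_normK ?num_real// expr2 mulrCA ler_wpM2l//.
have M0 : 0 <= M := le_trans (normr_ge0 _) (fM 0).
have [_ _ hp] := hf.
by apply: (le_trans (difference_quotient_bound x c (hp i) fM)); exact: ler_wpM2l.
Qed.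

(** A product over the coordinates suits the sup norm: it is positive exactly on the open cube of
    radius [d]. *)
Definition bump (d : R) : 'rV[R]_n -> R :=
  fun x => \prod_(i < n) (flat_exp 1 (d + 1 * x ord0 i) * flat_exp 1 (d + (-1) * x ord0 i)).

Lemma bump_smooth d : smooth (bump d).
Proof. by move=> k; apply: Ck_prod => i; apply: CkM; exact: Ck_flat_exp. Qed.

Lemma bump_ge0 d x : 0 <= bump d x.
Proof. by apply: prodr_ge0 => i _; apply: mulr_ge0; exact: flat_exp_ge0. Qed.

Lemma bump_support d x : 0 <= d -> bump d x != 0 -> `|x| <= d.
Proof.
move=> d0; apply: contraR; rewrite -ltNge => dx.
have [i di] : exists i, d < `|x ord0 i|.
  apply: contrapT => h; move: dx; apply/negP; rewrite -leNgt; apply: rV_norm_le => // i.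
  by rewrite leNgt; apply/negP => di; apply: h; exists i.
rewrite /bump (bigD1 i)//= mulf_eq0; apply/orP; left.
have [xi|xi] := leP 0 (x ord0 i).
  by rewrite (@flat_exp_le0 _ _ (d + -1 * _)) ?mulr0// ; rewrite ger0_norm// in di; lra.
by rewrite flat_exp_le0 ?mul0r//; rewrite ltr0_norm// in di; lra.
Qed.

Lemma bump_gt0 d x : `|x| < d -> 0 < bump d x.
Proof.
move=> xd; apply: prodr_gt0 => i _; have := le_lt_trans (rV_coord_le x i) xd.
rewrite ltr_norml => /andP[x1 x2].
by apply: mulr_gt0; apply: flat_exp_gt0; lra.
Qed.

Lemma mollifier_exists d : 0 < d -> exists rho : 'rV[R]_n -> R,
  [/\ smooth rho, forall x, 0 <= rho x, forall x, rho x != 0 -> `|x| <= d &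
      \int[mu]_x rho x = 1].
Proof.
move=> d0; pose b := bump d.
have cb : continuous b by exact: (Ck_continuous (@bump_smooth d 0)).
have bs x : b x != 0 -> `|x| <= d by exact: (bump_support (ltW d0)).
have [M _ MP] := Cc_bounded cb bs.
have mb := continuous_measurable_rV cb.
have ib : intg mu b := intg_bounded mb MP bs.
(* A zero integral would make the bump vanish almost everywhere, whereas it is positive on the cube
   of radius d / 2, which has positive measure. *)
have I0 : 0 < \int[mu]_x b x.
  rewrite lt_neqAle Rintegral_ge0 ?andbT; last by move=> x _; exact: bump_ge0.
  apply/negP => /eqP I0.
  have : (\int[mu]_x `|(b x)%:E| = 0)%E.
    under eq_integral => x _ do rewrite gee0_abs ?lee_fin ?bump_ge0//.
    by rewrite -EFin_Rint// -I0.
  have mEb : measurable_fun setT (EFin \o b) by exact/measurable_EFinP.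
  move=> /(ae_eq_integral_abs mu measurableT mEb).1.
  move=> [N [mN N0 sN]].
  pose B := [set y : 'rV[R]_n | `|y - 0| <= d / 2].
  have : (mu B <= mu N)%E.
    apply: le_measure; rewrite ?inE//; first exact: measurable_cball.
    move=> x; rewrite /B /= subr0 => xd; apply: sN => /= /(_ I) [b0].
    have : 0 < b x by apply: bump_gt0; lra.
    by rewrite b0 ltxx.
  have mB : mu B = ((2 * (d / 2)) ^+ n)%:E by apply: measure_cball; lra.
  rewrite N0 mB leNgt => /negP; apply.
  by rewrite lte_fin exprn_gt0//; lra.
exists (fun x => (\int[mu]_x b x)^-1 * b x); split.
- by move=> k; apply: CkZ; exact: bump_smooth.
- by move=> x; rewrite mulr_ge0 ?bump_ge0// invr_ge0 ltW.
- by move=> x; rewrite mulf_eq0 negb_or => /andP[_]; exact: bs.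
- by rewrite RintZ// mulVf// gt_eqF.
Qed.

End smooth_compact_support.

(** * Multiplication by bounded functions, and Jensen's inequality for the square *)

Section bounded_multipliers.
Context d (T : measurableType d) (R : realType).
Variable mu : {measure set T -> \bar R}.
Implicit Types f g h rho : T -> R.

Lemma intg_mull g f M : measurable_fun setT g -> (forall x, `|g x| <= M) ->
  intg mu f -> intg mu (fun x => g x * f x).
Proof.
move=> mg gM hf; apply: (intg_le _ _ (intgZ M (intg_abs hf))) => [|x].
  by apply: measurable_funM => //; exact: intg_measurable hf.
by rewrite normrM ler_wpM2r.
Qed.

Lemma sqi_mull g f M : measurable_fun setT g -> (forall x, `|g x| <= M) ->
  sqi mu f -> sqi mu (fun x => g x * f x).
Proof.
move=> mg gM hf; apply: (sqi_le _ _ (sqiZ M hf)) => [|x].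
  by apply: measurable_funM => //; exact: hf.1.
by rewrite !normrM ler_wpM2r// (le_trans (gM x))// ler_norm.
Qed.

(** Expand the nonnegative integral of rho (h - m)^2, where m is the mean of h. *)
Lemma jensen_sqr rho h : (forall x, 0 <= rho x) -> intg mu rho -> \int[mu]_x rho x = 1 ->
  measurable_fun setT h -> intg mu (fun x => rho x * h x ^+ 2) ->
  intg mu (fun x => rho x * h x) /\
  (\int[mu]_x (rho x * h x)) ^+ 2 <= \int[mu]_x (rho x * h x ^+ 2).
Proof.
move=> r0 ir r1 mh irh2.
have irh : intg mu (fun x => rho x * h x).
  apply: (intg_le _ _ (intgD ir irh2)) => [|x].
    by apply: measurable_funM => //; exact: intg_measurable ir.
  rewrite normrM ger0_norm// -[X in _ <= X + _]mulr1 -mulrDr; apply: ler_wpM2l => //.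
  by rewrite -[h x ^+ 2]real_normK ?num_real//; have := sqr_ge0 (`|h x| - 1); nra.
split => //; set m := \int[mu]_x _.
have : 0 <= \int[mu]_x (rho x * (h x - m) ^+ 2).
  by apply: Rintegral_ge0 => x _; rewrite mulr_ge0// sqr_ge0.
rewrite (_ : (fun x => _) = (fun x => (rho x * h x ^+ 2 - (2 * m) * (rho x * h x)) + m ^+ 2 * rho x)); last first.
  by apply/funext => x; ring.
have i2 := intgZ (2 * m) irh; have i3 := intgZ (m ^+ 2) ir.
rewrite RintD//; last exact: intgB.
rewrite RintB// !RintZ// r1 -/m; lra.
Qed.

End bounded_multipliers.

(** * Mollification and weak derivatives *)

Section mollification.
Context {R : realType} {n : nat}.
Local Notation mu := (lebesgue_rV n).
Implicit Types (f g phi rho : 'rV[R]_n -> R) (x y z : 'rV[R]_n) (i : 'I_n).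

(** The kernel is taken at y - x, so that the value at x is an average of f(x + z) with weight
    rho(z). Differentiating in x then brings a minus sign, which later cancels that of the weak
    derivative. *)
Definition conv rho f : 'rV[R]_n -> R := fun x => \int[mu]_y (rho (y - x) * f y).

(** Continuity is reduced to sequences so that dominated convergence can prove it. *)
Lemma seq_continuous f x :
  (forall h_ : nat -> 'rV[R]_n, h_ k @[k --> \oo] --> (0 : 'rV[R]_n) ->
    f (x + h_ k) @[k --> \oo] --> f x) -> {for x, continuous f}.
Proof.
move=> H A nA; apply/nbhs_ballP; apply: contrapT => nd.
have /choice[h_ hP] (k : nat) : exists h, `|h| < k.+1%:R^-1 /\ ~ A (f (x + h)).
  apply: contrapT => nh; apply: nd; exists k.+1%:R^-1; first by rewrite /= invr_gt0.
  move=> y; rewrite -ball_normE /= => yx; apply: contrapT => ny; apply: nh.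
  by exists (y - x); rewrite distrC yx addrCA subrr addr0.
have h0 : h_ k @[k --> \oo] --> (0 : 'rV[R]_n).
  apply/cvgrPdist_le => d d0; near=> k.
  rewrite sub0r normrN; apply: ltW; apply: (lt_trans (hP k).1).
  by near: k; exact: (near_infty_natSinv_lt (PosNum d0)).
have [N _ /(_ N (leqnn N))] := H _ h0 _ nA.
exact: (hP N).2.
Unshelve. all: by end_near. Qed.

Lemma continuous_seq f x (u : nat -> 'rV[R]_n) : continuous f ->
  u k @[k --> \oo] --> x -> f (u k) @[k --> \oo] --> f x.
Proof. by move=> cf ux; exact: (continuous_cvg _ (cf x) ux). Qed.

Lemma conv_continuous rho f M : continuous rho -> (forall x, `|rho x| <= M) ->
  intg mu f -> continuous (conv rho f).
Proof.
move=> cr rM hf x; apply: seq_continuous => h_ h0.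
have mt y : measurable_fun setT (fun z => rho (z - y)).
  exact: (measurableT_comp (continuous_measurable_rV cr) (measurable_translate _)).
apply: (@Rint_dct _ _ _ mu (fun k y => rho (y - (x + h_ k)) * f y) _
  (fun y => M * `|f y|) _ _ _ _ _).2.
- by move=> k; apply: measurable_funM => //; exact: intg_measurable hf.
- by apply: measurable_funM => //; exact: intg_measurable hf.
- apply: aeW => y; apply: cvgM; last exact: cvg_cst.
  apply: continuous_seq => //; apply: cvgB; first exact: cvg_cst.
  by rewrite -[X in _ --> X]addr0; apply: cvgD => //; exact: cvg_cst.
- by apply: intgZ; exact: intg_abs.
- by apply: aeW => y k; rewrite normrM ler_wpM2r.
Qed.

(** Differentiation under the integral: by the mean value theorem the difference quotients of the
    kernel are bounded by [M1], so M1 |f| dominates. *)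
Lemma conv_is_derive rho f i x M M1 : Ck 1 rho -> (forall x, `|rho x| <= M) ->
  (forall x, `|partial i rho x| <= M1) -> intg mu f ->
  is_derive x (evec i) (conv rho f) (conv (fun z => - partial i rho z) f x).
Proof.
move=> cr rM rM1 hf.
have mr : measurable_fun setT rho := continuous_measurable_rV (Ck_continuous cr).
have mp : measurable_fun setT (partial i rho).
  by apply: continuous_measurable_rV; have [_ _ h] := cr; exact: (h i).
have mt y : measurable_fun setT (fun z => rho (z - y)).
  exact: (measurableT_comp mr (measurable_translate _)).
have mtp y : measurable_fun setT (fun z => - partial i rho (z - y)).
  by apply: measurableT_comp => //; exact: (measurableT_comp mp (measurable_translate _)).
have mf := intg_measurable hf.
apply: is_derive_cvg; apply/cvgr_dnbhsP => t [t0 tc].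
have E k : (t k)^-1 *: (conv rho f (t k *: evec i + x) - conv rho f x) =
    \int[mu]_y (((t k)^-1 * (rho (y - (t k *: evec i + x)) - rho (y - x))) * f y).
  rewrite /conv -RintB; [|exact: intg_mull..].
  rewrite -[_ *: _]/(_ * _) -RintZ; last by apply: intgB; exact: intg_mull.
  by apply: eq_Rintegral => y _; ring.
under eq_fun do rewrite E.
apply: (@Rint_dct _ _ _ mu _ _ (fun y => M1 * `|f y|) _ _ _ _ _).2.
- by move=> k; apply: measurable_funM => //; apply: measurable_funM => //; exact: measurable_funB.
- exact: measurable_funM.
- apply: aeW => y; apply: cvgM; last exact: cvg_cst.
  have := cvg_is_derive (Ck_is_derive i (y - x) cr).
  move=> /cvgr_dnbhsP/(_ (fun k => - t k)) h.
  have {}h := h (conj (fun k => _) _).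
  have -> : (fun k => (t k)^-1 * (rho (y - (t k *: evec i + x)) - rho (y - x))) =
      (fun k => - ((- t k)^-1 *: (rho (- t k *: evec i + (y - x)) - rho (y - x)))).
    apply/funext => k; rewrite -[_ *: (rho _ - _)]/(_ * _) invrN mulNr opprK scaleNr.
    by rewrite opprD addrCA.
  apply: cvgN; apply: h => [k|]; first by rewrite oppr_eq0.
  by rewrite -[X in _ --> X]oppr0; exact: cvgN.
- by apply: intgZ; exact: intg_abs.
- apply: aeW => y k; rewrite normrM ler_wpM2r// normrM normfV.
  rewrite mulrC ler_pdivrMr ?normr_gt0//.
  have := difference_quotient_bound (y - x) (- t k) cr rM1.
  by rewrite normrN scaleNr opprD addrA [y - _ - x]addrAC.
Qed.

Lemma conv_smooth rho f : Cc_infty setT rho -> intg mu f -> smooth (conv rho f).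
Proof.
move=> hr hf k; elim: k rho hr => [|k IH] rho hr.
  have [M _ rM] := Cc_sup hr; have [sm _ _] := hr.
  exact: (conv_continuous (Ck_continuous (sm 0)) rM hf).
have [M _ rM] := Cc_sup hr; have [sm _ _] := hr.
apply: (@CkP _ _ _ _ (fun i => conv (fun z => - partial i rho z) f)).
- exact: (conv_continuous (Ck_continuous (sm 0)) rM hf).
- move=> i x; have [M1 _ rM1] := Cc_sup (Cc_partial i hr).
  exact: (conv_is_derive x (sm 1) rM rM1 hf).
- move=> i; apply: IH; have := CcZ (-1) (Cc_partial i hr).
  by under eq_fun do rewrite mulN1r.
Qed.

Lemma conv_support rho f d (K : set 'rV[R]_n) x : (forall z, rho z != 0 -> `|z| <= d) ->
  (forall y, ~ K y -> f y = 0) -> conv rho f x != 0 -> exists2 y, K y & `|y - x| <= d.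
Proof.
move=> rd fK; apply: contraNP => nK; apply/eqP.
rewrite /conv (@eq_Rintegral _ _ _ mu setT (fun=> 0)); first by rewrite /Rintegral integral0.
move=> y _; have [Ky|nKy] := pselect (K y); last by rewrite (fK _ nKy) mulr0.
have [->|r0] := eqVneq (rho (y - x)) 0; first by rewrite mul0r.
by exfalso; apply: nK; exists y => //; exact: rd.
Qed.

Section probability_kernel.
Variables (rho : 'rV[R]_n -> R) (d : R).
Hypotheses (srho : smooth rho) (rho0 : forall z, 0 <= rho z)
  (rhod : forall z, rho z != 0 -> `|z| <= d) (rho1 : \int[mu]_z rho z = 1).

Lemma kernel_Cc : Cc_infty setT rho.
Proof.
apply/Cc_inftyP; split => //; exists [set y | `|y - 0| <= d]; split => //.
  exact: rV_cball_compact.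
by move=> x /= nx; apply/eqP/negPn/negP => /rhod; rewrite -[x]subr0.
Qed.

Let irho : intg mu rho := Cc_intg kernel_Cc.

Lemma conv_translateE f x : measurable_fun setT f ->
  conv rho f x = \int[mu]_z (rho z * f (z + x)).
Proof.
move=> mf; rewrite /conv -(Rint_translate x).
  by apply: eq_Rintegral => y _; rewrite addrK.
apply: measurable_funM => //.
exact: (measurableT_comp (Cc_measurable kernel_Cc) (measurable_translate _)).
Qed.

Lemma conv_bound f M x : intg mu f -> (forall y, `|f y| <= M) -> `|conv rho f x| <= M.
Proof.
move=> hf fM; have [B _ rB] := Cc_sup kernel_Cc.
have mf := intg_measurable hf.
rewrite conv_translateE//.
have mr := Cc_measurable kernel_Cc.
have i1 : intg mu (fun z => rho z * f (z + x)) by apply: intg_mull rB _ => //; exact: intg_translate.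
apply: (le_trans (Rint_norm i1)).
have <- : \int[mu]_z (M * rho z) = M by rewrite RintZ// rho1 mulr1.
apply: Rint_le; [exact: intg_abs|exact: intgZ|].
by move=> z; rewrite normrM ger0_norm// mulrC ler_wpM2r.
Qed.

(** At each x, Jensen bounds the squared error by the mean of (f(x + z) - f(x))^2 for the density
    rho. After exchanging the integrals, the inner one is a translation modulus, at most e wherever
    rho does not vanish. *)
Lemma conv_L2_close f e : 0 <= e -> intg mu f -> sqi mu f ->
  (forall h, `|h| <= d -> nrm2 mu (fun x => f (x + h) - f x) <= e) ->
  sqi mu (fun x => conv rho f x - f x) /\ nrm2 mu (fun x => conv rho f x - f x) <= e.
Proof.
move=> e0 hf hf2 fe; have [B B0 rB] := Cc_sup kernel_Cc.
have mf := intg_measurable hf; have mr := Cc_measurable kernel_Cc.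
have [sr _ _] := kernel_Cc.
have mc : measurable_fun setT (conv rho f).
  by apply: continuous_measurable_rV; exact: (conv_continuous (Ck_continuous (sr 0)) rB hf).
have mD : measurable_fun setT (fun x => conv rho f x - f x) by exact: measurable_funB.
pose F (p : 'rV[R]_n * 'rV[R]_n) : R := rho p.2 * (f (p.1 + p.2) - f p.1) ^+ 2.
have mF : measurable_fun setT F.
  apply: measurable_funM; first exact: (measurableT_comp mr measurable_snd).
  apply: measurable_funX; apply: measurable_funB.
    apply: (measurableT_comp mf); apply/measurable_fun_rVP => i.
    under eq_fun do rewrite mxE.
    apply: measurable_funD.
      exact: (measurableT_comp (measurable_coord i) measurable_fst).
    exact: (measurableT_comp (measurable_coord i) measurable_snd).
  exact: (measurableT_comp mf measurable_fst).
have F0 p : 0 <= F p by rewrite mulr_ge0// sqr_ge0.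
have iF x : intg mu (fun z => F (x, z)).
  have h1 := intgZ (2 * B) (intg_translate x hf2.2).
  have h2 := intgZ (2 * f x ^+ 2) irho.
  apply: (intg_le _ _ (intgD h1 h2)) => [|z].
    exact: (measurableT_comp mF (measurable_pair1 x)).
  rewrite ger0_norm// /F /= [x + z]addrC.
  have r0 := rho0 z; have rb : rho z <= B := le_trans (ler_norm _) (rB z).
  have : rho z * (f (z + x) - f x) ^+ 2 <= rho z * (2 * f (z + x) ^+ 2 + 2 * f x ^+ 2).
    by apply: ler_wpM2l => //; have := sqr_ge0 (f (z + x) + f x); nra.
  have : rho z * f (z + x) ^+ 2 <= B * f (z + x) ^+ 2 by apply: ler_wpM2r => //; exact: sqr_ge0.
  by lra.
have le1 x : (conv rho f x - f x) ^+ 2 <= \int[mu]_z F (x, z).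
  have mh : measurable_fun setT (fun z => f (x + z) - f x).
    by apply: measurable_funB => //; under eq_fun do rewrite addrC;
      exact: (measurableT_comp mf (measurable_translate _)).
  have [i1 J] := jensen_sqr rho0 irho rho1 mh (iF x).
  apply: le_trans J; rewrite conv_translateE//.
  rewrite (_ : f x = \int[mu]_z (f x * rho z)); last by rewrite RintZ// rho1 mulr1.
  rewrite -RintB; last 2 first.
  - by apply: intg_mull rB _ => //; exact: intg_translate.
  - exact: intgZ.
  rewrite le_eqVlt; apply/orP; left; apply/eqP; congr (_ ^+ 2).
  by apply: eq_Rintegral => z _; rewrite RintZ// rho1 mulr1 [x + z]addrC; ring.
have mEF : measurable_fun setT (EFin \o F) by exact/measurable_EFinP.
have EF0 p : (0 <= (EFin \o F) p)%E by rewrite lee_fin.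
have mD2 : measurable_fun setT (fun x => ((conv rho f x - f x) ^+ 2)%:E).
  by apply/measurable_EFinP; exact: measurable_funX.
have mI1 : measurable_fun setT (fun x => \int[mu]_z (F (x, z))%:E)%E.
  exact: (@measurable_fun_fubini_tonelli_F _ _ _ _ _ mu (EFin \o F) mEF EF0).
have mI2 : measurable_fun setT (fun z => \int[mu]_x (F (x, z))%:E)%E.
  exact: (@measurable_fun_fubini_tonelli_G _ _ _ _ _ mu (EFin \o F) mEF EF0).
have mer : measurable_fun setT (fun z => (e * rho z)%:E).
  by apply/measurable_EFinP; exact: measurable_funM.
have le2 : (\int[mu]_x ((conv rho f x - f x) ^+ 2)%:E <= e%:E)%E.
  apply: (@le_trans _ _ (\int[mu]_x \int[mu]_z (F (x, z))%:E)%E).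
    apply: (ge0_le_integral mu measurableT _ mD2 mI1).
    - by move=> x _; rewrite lee_fin sqr_ge0.
    - by move=> x _; rewrite -(EFin_Rint (iF x)) lee_fin; exact: le1.
  have -> := @fubini_tonelli _ _ _ _ R mu mu (EFin \o F) mEF EF0.
  apply: (@le_trans _ _ (\int[mu]_z (e * rho z)%:E)%E); last first.
    by rewrite -EFin_Rint ?RintZ ?rho1 ?mulr1//; exact: intgZ.
  apply: (ge0_le_integral mu measurableT _ mI2 mer).
  - by move=> z _; apply: integral_ge0 => x _; rewrite lee_fin.
  - move=> z _.
    have sD := sqi_diff_translate z hf2.
    rewrite -(EFin_Rint (intgZ (rho z) sD.2)).
    rewrite lee_fin /F /= RintZ; last exact: sD.2.
    have [->|rz] := eqVneq (rho z) 0; first by rewrite mul0r mulr0.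
    by rewrite mulrC ler_wpM2r//; apply: fe; exact: rhod.
have iD : intg mu (fun x => (conv rho f x - f x) ^+ 2).
  apply/integrableP; split; first by apply/measurable_EFinP; exact: measurable_funX.
  under eq_integral => x _ do rewrite gee0_abs ?lee_fin ?sqr_ge0//.
  by apply: (le_lt_trans le2); rewrite ltry.
split; first by split.
by rewrite -lee_fin EFin_Rint.
Qed.

End probability_kernel.

End mollification.

(** * Weak derivatives on the whole space and their approximation by smooth functions *)

Section weak_derivatives.
Context {R : realType} {n : nat}.
Local Notation mu := (lebesgue_rV n).
Implicit Types (f g phi rho : 'rV[R]_n -> R) (x y z : 'rV[R]_n) (i : 'I_n)
  (K U : set 'rV[R]_n) (r e d c M : R).

Lemma indicator_cball r : intg mu (\1_[set y : 'rV[R]_n | `|y| <= r] : 'rV[R]_n -> R).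
Proof.
have mB : measurable [set y : 'rV[R]_n | `|y| <= r].
  by rewrite (_ : [set _ | _] = [set y | `|y - 0| <= r]);
    [exact: measurable_cball|apply/seteqP; split => y /=; rewrite subr0].
by apply: intg_indic => //; exact: (bounded_measure_fin (r := r)).
Qed.

Lemma sqi_intg f r : sqi mu f -> (forall x, f x != 0 -> `|x| <= r) -> intg mu f.
Proof.
move=> hf fr; apply: (intg_le hf.1 _ (intgD hf.2 (indicator_cball r))) => x.
have [->|fx] := eqVneq (f x) 0.
  by rewrite normr0 addr_ge0 ?sqr_ge0// indicE.
rewrite indicE mem_set /=; last exact: fr.
by rewrite -[f x ^+ 2]real_normK ?num_real//; have := sqr_ge0 (`|f x| - 1); nra.
Qed.

(** By translation invariance each difference quotient has integral 0, and these quotients converge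
    boundedly on a fixed cube. *)
Lemma Rint_partial0 (F : 'rV[R]_n -> R) i : Cc_infty setT F -> \int[mu]_x partial i F x = 0.
Proof.
move=> hF; have [sm _ _] := hF; have [M M0 FM] := Cc_sup (Cc_partial i hF).
have [r r0 Fr] := Cc_support_bound hF; have mF := Cc_measurable hF.
pose t (k : nat) : R := k.+1%:R^-1.
have t0 k : t k != 0 by rewrite invr_eq0.
have tc : t k @[k --> \oo] --> 0 by exact: cvg_harmonic.
have iF := Cc_intg hF.
have Z k : \int[mu]_x ((t k)^-1 * (F (x + t k *: evec i) - F x)) = 0.
  have iT := intg_translate (t k *: evec i) iF.
  by rewrite RintZ ?RintB ?Rint_translate ?subrr ?mulr0//; exact: intgB.
have : \int[mu]_x ((t k)^-1 * (F (x + t k *: evec i) - F x)) @[k --> \oo] --> \int[mu]_x partial i F x.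
  apply: (@Rint_dct _ _ _ mu _ _ (fun x => M * \1_[set y : 'rV[R]_n | `|y| <= r + 1] x) _ _ _ _ _).2.
  - move=> k; apply: measurable_funM => //; apply: measurable_funB => //.
    exact: (measurableT_comp mF (measurable_translate _)).
  - exact: (Cc_measurable (Cc_partial i hF)).
  - apply: aeW => x; have := cvg_is_derive (Ck_is_derive i x (sm 1)).
    move=> /cvgr_dnbhsP/(_ t (conj t0 tc)).
    have -> : (fun k => (t k)^-1 *: (F (t k *: evec i + x) - F x)) =
        (fun k => (t k)^-1 * (F (x + t k *: evec i) - F x)) => //.
    by apply/funext => k; rewrite [x + _]addrC.
  - by apply: intgZ; exact: indicator_cball.
  - apply: aeW => x k; rewrite indicE; have [_|] := boolP (x \in _).
      rewrite mulr1 normrM normfV mulrC ler_pdivrMr ?normr_gt0//.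
      exact: (difference_quotient_bound x (t k) (sm 1) FM).
    rewrite notin_setE /= => /negP; rewrite -ltNge => rx.
    have tk : `|t k *: evec i| <= 1.
      apply: (le_trans (norm_scale_evec _ _)); rewrite ger0_norm ?invr_ge0//.
      by rewrite invf_le1 ?ltr0n// ler1n.
    have -> : F x = 0 by apply/eqP/negPn/negP => /Fr; lra.
    have -> : F (x + t k *: evec i) = 0.
      apply/eqP/negPn/negP => /Fr.
      by have := ler_normB (x + t k *: evec i) (t k *: evec i); rewrite addrK; lra.
    by rewrite subrr mulr0 normr0 mulr0.
under eq_fun do rewrite Z.
by move=> /cvg_lim <- //; rewrite lim_cst.
Qed.

(** Only the integration by parts formula of [is_wpartial] on the whole space; integrability is
    carried separately by [sqi]. *)
Definition weak_partial i f g := forall phi, Cc_infty setT phi ->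
  \int[mu]_x (f x * partial i phi x) = - \int[mu]_x (g x * phi x).

Local Notation WD := weak_partial.

Lemma WD_smooth F i : Cc_infty setT F -> WD i F (partial i F).
Proof.
move=> hF phi hp; have [sF _ _] := hF; have [sp _ _] := hp.
have := Rint_partial0 i (Cc_mull sF hp).
rewrite partialM ?RintD; [|exact: sqi_mul (Cc_sqi hF) (Cc_sqi (Cc_partial i hp))
  |exact: sqi_mul (Cc_sqi hp) (Cc_sqi (Cc_partial i hF))|exact: sF|exact: sp].
move=> /eqP; rewrite addr_eq0 => /eqP ->; congr (- _).
by apply: eq_Rintegral => x _; rewrite mulrC.
Qed.

Lemma WDD f g f' g' i : sqi mu f -> sqi mu g -> sqi mu f' -> sqi mu g' ->
  WD i f g -> WD i f' g' -> WD i (fun x => f x + f' x) (fun x => g x + g' x).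
Proof.
move=> sf sg sf' sg' h h' phi hp.
have sp := Cc_sqi hp; have sdp := Cc_sqi (Cc_partial i hp).
under eq_Rintegral do rewrite mulrDl.
under [in RHS]eq_Rintegral do rewrite mulrDl.
by rewrite !RintD ?h ?h' ?opprD//; exact: sqi_mul.
Qed.

Lemma WDZ c f g i : sqi mu f -> sqi mu g -> WD i f g ->
  WD i (fun x => c * f x) (fun x => c * g x).
Proof.
move=> sf sg h phi hp.
have sp := Cc_sqi hp; have sdp := Cc_sqi (Cc_partial i hp).
under eq_Rintegral do rewrite -mulrA.
under [in RHS]eq_Rintegral do rewrite -mulrA.
by rewrite !RintZ ?h ?mulrN//; exact: sqi_mul.
Qed.

Lemma WDB f g f' g' i : sqi mu f -> sqi mu g -> sqi mu f' -> sqi mu g' ->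
  WD i f g -> WD i f' g' -> WD i (fun x => f x - f' x) (fun x => g x - g' x).
Proof.
move=> sf sg sf' sg' h h'.
have := WDD sf sg (sqiZ (-1) sf') (sqiZ (-1) sg') h (WDZ (-1) sf' sg' h').
by under eq_fun do rewrite mulN1r; under [in X in WD _ _ X]eq_fun do rewrite mulN1r.
Qed.

Lemma WD_ae f g f' g' i : measurable_fun setT f -> measurable_fun setT g ->
  measurable_fun setT f' -> measurable_fun setT g' ->
  {ae mu, forall x, f x = f' x} -> {ae mu, forall x, g x = g' x} ->
  WD i f g -> WD i f' g'.
Proof.
move=> mf mg mf' mg' ff' gg' h phi hp.
have mp := Cc_measurable hp; have mdp := Cc_measurable (Cc_partial i hp).
have := h _ hp.
rewrite (@Rint_ae_eq _ _ _ mu _ (fun x => f' x * partial i phi x)); last 3 first.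
- exact: measurable_funM.
- exact: measurable_funM.
- by apply: filterS ff' => x ->.
move=> ->; congr (- _); apply: Rint_ae_eq; try exact: measurable_funM.
by apply: filterS gg' => x ->.
Qed.

(** The weak derivative is tested on a translate of the kernel; its minus sign cancels the one
    produced by differentiating [conv]. *)
Lemma partial_conv f g i rho : Cc_infty setT rho -> intg mu f -> intg mu g ->
  WD i f g -> partial i (conv rho f) = conv rho g.
Proof.
move=> hr hf hg h; apply/funext => x; apply: partialE.
have [sr _ _] := hr; have [M _ rM] := Cc_sup hr.
have [M1 _ rM1] := Cc_sup (Cc_partial i hr).
suff <- : conv (fun z => - partial i rho z) f x = conv rho g x.
  exact: (conv_is_derive x (sr 1) rM rM1 hf).
have mpr := Cc_measurable (Cc_partial i hr).
have := h _ (Cc_translate (- x) hr); rewrite partial_translate; last exact: sr.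
have -> : \int[mu]_y (g y * rho (y - x)) = conv rho g x.
  by apply: eq_Rintegral => y _; rewrite mulrC.
move=> E; rewrite -[RHS]opprK -E -RintN.
  by apply: eq_Rintegral => y _; rewrite mulNr mulrC.
under eq_fun do rewrite mulrC; apply: intg_mull hf => [|y].
  exact: (measurableT_comp mpr (measurable_translate _)).
exact: rM1.
Qed.

Lemma common_mollifier (I : finType) (h : I -> 'rV[R]_n -> R) e (d0 : R) :
  (forall a, sqi mu (h a)) -> (forall a, intg mu (h a)) -> 0 < e -> 0 < d0 ->
  exists (rho : 'rV[R]_n -> R) (d : R), [/\ 0 < d <= d0,
    [/\ smooth rho, forall x, 0 <= rho x, forall x, rho x != 0 -> `|x| <= d &
      \int[mu]_x rho x = 1] &
    forall a, sqi mu (fun x => conv rho (h a) x - h a x) /\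
      nrm2 mu (fun x => conv rho (h a) x - h a x) <= e].
Proof.
move=> sh ih e0 d00.
have /choice[D DP] (a : I) : exists d, 0 < d /\ forall v, `|v| <= d ->
    nrm2 mu (fun x => h a (x + v) - h a x) <= e.
  by have [d dp dP] := L2_translate_small (sh a) e0; exists d.
(* The inverse of a sum of inverses lies below each of the radii, and serves as a positive lower
   bound for the finite family. *)
pose S := d0^-1 + \sum_a (D a)^-1.
have DI a : 0 < (D a)^-1 by rewrite invr_gt0; exact: (DP a).1.
have SI : 0 <= \sum_a (D a)^-1 by apply: sumr_ge0 => a _; exact: ltW.
have d0I : 0 < d0^-1 by rewrite invr_gt0.
have S0 : 0 < S by rewrite ltr_pwDl.
have Sd0 : S^-1 <= d0 by rewrite -[leRHS]invrK lef_pV2 ?posrE// lerDl.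
have SD a : S^-1 <= D a.
  rewrite -[leRHS]invrK lef_pV2 ?posrE//.
  rewrite /S (bigD1 a)//= addrCA lerDl; apply: addr_ge0; first exact: ltW.
  by apply: sumr_ge0 => b _; exact: ltW.
have Si0 : 0 < S^-1 by rewrite invr_gt0.
have [rho [r1 r2 r3 r4]] := @mollifier_exists R n _ Si0.
exists rho, S^-1; split => //; first by rewrite Si0.
move=> a; apply: (conv_L2_close r1 r2 r3 r4 (ltW e0) (ih a) (sh a)) => v vS.
by apply: (DP a).2; exact: le_trans (SD a).
Qed.

Lemma smooth_approximation f (g : 'I_n -> 'rV[R]_n -> R) K r e (d0 : R) :
  (forall x, K x -> `|x| <= r) -> 0 < e -> 0 < d0 ->
  sqi mu f -> (forall i, sqi mu (g i)) ->
  (forall x, ~ K x -> f x = 0) -> (forall i x, ~ K x -> g i x = 0) ->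
  (forall i, WD i f (g i)) ->
  exists phi, [/\ Cc_infty setT phi,
    forall x, phi x != 0 -> exists2 y, K y & `|y - x| <= d0,
    nrm2 mu (fun x => phi x - f x) <= e,
    forall i, nrm2 mu (fun x => partial i phi x - g i x) <= e &
    forall M, (forall x, `|f x| <= M) -> forall x, `|phi x| <= M].
Proof.
move=> Kr e0 d00 sf sg fK gK wd.
have sup0 (h : 'rV[R]_n -> R) : (forall x, ~ K x -> h x = 0) -> forall x, h x != 0 -> `|x| <= r.
  move=> hK x hx; apply: Kr; apply: contrapT => /hK h0; by rewrite h0 eqxx in hx.
have i_f : intg mu f := sqi_intg sf (sup0 _ fK).
have i_g i : intg mu (g i) := sqi_intg (sg i) (sup0 _ (gK i)).
(* [None] stands for the function and [Some i] for its derivatives, so that a single kernel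
   approximates all of them. *)
pose h (a : option 'I_n) := if a is Some i then g i else f.
have sh a : sqi mu (h a) by case: a.
have ih a : intg mu (h a) by case: a.
have [rho [d [/andP[dp dd0] [r1 r2 r3 r4] cl]]] := common_mollifier sh ih e0 d00.
have rC := kernel_Cc r1 r3.
have sc x : conv rho f x != 0 -> exists2 y, K y & `|y - x| <= d0.
  by move=> /(conv_support r3 fK)[y Ky yx]; exists y => //; exact: le_trans dd0.
exists (conv rho f); split => //.
- apply/Cc_inftyP; split; first exact: conv_smooth.
  exists [set y | `|y - 0| <= r + d0]; split => //; first exact: rV_cball_compact.
  move=> x /= nx; apply/eqP/negPn/negP => /sc[y Ky yx]; apply: nx.
  rewrite subr0; have := ler_distD y x 0; rewrite !subr0 distrC.
  by have := Kr _ Ky; lra.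
- exact: (cl None).2.
- by move=> i; rewrite (partial_conv rC i_f (i_g i) (wd i)); exact: (cl (Some i)).2.
- by move=> M fM x; apply: (conv_bound r1 r2 r3 r4).
Qed.

(** The variant without derivatives, meant for the discontinuous sign function in the fundamental
    lemma. *)
Lemma approximation_bounded f K r e (d0 : R) M :
  (forall x, K x -> `|x| <= r) -> 0 < e -> 0 < d0 ->
  measurable_fun setT f -> (forall x, `|f x| <= M) -> (forall x, ~ K x -> f x = 0) ->
  exists phi, [/\ Cc_infty setT phi,
    forall x, phi x != 0 -> exists2 y, K y & `|y - x| <= d0,
    nrm2 mu (fun x => phi x - f x) <= e &
    forall x, `|phi x| <= M].
Proof.
move=> Kr e0 d00 mf fM fK.
have sup0 x : f x != 0 -> `|x| <= r.
  move=> hx; apply: Kr; apply: contrapT => /fK h0; by rewrite h0 eqxx in hx.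
have sf := sqi_bounded mf fM sup0; have i_f := intg_bounded mf fM sup0.
have [rho [d [/andP[dp dd0] [r1 r2 r3 r4] cl]]] :=
  @common_mollifier unit (fun=> f) e d0 (fun=> sf) (fun=> i_f) e0 d00.
have rC := kernel_Cc r1 r3.
have sc x : conv rho f x != 0 -> exists2 y, K y & `|y - x| <= d0.
  by move=> /(conv_support r3 fK)[y Ky yx]; exists y => //; exact: le_trans dd0.
exists (conv rho f); split => //.
- apply/Cc_inftyP; split; first exact: conv_smooth.
  exists [set y | `|y - 0| <= r + d0]; split => //; first exact: rV_cball_compact.
  move=> x /= nx; apply/eqP/negPn/negP => /sc[y Ky yx]; apply: nx.
  rewrite subr0; have := ler_distD y x 0; rewrite !subr0 distrC.
  by clear cl; have := Kr _ Ky; lra.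
- exact: (cl tt).2.
- by move=> x; apply: (conv_bound r1 r2 r3 r4).
Qed.

End weak_derivatives.

(** * Compact exhaustions, cut-off functions and the fundamental lemma *)

Section exhaustion.
Context {R : realType} {n : nat}.
Local Notation mu := (lebesgue_rV n).
Implicit Types (f g phi h : 'rV[R]_n -> R) (x y z : 'rV[R]_n) (i : 'I_n)
  (K U V : set 'rV[R]_n) (r e d c M : R).

(** Compactness makes the distance to the complement of [U] uniform over [K]; half of that distance
    leaves room for taking a closure. *)
Lemma compact_enlarge K U : compact K -> open U -> K `<=` U ->
  exists2 d, 0 < d & exists K', [/\ compact K', K' `<=` U &
    forall x y, K x -> `|y - x| <= d -> K' y].
Proof.
move=> cK oU KU.
have [d d0 dP] : exists2 d : R, 0 < d & forall x y, K x -> `|y - x| <= d -> U y.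
  pose P (d : R) x := forall y, `|y - x| <= d -> U y.
  have : \forall d \near 0^'+, K `<=` P d.
    move/compact_near_coveringP : cK => /(_ R (0^'+) P _); apply => x Kx.
    have /nbhs_ballP[e /= e0 eU] : nbhs x U by apply: open_nbhs_nbhs; split => //; exact: KU.
    exists (ball x (e / 2), [set d | d < e / 2]) => /=.
      split; first by apply: nbhsx_ballx; rewrite divr_gt0.
      by apply: nbhs_right_lt; rewrite divr_gt0.
    move=> [x' d] /= [+ de] y yx'; rewrite -ball_normE /= => xx'.
    apply: eU; rewrite -ball_normE /=.
    have := ler_distD x' x y; rewrite (distrC x' y).
    by move: (`|x - y|) (`|x - x'|) (`|y - x'|) xx' de yx' => a b c; lra.
  move=> [e /= e0 eP]; exists (e / 2); first by rewrite divr_gt0.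
  move=> x y Kx; apply: (eP (e / 2) _ _ x Kx) => /=; last by rewrite divr_gt0.
  by rewrite sub0r normrN ger0_norm; lra.
have [r r0 Kr] := compact_norm_bound cK.
exists (d / 2); first by rewrite divr_gt0.
pose Kd := [set y | exists2 x, K x & `|y - x| <= d / 2].
exists (closure Kd); split.
- apply: bounded_closed_compact; last exact: closed_closure.
  exists (r + d); split; first exact: num_real.
  move=> M rM y cy; apply: ltW; apply: le_lt_trans rM.
  have : nbhs y (ball y (d / 2)) by apply: nbhsx_ballx; rewrite divr_gt0.
  move=> /cy[z [[x Kx zx]]]; rewrite -ball_normE /= => yz.
  have h1 := Kr _ Kx; have h2 := ler_distD z y x; have := ler_normD (y - x) x.
  by rewrite subrK; lra.
- move=> y cy.
  have : nbhs y (ball y (d / 2)) by apply: nbhsx_ballx; rewrite divr_gt0.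
  move=> /cy[z [[x Kx zx]]]; rewrite -ball_normE /= => yz.
  by apply: (dP x) => //; have h2 := ler_distD z y x; lra.
- by move=> x y Kx yx; apply: subset_closure; exists x.
Qed.

(** Finite unions of the rational cubes contained in [U]. Each point has such a cube as a
    neighbourhood, so a compact set is already covered at some finite stage. *)
Lemma compact_exhaustion U : open U -> exists C : nat -> set 'rV[R]_n,
  [/\ forall j, compact (C j), forall j k, (j <= k)%N -> C j `<=` C k,
      forall j, C j `<=` U & forall K, compact K -> K `<=` U -> exists j, K `<=` C j].
Proof.
move=> oU.
pose B k : set 'rV[R]_n := if unpickle k is Some p then
  (if `[< rat_ball p `<=` U >] then rat_ball p else set0) else set0.
have cB k : compact (B k).
  rewrite /B; case: unpickle => [p|]; last exact: compact0.
  by case: asboolP => _; [exact: rV_cball_compact|exact: compact0].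
have BU k : B k `<=` U.
  by move=> x; rewrite /B; case: unpickle => [p|[]]; case: asboolP => [pU /pU|_ []].
exists (fun j => \bigcup_(k < j) B k); split.
- move=> j; elim: j => [|j IH]; first by rewrite bigcup_mkord big_ord0; exact: compact0.
  by rewrite bigcup_mkord big_ord_recr /= -bigcup_mkord; exact: compactU.
- by move=> j k jk x [l /= lj Bx]; exists l => //=; exact: leq_trans jk.
- by move=> j x [l _ /BU].
- move=> K cK KU.
  have : \forall j \near \oo, K `<=` \bigcup_(k < j) B k.
    move/compact_near_coveringP : cK.
    move=> /(_ nat \oo (fun j => \bigcup_(k < j) B k) _); apply => x Kx.
    have [p [pU px]] := open_rat_ball oU (KU _ Kx).
    exists (rat_ball p, [set j | (pickle p < j)%N]) => /=.
      by split => //; exists (pickle p).+1.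
    move=> [x' j] /= [px' pj]; exists (pickle p) => //.
    by rewrite /B pickleK asboolT.
  by move=> [j _ jP]; exists j; exact: (jP j (leqnn j)).
Qed.

Lemma ae_forall_nat (P : nat -> 'rV[R]_n -> Prop) :
  (forall j, {ae mu, forall x, P j x}) -> {ae mu, forall x, forall j, P j x}.
Proof.
move=> h.
suff : mu.-negligible (\bigcup_j ~` [set x | P j x]).
  apply: negligibleS => x /= nx; apply: contrapT => nn; apply: nx => j.
  by apply: contrapT => nP; apply: nn; exists j.
by apply: negligible_bigcup => j; exact: h.
Qed.

Lemma cutoff_exists K U : compact K -> open U -> K `<=` U ->
  exists (eta : 'rV[R]_n -> R) d, [/\ Cc_infty U eta, forall x, 0 <= eta x <= 1, 0 < d &
    forall x y, K x -> `|y - x| <= d -> eta y = 1].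
Proof.
move=> cK oU KU.
have [d1 d10 [K1 [cK1 K1U K1P]]] := compact_enlarge cK oU KU.
have [d2 d20 [K2 [cK2 K2U K2P]]] := compact_enlarge cK1 oU K1U.
(* The indicator of [K1] is mollified at radius [dr]: at most d1 / 2, so that the result is 1 within
   d1 / 2 of [K], and at most [d2], so that the support stays in [K2]. *)
pose d := d1 / 2; pose dr := Num.min d d2.
have d0 : 0 < d by rewrite divr_gt0.
have dr0 : 0 < dr by rewrite lt_min d0.
have [rho [r1 r2 r3 r4]] := @mollifier_exists R n _ dr0.
have mK1 : measurable K1 := compact_measurable_rV cK1.
pose f : 'rV[R]_n -> R := \1_K1.
have mf : measurable_fun setT f by exact: measurable_indic.
have fK x : ~ K1 x -> f x = 0 by move=> nK; rewrite /f indicE memNset.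
have f1 x : `|f x| <= 1 by rewrite /f indicE; case: (_ \in _); rewrite ?normr1 ?normr0.
have [r _ rP] := compact_norm_bound cK1.
have i_f : intg mu f.
  by apply: (intg_bounded mf f1 (r := r)) => x fx; apply: rP; apply: contrapT => /fK f0; rewrite f0 eqxx in fx.
have rC := kernel_Cc r1 r3.
exists (conv rho f), d; split => //.
- apply/Cc_inftyP; split; first exact: conv_smooth.
  exists K2; split => // x nx; apply/eqP/negPn/negP => /(conv_support r3 fK)[y Ky yx].
  apply: nx; apply: (K2P y) => //; rewrite distrC; apply: (le_trans yx).
  by rewrite ge_min lexx orbT.
- move=> x; apply/andP; split; last first.
    by apply: (le_trans (ler_norm _)); exact: (conv_bound r1 r2 r3 r4).
  by apply: Rintegral_ge0 => y _; rewrite mulr_ge0.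
- move=> x y Kx yx; rewrite (conv_translateE r1 r3 _ mf) -r4.
  apply: eq_Rintegral => z _; have [->|rz] := eqVneq (rho z) 0; first by rewrite mul0r.
  rewrite /f indicE mem_set ?mulr1//; apply: (K1P x) => //.
  have zd : `|z| <= d by apply: (le_trans (r3 _ rz)); rewrite ge_min lexx.
  have := ler_normD z (y - x); rewrite addrA /d in zd yx *.
  by move: yx zd; rewrite /d; move: (`|z|) (`|y - x|) (`|z + y - x|) => a b c; lra.
Qed.

Lemma measurable_sgr : measurable_fun setT (Num.sg : R -> R).
Proof.
rewrite (_ : Num.sg = fun t : R => \1_(`]0, +oo[%classic) t - \1_(`]-oo, 0[%classic) t).
  by apply: measurable_funB; apply: measurable_indic; exact: measurable_itv.
apply/funext => t; rewrite !indicE; case: (sgrP t) => [->|t0|t0].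
- by rewrite !memNset ?subrr//= in_itv/= ltxx.
- by rewrite mem_set ?memNset ?subr0//= in_itv/= ?t0// ltNge ltW.
- by rewrite memNset ?mem_set ?sub0r//= in_itv/= ?t0// andbT ltNge ltW.
Qed.

(* Only local integrability of h is available, so the test functions approximate
   the bounded function sgn h on a compact set and the limit is taken by dominated convergence. *)
Lemma fundamental_lemma U h : open U -> measurable_fun U h ->
  (forall K, compact K -> K `<=` U -> mu.-integrable K (EFin \o h)) ->
  (forall phi, Cc_infty U phi -> \int[mu]_(x in U) (h x * phi x) = 0) ->
  {ae mu, forall x, U x -> h x = 0}.
Proof.
move=> oU mhU ih H.
have [C [cC C_mono CU CP]] := compact_exhaustion oU.
suff HC j : {ae mu, forall x, C j x -> h x = 0}.
  apply: filterS (ae_forall_nat HC) => x xh Ux.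
  have sU : [set x] `<=` U by move=> y ->.
  have [j jP] := CP _ (@compact_set1 _ x) sU.
  by apply: (xh j); exact: jP.
have [d d0 [K' [cK' K'U K'P]]] := compact_enlarge (cC j) oU (CU j).
have mU := open_measurable_rV oU.
have mK' := compact_measurable_rV cK'; have mC := compact_measurable_rV (cC j).
pose hU := h \_ U.
have mhU' : measurable_fun setT hU.
  by apply/(measurable_restrictT _ mU).
pose psi x := Num.sg (hU x) * \1_(C j) x.
have mpsi : measurable_fun setT psi.
  by apply: measurable_funM; [exact: (measurableT_comp measurable_sgr)|exact: measurable_indic].
have psi1 x : `|psi x| <= 1.
  rewrite /psi normrM indicE normr_sg; case: (_ == _); case: (_ \in _);
  by rewrite /= ?mul0r ?mulr0 ?mul1r ?normr1 ?normr0.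
have psiK x : ~ C j x -> psi x = 0 by move=> nC; rewrite /psi indicE memNset ?mulr0.
have [r _ rP] := compact_norm_bound (cC j).
(* The errors 2^(-k) are summable, which yields almost everywhere convergence of the whole
   sequence. *)
have p20 (k : nat) : 0 < 2^-1 ^+ k :> R by rewrite exprn_gt0 ?invr_gt0.
have /choice[phi phiP] (k : nat) := approximation_bounded rP (p20 k) d0 mpsi psi1 psiK.
have phiC k : Cc_infty setT (phi k) by have [] := phiP k.
have phiK k x : ~ K' x -> phi k x = 0.
  move=> nK; apply/eqP/negPn/negP; have [_ + _ _] := phiP k.
  by move=> /[apply] -[y Cy yx]; apply: nK; apply: (K'P y); rewrite // distrC.
have phiU k : Cc_infty U (phi k).
  apply/Cc_inftyP; split; first by have [] := phiC k.
  by exists K'; split => // x; exact: phiK.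
have spsi : sqi mu psi.
  by apply: (sqi_bounded mpsi psi1 (r := r)) => x px; apply: rP; apply: contrapT => /psiK p; rewrite p eqxx in px.
have cv : {ae mu, forall x, phi k x @[k --> \oo] --> psi x}.
  have := @ae_cvg0_summable _ _ _ mu (fun k x => phi k x - psi x) (fun k => sqiB (Cc_sqi (phiC k)) spsi)
    (fun k => let: And4 _ _ h _ := phiP k in h).
  apply: filterS => x cx; have : phi k x - psi x + psi x @[k --> \oo] --> 0 + psi x.
    by apply: cvgD => //; exact: cvg_cst.
  by rewrite add0r; under eq_fun do rewrite subrK.
have ihK : intg mu (hU \_ K').
  have -> : hU \_ K' = h \_ K'.
    by apply/funext => x; rewrite /hU !patchE; case: ifPn => // /set_mem /K'U Ux; rewrite mem_set.
  exact: ((intg_in mu h mK').1 (ih _ cK' K'U)).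
have mhK := intg_measurable ihK.
have [||||| _ cvI] := @Rint_dct _ _ _ mu (fun k x => (hU \_ K') x * phi k x)
    (fun x => (hU \_ K') x * psi x) (fun x => `|(hU \_ K') x|).
- by move=> k; apply: measurable_funM => //; exact: Cc_measurable (phiC k).
- exact: measurable_funM.
- by apply: filterS cv => x cx; apply: cvgM => //; exact: cvg_cst.
- exact: intg_abs.
- apply: aeW => x k; rewrite normrM ler_piMr//.
  by have [_ _ _] := phiP k; exact.
have Z k : \int[mu]_x ((hU \_ K') x * phi k x) = 0.
  rewrite -(H _ (phiU k)) [RHS]Rint_in; apply: eq_Rintegral => x _.
  rewrite /hU !patchE; case: (boolP (x \in U)) => Ux; case: (boolP (x \in K')) => Kx //.
  - rewrite phiK ?mulr0 ?mul0r//; last by move=> Kx'; move: Kx; rewrite mem_set.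
  - by rewrite mul0r.
  - by rewrite mul0r.
have {cvI} I0 : \int[mu]_x ((hU \_ K') x * psi x) = 0.
  by move: cvI; under eq_fun do rewrite Z; move=> /cvg_lim <- //; rewrite lim_cst.
have E x : (hU \_ K') x * psi x = `|hU x| * \1_(C j) x.
  rewrite /psi patchE indicE; have [/set_mem Cx|_] := boolP (x \in C j); last by rewrite !mulr0.
  rewrite mem_set ?mulr1; last by apply: (K'P x) => //; rewrite subrr normr0 ltW.
  by rewrite mulrC -normrEsg.
have iE : intg mu (fun x => `|hU x| * \1_(C j) x).
  under eq_fun do rewrite -E mulrC.
  by apply: intg_mull psi1 ihK.
have mE := intg_measurable iE.
have mEE : measurable_fun setT (EFin \o (fun x => `|hU x| * \1_(C j) x)) by exact/measurable_EFinP.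
have : (\int[mu]_x `|(`|hU x| * \1_(C j) x)%:E| = 0)%E.
  under eq_integral => x _ do rewrite gee0_abs ?lee_fin ?mulr_ge0//.
  by rewrite -EFin_Rint//; under eq_Rintegral do rewrite -E; rewrite I0.
move=> /(ae_eq_integral_abs mu measurableT mEE).1.
apply: filterS => x /(_ I) /= [] /eqP; rewrite mulf_eq0 normr_eq0 indicE.
move=> + Cx; rewrite mem_set// oner_eq0 orbF /hU patchE mem_set ?(CU _ _ Cx)//.
  by move=> /eqP.
exact: (CU j).
Qed.

End exhaustion.

(** * Difference quotients and the negative part *)

Section difference_quotients.
Context {R : realType} {n : nat}.
Local Notation mu := (lebesgue_rV n).
Local Notation WD := weak_partial.
Implicit Types (f g phi h F : 'rV[R]_n -> R) (x y z v : 'rV[R]_n) (i : 'I_n)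
  (r e d c M t : R).

Lemma nrm2_ball_bound f M r : measurable_fun setT f -> (forall x, `|f x| <= M) ->
  (forall x, f x != 0 -> `|x| <= r) ->
  nrm2 mu f <= M ^+ 2 * \int[mu]_x (\1_[set y : 'rV[R]_n | `|y| <= r] : 'rV[R]_n -> R) x.
Proof.
move=> mf fM fr; have iB := indicator_cball r; rewrite -RintZ//.
have [_ i2] := sqi_bounded mf fM fr.
apply: Rint_le => //; first exact: intgZ.
move=> x; rewrite indicE; have [->|fx] := eqVneq (f x) 0.
  by rewrite expr0n /= mulr_ge0 ?sqr_ge0.
rewrite mem_set ?mulr1 /=; last exact: fr.
by rewrite -[f x ^+ 2]real_normK ?num_real// lerXn2r ?nnegrE// (le_trans _ (fM x)).
Qed.

(** The Taylor remainder is at most M t^2 and, for |t| <= 1, vanishes outside a fixed cube; the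
    squared norm is thus of order t^4. *)
Lemma smooth_difference_quotient F i : Cc_infty setT F ->
  exists2 C, 0 <= C & forall t, `|t| <= 1 ->
    nrm2 mu (fun x => F (x + t *: evec i) - F x - t * partial i F x) <= C * (t ^+ 2) ^+ 2.
Proof.
move=> hF; have [sm _ _] := hF.
have [M M0 FM] := Cc_sup (Cc_partial i (Cc_partial i hF)).
have [r r0 Fr] := Cc_support_bound hF.
have [r' r0' Fr'] := Cc_support_bound (Cc_partial i hF).
have mF := Cc_measurable hF; have mdF := Cc_measurable (Cc_partial i hF).
pose rr := Num.max (r + 1) r'.
have I0 : 0 <= \int[mu]_x (\1_[set y : 'rV[R]_n | `|y| <= rr] : 'rV[R]_n -> R) x.
  by apply: Rintegral_ge0.
exists (M ^+ 2 * \int[mu]_x (\1_[set y : 'rV[R]_n | `|y| <= rr] : 'rV[R]_n -> R) x).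
  by rewrite mulr_ge0 ?sqr_ge0.
move=> t t1; rewrite mulrAC -exprMn; apply: nrm2_ball_bound.
- apply: measurable_funB; last exact: measurable_funM.
  by apply: measurable_funB => //; exact: (measurableT_comp mF (measurable_translate _)).
- by move=> x; exact: (taylor_bound x t (sm 2) FM).
- move=> x; apply: contraR; rewrite -ltNge /rr gt_max => /andP[x1 x2].
  have -> : F x = 0 by apply/eqP/negPn/negP => /Fr; lra.
  have -> : partial i F x = 0 by apply/eqP/negPn/negP => /Fr'; lra.
  have -> : F (x + t *: evec i) = 0.
    apply/eqP/negPn/negP => /Fr.
    have := ler_normB (x + t *: evec i) (t *: evec i); rewrite addrK.
    by have := norm_scale_evec t i; lra.
  by rewrite mulr0 !subr0.
Qed.

(** The factor 2 comes from splitting each small step into its linear part and its Taylor remainder.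
    With m steps the remainders contribute a multiple of 1 / m^2. *)
Lemma nrm2_smooth_translate F i r : Cc_infty setT F ->
  nrm2 mu (fun x => F (x + r *: evec i) - F x) <= r ^+ 2 * nrm2 mu (partial i F) * 2.
Proof.
move=> hF; have sF := Cc_sqi hF; have sdF := Cc_sqi (Cc_partial i hF).
have [C C0 CP] := smooth_difference_quotient i hF.
have mF := Cc_measurable hF.
have N0 := nrm2_ge0 mu (partial i F).
(* telescoping into m steps of size r / m, then m -> infinity *)
have step m : (0 < m)%N -> `|r / m%:R| <= 1 ->
    nrm2 mu (fun x => F (x + r *: evec i) - F x) <=
    2 * r ^+ 2 * nrm2 mu (partial i F) + 2 * C * (r ^+ 2) ^+ 2 / m%:R ^+ 2.
  move=> m0 rm; pose t := r / m%:R.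
  have mR : m%:R != 0 :> R by rewrite pnatr_eq0 -lt0n.
  pose G (j : nat) x := F (x + (j.+1%:R * t) *: evec i) - F (x + (j%:R * t) *: evec i).
  have sG j : sqi mu (G j) by apply: sqiB; exact: sqi_translate.
  have -> : (fun x => F (x + r *: evec i) - F x) = (fun x => \sum_(j < m) G j x).
    apply/funext => x; rewrite -(big_mkord xpredT (fun j => G j x)).
    rewrite (telescope_sumr (fun j => F (x + (j%:R * t) *: evec i)))// mul0r scale0r addr0.
    by rewrite /t mulrC divfK.
  apply: (le_trans (nrm2_trunc_sum m sG)).
  have Gj j : nrm2 mu (G j) <= 2 * (t ^+ 2 * nrm2 mu (partial i F)) + 2 * (C * (t ^+ 2) ^+ 2).
    have -> : nrm2 mu (G j) = nrm2 mu (fun x => F (x + t *: evec i) - F x).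
      rewrite -[RHS](nrm2_translate ((j%:R * t) *: evec i)); last first.
        by apply: measurable_funB => //; exact: (measurableT_comp mF (measurable_translate _)).
      apply: eq_Rintegral => x _; rewrite /G -addrA -scalerDl.
      by rewrite -natr1 mulrDl mul1r.
    pose D x := F (x + t *: evec i) - F x - t * partial i F x.
    have sD : sqi mu D by apply: sqiB; [exact: sqi_diff_translate|exact: sqiZ].
    have -> : (fun x => F (x + t *: evec i) - F x) = (fun x => t * partial i F x + D x).
      by apply/funext => x; rewrite /D; ring.
    apply: (le_trans (nrm2D (sqiZ t sdF) sD)); rewrite nrm2Z//.
    by apply: lerD => //; rewrite ler_pM2l//; exact: CP.
  apply: (@le_trans _ _ (m%:R * \sum_(j < m)
      (2 * (t ^+ 2 * nrm2 mu (partial i F)) + 2 * (C * (t ^+ 2) ^+ 2)))).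
    by apply: ler_wpM2l => //; apply: ler_sum => j _; exact: Gj.
  rewrite sumr_const card_ord -mulr_natl /t; rewrite le_eqVlt; apply/orP; left; apply/eqP.
  by field.
have lim0 : 2 * r ^+ 2 * nrm2 mu (partial i F) + 2 * C * (r ^+ 2) ^+ 2 * k.+1%:R^-1 @[k --> \oo] -->
    2 * r ^+ 2 * nrm2 mu (partial i F) + 2 * C * (r ^+ 2) ^+ 2 * 0.
  by apply: cvgD; [exact: cvg_cst|apply: cvgMr; exact: cvg_harmonic].
rewrite mulr0 addr0 in lim0.
rewrite mulrC mulrA; apply: (cvgr_to_ge lim0); near=> k.
have k0 : 0 < k.+1%:R :> R by rewrite ltr0n.
apply: (le_trans (step k.+1 isT _)).
  rewrite normrM normfV (gtr0_norm k0) ler_pdivrMr// mul1r.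
  apply: (@le_trans _ _ k%:R); last by rewrite ler_nat.
  by near: k; exact: nbhs_infty_ger.
apply: lerD => //; apply: ler_wpM2l; first by apply: mulr_ge0; [apply: mulr_ge0|exact: sqr_ge0].
by rewrite lef_pV2 ?posrE ?exprn_gt0// expr2 ler_peMl ?(ltW k0)// ler1n.
Unshelve. all: by end_near. Qed.

Section compactly_supported.
Variables (f : 'rV[R]_n -> R) (g : 'I_n -> 'rV[R]_n -> R) (r : R).
Hypotheses (sf : sqi mu f) (sg : forall i, sqi mu (g i))
  (fr : forall x, f x != 0 -> `|x| <= r) (gr : forall i x, g i x != 0 -> `|x| <= r)
  (fg : forall i, WD i f (g i)).

Lemma H1_approximation e : 0 < e -> exists phi, [/\ Cc_infty setT phi,
  nrm2 mu (fun x => phi x - f x) <= e & forall i, nrm2 mu (fun x => partial i phi x - g i x) <= e].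
Proof.
move=> e0.
have [|||phi [h1 _ h2 h3 _]] := @smooth_approximation R n f g [set x | `|x| <= r] r e 1
  _ e0 ltr01 sf sg _ _ fg; last by exists phi.
- by [].
- by move=> x /= nx; apply/eqP/negPn/negP => /fr.
- by move=> i x /= nx; apply/eqP/negPn/negP => /gr.
Qed.

Lemma nrm2_translate_line i t :
  nrm2 mu (fun x => f (x + t *: evec i) - f x) <= 8 * t ^+ 2 * nrm2 mu (g i).
Proof.
have N0 := nrm2_ge0 mu (g i).
apply/ler_addgt0Pr => e e0.
(* The approximation errors add up to (8 t^2 + 8) e'. The factor 8 in the statement is made of three
   factors 2, two from splittings here and one from the smooth case. *)
pose e' := e / (8 * t ^+ 2 + 8).
have t20 := sqr_ge0 t.
have c0 : 0 < 8 * t ^+ 2 + 8 by lra.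
have e'0 : 0 < e' by rewrite divr_gt0.
have [phi [hp h1 /(_ i) h2]] := H1_approximation e'0.
have sp := Cc_sqi hp; have sdp := Cc_sqi (Cc_partial i hp).
pose D x := phi x - f x; have sD : sqi mu D by exact: sqiB.
pose E x := D (x + t *: evec i) - D x.
have sE : sqi mu E by exact: sqi_diff_translate.
have -> : (fun x => f (x + t *: evec i) - f x) =
    (fun x => (phi (x + t *: evec i) - phi x) - E x).
  by apply/funext => x; rewrite /E /D; ring.
apply: (le_trans (nrm2B (sqi_diff_translate _ sp) sE)).
have b1 := nrm2_smooth_translate i t hp.
have b2 : nrm2 mu (partial i phi) <= 2 * e' + 2 * nrm2 mu (g i).
  have -> : partial i phi = (fun x => (partial i phi x - g i x) + g i x).
    by apply/funext => x; rewrite subrK.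
  apply: (le_trans (nrm2D (sqiB sdp (sg i)) (sg i))).
  by rewrite lerD2r ler_pM2l.
have b3 : nrm2 mu E <= 4 * e'.
  apply: (le_trans (nrm2B (sqi_translate _ sD) sD)).
  rewrite nrm2_translate; last exact: sD.1.
  by rewrite /D in h1 *; lra.
have b4 : t ^+ 2 * nrm2 mu (partial i phi) <= t ^+ 2 * (2 * e' + 2 * nrm2 mu (g i)).
  exact: ler_wpM2l.
have b5 : (8 * t ^+ 2 + 8) * e' = e by rewrite /e' mulrC divfK// gt_eqF.
apply: (@le_trans _ _ (2 * (t ^+ 2 * (2 * e' + 2 * nrm2 mu (g i)) * 2) + 2 * (4 * e'))).
  apply: lerD; rewrite ler_pM2l//; apply: (le_trans b1).
  by rewrite ler_pM2r.
rewrite -b5 le_eqVlt; apply/orP; left; apply/eqP; ring.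
Qed.

End compactly_supported.

Section compactly_supported_quotients.
Variables (f : 'rV[R]_n -> R) (g : 'I_n -> 'rV[R]_n -> R) (r : R).
Hypotheses (sf : sqi mu f) (sg : forall i, sqi mu (g i))
  (fr : forall x, f x != 0 -> `|x| <= r) (gr : forall i x, g i x != 0 -> `|x| <= r)
  (fg : forall i, WD i f (g i)).

(** For a smooth approximation phi the quotients converge by Taylor. The quotients of the error phi
    - f are bounded uniformly in t by [nrm2_translate_line], since this error is itself compactly
    supported with weak derivatives close to 0. *)
Lemma difference_quotient_cvg i (t : nat -> R) : (forall k, t k != 0) ->
  t k @[k --> \oo] --> 0 ->
  nrm2 mu (fun x => (t k)^-1 * (f (x + t k *: evec i) - f x) - g i x) @[k --> \oo] --> 0.
Proof.
move=> t0 tc; apply/cvgrPdist_le => e e0.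
pose e' := e / 80.
have e'0 : 0 < e' by rewrite divr_gt0.
have [phi [hp h1 h2]] := H1_approximation sf sg fr gr fg e'0.
have sp := Cc_sqi hp; have sdp i := Cc_sqi (Cc_partial i hp).
have [C C0 CP] := smooth_difference_quotient i hp.
have ct : (C * t k ^+ 2) @[k --> \oo] --> 0.
  rewrite -(mulr0 C); apply: cvgMr; under eq_fun do rewrite expr2.
  by rewrite -(mulr0 0); exact: cvgM.
have e80 : 0 < e / 8 by rewrite divr_gt0.
near=> k.
have tk1 : `|t k| <= 1.
  by near: k; move/cvgrPdist_le : tc => /(_ 1 ltr01); apply: filterS => k; rewrite sub0r normrN.
have Ck : C * t k ^+ 2 <= e / 8.
  near: k; move/cvgrPdist_le : ct => /(_ _ e80); apply: filterS => k; rewrite sub0r normrN.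
  by rewrite ger0_norm// mulr_ge0 ?sqr_ge0.
have tk2 : t k ^+ 2 != 0 by rewrite expf_neq0.
have tk20 : 0 < t k ^+ 2 by rewrite lt_neqAle eq_sym tk2 sqr_ge0.
rewrite sub0r normrN ger0_norm ?nrm2_ge0//.
pose T h x := h (x + t k *: evec i) - h x.
have sT h : sqi mu h -> sqi mu (T h) by exact: sqi_diff_translate.
pose A x := (t k)^-1 * (T phi x - t k * partial i phi x).
pose B x := partial i phi x - g i x.
pose D x := phi x - f x; have sD : sqi mu D by exact: sqiB.
pose E x := (t k)^-1 * T D x.
have sA0 : sqi mu (fun x => T phi x - t k * partial i phi x).
  by apply: sqiB; [exact: sT|exact: sqiZ].
have sA : sqi mu A by exact: sqiZ.
have sB : sqi mu B by exact: sqiB.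
have sE : sqi mu E by apply: sqiZ; exact: sT.
have -> : (fun x => (t k)^-1 * (f (x + t k *: evec i) - f x) - g i x) =
    (fun x => A x + (B x - E x)).
  by apply/funext => x; rewrite /A /B /E /D /T; field.
apply: (le_trans (nrm2D sA (sqiB sB sE))).
have bA : nrm2 mu A <= e / 8.
  rewrite nrm2Z// exprVn mulrC ler_pdivrMr//.
  apply: (le_trans (CP _ tk1)); rewrite [X in C * X]expr2 mulrA.
  by rewrite ler_pM2r.
have bE : nrm2 mu E <= 8 * e'.
  have bT : nrm2 mu (T D) <= 8 * t k ^+ 2 * nrm2 mu B.
    (* A common support radius for the error and for all its derivatives; the sum of the individual
       radii is large enough. *)
    have rr : exists r', (forall x, D x != 0 -> `|x| <= r') /\
        forall i x, partial i phi x - g i x != 0 -> `|x| <= r'.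
      have [r1 _ r1P] := Cc_support_bound hp.
      have /choice[r2 r2P] j : exists r2, forall x, partial j phi x != 0 -> `|x| <= r2.
        by have [r2 _ r2P] := Cc_support_bound (Cc_partial j hp); exists r2.
      pose S := \sum_j `|r2 j|.
      exists (`|r| + `|r1| + S); have S0 : 0 <= S by apply: sumr_ge0.
      have r0 := ler_norm r; have r10 := ler_norm r1; have := normr_ge0 r; have := normr_ge0 r1.
      split => [x|j x].
        have [p0|p0 _] := eqVneq (phi x) 0; last by have := r1P _ p0; lra.
        by rewrite /D p0 sub0r oppr_eq0 => /fr; lra.
      have [p0|p0 _] := eqVneq (partial j phi x) 0.
        by rewrite p0 sub0r oppr_eq0 => /gr; lra.
      have : `|r2 j| <= S by rewrite /S (bigD1 j)//= lerDl; apply: sumr_ge0.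
      by have := r2P j _ p0; have := ler_norm (r2 j); lra.
    have [r' [rD rB]] := rr.
    have sDj j : sqi mu (fun x => partial j phi x - g j x) by exact: sqiB.
    have wD j : WD j D (fun x => partial j phi x - g j x).
      by apply: WDB => //; exact: WD_smooth.
    exact: (nrm2_translate_line sD sDj rD rB wD).
  rewrite nrm2Z; last exact: sT.
  rewrite exprVn mulrC ler_pdivrMr//; apply: (le_trans bT).
  rewrite mulrAC ler_pM2r// ler_pM2l//; exact: h2.
have bB : nrm2 mu B <= e' := h2 i.
have := nrm2B sB sE; rewrite /e' in bE bB.
by move: (nrm2 mu A) (nrm2 mu B) (nrm2 mu E) (nrm2 mu _) bA bB bE => a b c d; lra.
Unshelve. all: by end_near. Qed.

(** The translation is carried out along one coordinate after the other; each new direction doubles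
    the previous bound, whence 2^n. *)
Lemma nrm2_translate_vec v :
  nrm2 mu (fun x => f (x + v) - f x) <=
  8 * 2 ^+ n * `|v| ^+ 2 * \sum_i nrm2 mu (g i).
Proof.
have S (s : seq 'I_n) : nrm2 mu (fun x => f (x + \sum_(i <- s) v ord0 i *: evec i) - f x) <=
    8 * 2 ^+ size s * `|v| ^+ 2 * \sum_(i <- s) nrm2 mu (g i).
  elim: s => [|i s IH].
    rewrite !big_nil mulr0 (_ : (fun x => _) = fun=> 0); last first.
      by apply/funext => x; rewrite addr0 subrr.
    by rewrite /nrm2 expr0n /= /Rintegral integral0.
  rewrite !big_cons; set w := \sum_(j <- s) _ in IH *; set G := \sum_(j <- s) _ in IH *.
  have G0 : 0 <= G by apply: sumr_ge0 => j _; exact: nrm2_ge0.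
  have sT := sqi_diff_translate w sf.
  have -> : (fun x => f (x + (v ord0 i *: evec i + w)) - f x) =
      (fun x => (f (x + v ord0 i *: evec i + w) - f (x + v ord0 i *: evec i)) +
        (f (x + v ord0 i *: evec i) - f x)).
    by apply/funext => x; rewrite addrA; ring.
  apply: (le_trans (nrm2D (sqi_translate (v ord0 i *: evec i) sT) (sqi_diff_translate _ sf))).
  rewrite (nrm2_translate _ sT.1).
  have b1 := nrm2_translate_line sf sg fr gr fg i (v ord0 i).
  have vi : v ord0 i ^+ 2 <= `|v| ^+ 2.
    by rewrite -[leLHS]real_normK ?num_real// lerXn2r ?nnegrE// rV_coord_le.
  have N0 := nrm2_ge0 mu (g i).
  have b2 : 8 * v ord0 i ^+ 2 * nrm2 mu (g i) <= 8 * `|v| ^+ 2 * nrm2 mu (g i).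
    by rewrite ler_wpM2r// ler_pM2l.
  have p1 : 1 <= 2 ^+ size s :> R by rewrite exprn_ege1// ler1n.
  have b3 : 8 * `|v| ^+ 2 * nrm2 mu (g i) <= 2 ^+ size s * (8 * `|v| ^+ 2 * nrm2 mu (g i)).
    by rewrite ler_peMl// !mulr_ge0 ?sqr_ge0.
  have -> : 8 * 2 ^+ size (i :: s) * `|v| ^+ 2 * (nrm2 mu (g i) + G) =
    2 * (8 * 2 ^+ size s * `|v| ^+ 2 * G) + 2 * (2 ^+ size s * (8 * `|v| ^+ 2 * nrm2 mu (g i))).
    by rewrite /= exprS; ring.
  apply: lerD; rewrite ler_pM2l//.
  exact: (le_trans b1 (le_trans b2 b3)).
have := S (index_enum 'I_n).
rewrite [size _](_ : _ = n); last by rewrite -[RHS]card_ord cardT /index_enum; unlock; rewrite enumT.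
suff -> : \sum_i v ord0 i *: evec i = v by [].
by rewrite [RHS]row_sum_delta.
Qed.

End compactly_supported_quotients.

End difference_quotients.

Lemma cvg_seq_le (R : realType) (u v : nat -> R) a b : (forall k, u k <= v k) ->
  u k @[k --> \oo] --> a -> v k @[k --> \oo] --> b -> a <= b.
Proof.
move=> uv ua vb; rewrite -(cvg_lim _ ua)// -(cvg_lim _ vb)//.
apply: ler_lim; [by apply/cvg_ex; exists a|by apply/cvg_ex; exists b|exact: nearW].
Qed.

(** * The weak gradient of the negative part *)

Section negative_part.
Context {R : realType} {n : nat}.
Local Notation mu := (lebesgue_rV n).
Local Notation WD := weak_partial.
Implicit Types (f phi : 'rV[R]_n -> R) (x y : 'rV[R]_n) (i : 'I_n) (r e M t : R).

Definition negp f : 'rV[R]_n -> R := fun x => Num.max (- f x) 0.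

Lemma negp_ge0 f x : 0 <= negp f x.
Proof. by rewrite /negp le_max lexx orbT. Qed.

Lemma measurable_negp f : measurable_fun setT f -> measurable_fun setT (negp f).
Proof. by move=> mf; apply: measurable_maxr => //; exact: measurable_funN. Qed.

Lemma negp_le_norm f x : `|negp f x| <= `|f x|.
Proof.
rewrite ger0_norm ?negp_ge0// /negp ge_max normr_ge0 andbT.
by rewrite -normrN ler_norm.
Qed.

Lemma sqi_negp f : sqi mu f -> sqi mu (negp f).
Proof.
by move=> sf; apply: (sqi_le _ _ sf) => [|x]; [exact: measurable_negp sf.1|exact: negp_le_norm].
Qed.

Definition neg_ind f : 'rV[R]_n -> R := \1_[set x | f x < 0].

Lemma neg_indE f x : neg_ind f x = (f x < 0)%R%:R.
Proof.
rewrite /neg_ind indicE; case: ltP => h; first by rewrite mem_set.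
by rewrite memNset//= => h'; have := lt_le_trans h' h; rewrite ltxx.
Qed.

Lemma measurable_neg_ind f : measurable_fun setT f -> measurable_fun setT (neg_ind f).
Proof.
move=> mf; apply: measurable_indic; rewrite -[X in measurable X]setTI.
have -> : [set x | f x < 0] = f @^-1` `]-oo, 0[ by apply/seteqP; split => x /=; rewrite in_itv.
by apply: mf => //; exact: measurable_itv.
Qed.

Lemma neg_ind_bound f x : `|neg_ind f x| <= 1.
Proof. by rewrite neg_indE normr_nat; case: (f x < 0). Qed.

(** Convexity of the negative part, for which minus the indicator of negative values is a
    subgradient. *)
Lemma negp_subgradient f x y : neg_ind f x * (f x - f y) <= negp f y - negp f x.
Proof.
rewrite neg_indE /negp; case: (ltP (f x) 0) => fx /=.
  rewrite mul1r [Num.max (- f x) 0]max_l; last by rewrite oppr_ge0 ltW.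
  have : - f y <= Num.max (- f y) 0 by rewrite le_max lexx.
  by lra.
rewrite mul0r [Num.max (- f x) 0]max_r ?oppr_le0// subr0.
by rewrite le_max lexx orbT.
Qed.

Section weak_derivative.
Variables (f : 'rV[R]_n -> R) (g : 'I_n -> 'rV[R]_n -> R) (r : R).
Hypotheses (sf : sqi mu f) (sg : forall i, sqi mu (g i))
  (fr : forall x, f x != 0 -> `|x| <= r) (gr : forall i x, g i x != 0 -> `|x| <= r)
  (fg : forall i, WD i f (g i)).
Let N := negp f.
Let A := neg_ind f.
Let sN : sqi mu N. Proof. exact: sqi_negp. Qed.
Let mA : measurable_fun setT A. Proof. exact: measurable_neg_ind sf.1. Qed.
Let A1 x : `|A x| <= 1. Proof. exact: neg_ind_bound. Qed.

(** [P] is the difference quotient of [f] tested on [phi] times the indicator of f < 0, and [Q] that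
    of the negative part with the quotient moved onto [phi]. Their limits are the two sides of the
    formula for the weak derivative. *)
Let P phi i t := \int[mu]_x ((phi x * A x) * (t^-1 * (f (x + t *: evec i) - f x))).
Let Q phi i t := \int[mu]_x (N x * ((- t)^-1 * (phi (x + (- t) *: evec i) - phi x))).

Let sqi_dq h i t : sqi mu h -> sqi mu (fun x => t^-1 * (h (x + t *: evec i) - h x)).
Proof. by move=> sh; apply: sqiZ; exact: sqi_diff_translate. Qed.

Let sqi_phiA phi : sqi mu phi -> sqi mu (fun x => phi x * A x).
Proof.
move=> sp; under eq_fun do rewrite mulrC; exact: (sqi_mull mA A1 sp).
Qed.

(** Discrete integration by parts: a translation moves the quotient from [phi] to [N], and reverses
    the direction. *)
Let QE phi i t : Cc_infty setT phi -> t != 0 ->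
  Q phi i t = - \int[mu]_x (phi x * (t^-1 * (N (x + t *: evec i) - N x))).
Proof.
move=> hp t0; have sp := Cc_sqi hp.
have i1 := sqi_mul sN (sqi_translate ((- t) *: evec i) sp).
have i2 := sqi_mul sN sp.
have i3 := sqi_mul sp (sqi_translate (t *: evec i) sN).
rewrite /Q [in LHS](_ : (fun x => _) =
    (fun x => (- t)^-1 * (N x * phi (x + (- t) *: evec i) - N x * phi x))); last first.
  by apply/funext => x; ring.
rewrite [in RHS](_ : (fun x => _) =
    (fun x => t^-1 * (phi x * N (x + t *: evec i) - N x * phi x))); last first.
  by apply/funext => x; ring.
rewrite !RintZ ?RintB//; try exact: intgB.
rewrite -[X in _ * (X - _) = _](Rint_translate (t *: evec i)); last exact: intg_measurable i1.
rewrite [X in _ * (X - _) = _](_ : _ = \int[mu]_x (phi x * N (x + t *: evec i))).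
  by rewrite invrN mulNr.
by apply: eq_Rintegral => x _; rewrite -addrA -scalerDl subrr scale0r addr0 mulrC.
Qed.

Let Pcvg phi i (t : nat -> R) : Cc_infty setT phi -> (forall k, t k != 0) ->
  t k @[k --> \oo] --> 0 ->
  P phi i (t k) @[k --> \oo] --> \int[mu]_x ((phi x * A x) * g i x).
Proof.
move=> hp t0 tc; apply: ip_cvg => //.
- exact/sqi_phiA/(Cc_sqi hp).
- by move=> k; exact: sqi_dq.
- exact: (difference_quotient_cvg sf sg fr gr fg).
Qed.

Let Qcvg phi i (t : nat -> R) : Cc_infty setT phi -> (forall k, t k != 0) ->
  t k @[k --> \oo] --> 0 ->
  Q phi i (t k) @[k --> \oo] --> \int[mu]_x (N x * partial i phi x).
Proof.
move=> hp t0 tc; have /Cc_inftyP[_ [K [cK _ p0]]] := hp.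
have [r' _ r'P] := compact_norm_bound cK.
apply: (ip_cvg sN (Cc_sqi (Cc_partial i hp))) => [k|].
  by apply: sqi_dq; exact: Cc_sqi hp.
apply: (@difference_quotient_cvg R n phi (fun i => partial i phi) r') => //.
- exact: Cc_sqi hp.
- by move=> j; exact: Cc_sqi (Cc_partial j hp).
- move=> x h; apply: r'P; apply: contrapT => /p0 h0; by rewrite h0 eqxx in h.
- move=> j x h; apply: r'P; apply: contrapT => Kx.
  by rewrite (partial_off_support _ (compact_closed (@norm_hausdorff _ _) cK) p0 Kx) eqxx in h.
- by move=> j; exact: WD_smooth.
- by move=> k; rewrite oppr_eq0.
- by rewrite -oppr0; exact: cvgN.
Qed.

Let PQ phi i t : Cc_infty setT phi -> (forall x, 0 <= phi x) -> t != 0 ->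
  0 <= t * (P phi i t - Q phi i t).
Proof.
move=> hp p0 t0; have sp := Cc_sqi hp.
rewrite QE// /P opprK.
have i1 := sqi_mul (sqi_phiA sp) (sqi_dq i t sf).
have i2 := sqi_mul sp (sqi_dq i t sN).
rewrite -RintD// -RintZ; last exact: intgD.
apply: Rintegral_ge0 => x _.
rewrite [leRHS](_ : _ = phi x * (A x * (f (x + t *: evec i) - f x) + (N (x + t *: evec i) - N x))).
  apply: mulr_ge0 => //; have := negp_subgradient f x (x + t *: evec i).
  by rewrite -/A -/N -[f x - _]opprB mulrN; lra.
by field.
Qed.

(** The subgradient inequality compares [P] and [Q] in an order depending on the sign of t; letting
    t tend to 0 from each side gives equality. *)
Let ge0_case phi i : Cc_infty setT phi -> (forall x, 0 <= phi x) ->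
  \int[mu]_x (N x * partial i phi x) = \int[mu]_x ((phi x * A x) * g i x).
Proof.
move=> hp p0.
pose t (k : nat) : R := k.+1%:R^-1.
have t0 k : t k != 0 by rewrite invr_eq0.
have tp k : 0 < t k by rewrite invr_gt0 ltr0n.
have tc : t k @[k --> \oo] --> 0 by exact: cvg_harmonic.
have t0' k : - t k != 0 by rewrite oppr_eq0.
have tc' : - t k @[k --> \oo] --> 0 by rewrite -oppr0; exact: cvgN.
apply/eqP; rewrite eq_le; apply/andP; split.
  have c1 := @Qcvg phi i t hp t0 tc; have c2 := @Pcvg phi i t hp t0 tc; apply: (cvg_seq_le _ c1 c2) => k.
  by have := PQ i hp p0 (t0 k); rewrite pmulr_rge0// subr_ge0.
apply: (cvg_seq_le _ (@Pcvg phi i _ hp t0' tc') (@Qcvg phi i _ hp t0' tc')) => k.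
by have := PQ i hp p0 (t0' k); rewrite mulNr oppr_ge0 pmulr_rle0// subr_le0.
Qed.

(** A signed test function is the difference of the nonnegative ones phi + M eta and M eta, where
    eta is a cut-off equal to 1 on the support of phi and M bounds |phi|. *)
Lemma WD_negp i : WD i N (fun x => - (A x * g i x)).
Proof.
move=> phi hp; have [M M0 pM] := Cc_sup hp.
have /Cc_inftyP[_ [K [cK _ p0]]] := hp.
have [eta [d [he e01 d0 eK]]] := cutoff_exists cK (@openT 'rV[R]_n) (@subsetT _ K).
have sp := Cc_sqi hp; have se := Cc_sqi he.
have hMe := CcZ M he; have hpe := CcD hp hMe.
have [cp _ _] := hp; have [cMe _ _] := hMe.
have c1 := ge0_case i hpe; have c2 := ge0_case i hMe.
have sAg : sqi mu (fun x => A x * g i x) by exact: sqi_mull mA A1 (sg i).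
rewrite [in RHS](_ : (fun x => _) = (fun x => - (phi x * A x * g i x))); last first.
  by apply/funext => x; ring.
have sdp := Cc_sqi (Cc_partial i hp); have sdM := Cc_sqi (Cc_partial i hMe).
have i1 := sqi_mul (sqi_phiA sp) (sg i).
have i2 := sqi_mul (sqi_phiA (Cc_sqi hMe)) (sg i).
rewrite RintN// opprK.
have : \int[mu]_x (N x * partial i (fun x => phi x + M * eta x) x) =
       \int[mu]_x ((phi x + M * eta x) * A x * g i x).
  apply: c1 => x; have /andP[e0 e1] := e01 x.
  have [Kx|/p0 ->] := pselect (K x); last by rewrite add0r mulr_ge0.
  rewrite (eK x x)// ?subrr ?normr0 ?(ltW d0)// mulr1.
  by have := pM x; rewrite ler_norml => /andP[? _]; lra.
have : \int[mu]_x (N x * partial i (fun x => M * eta x) x) =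
       \int[mu]_x ((M * eta x) * A x * g i x).
  by apply: c2 => x; have /andP[e0 e1] := e01 x; rewrite mulr_ge0.
rewrite partialD; [|exact: cp|exact: cMe].
under [X in _ -> X = _ -> _]eq_Rintegral do rewrite mulrDr.
under [X in _ -> _ = X -> _]eq_Rintegral do rewrite !mulrDl.
rewrite !RintD//; [|exact: sqi_mul|exact: sqi_mul].
by move=> ->; exact: addIr.
Qed.

Lemma sqi_neg_ind i : sqi mu (fun x => - (A x * g i x)).
Proof. by apply: sqiN; exact: sqi_mull mA A1 (sg i). Qed.

End weak_derivative.
End negative_part.

(** * Sobolev spaces on open sets *)

Section sobolev_spaces.
Context {R : realType} {n : nat}.
Local Notation mu := (lebesgue_rV n).
Local Notation WD := weak_partial.
Implicit Types (f h phi eta u : 'rV[R]_n -> R) (x y : 'rV[R]_n) (i : 'I_n)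
  (U V K D : set 'rV[R]_n).

Lemma restrict_in f D x : D x -> (f \_ D) x = f x.
Proof. by move=> Dx; rewrite patchE mem_set. Qed.

Lemma restrict_out f D x : ~ D x -> (f \_ D) x = 0.
Proof. by move=> Dx; rewrite patchE memNset. Qed.

Lemma Lfun2P f : f \in Lfun mu 2%:E <-> sqi mu f.
Proof.
split=> [h|[mf /integrableP[_ fin]]].
  split; last exact: Lfun2_integrable_sqr.
  by move: h; rewrite inE => /andP[/[!inE]].
rewrite inE; apply/andP; split; rewrite inE//=.
rewrite /finite_norm unlock poweR_lty//; apply: le_lt_trans fin.
apply: ge0_le_integral => //.
- by move=> x _; exact: poweR_ge0.
- by apply: (measurableT_comp (measurable_poweR _)); do 2 apply: measurableT_comp => //.
- by apply: measurableT_comp => //; apply/measurable_EFinP; exact: measurable_funX.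
- by move=> x _ /=; rewrite lee_fin normrX powR_mulrn.
Qed.

Lemma sqi_restrict K f : measurable K -> sqi mu f -> sqi mu (f \_ K).
Proof.
move=> mK sf; apply: (sqi_le _ _ sf) => [|x].
  by apply/(measurable_restrictT _ mK); exact: measurable_funTS sf.1.
by rewrite patchE; case: ifP => // _; rewrite normr0.
Qed.

Lemma sqi_L1_loc U f : sqi mu f -> L1_loc U f.
Proof.
move=> sf; split; first exact: measurable_funTS sf.1.
move=> K cK _; have mK := compact_measurable_rV cK; apply: (intg_in mu f mK).2.
have [r _ Kr] := compact_norm_bound cK; apply: (sqi_intg (r := r) (sqi_restrict mK sf)) => x.
by rewrite patchE; case: ifP => [/set_mem /Kr//|_]; rewrite eqxx.
Qed.

Lemma Rint_restrictM U h phi :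
  \int[mu]_(x in U) (h x * phi x) = \int[mu]_x ((h \_ U) x * phi x).
Proof.
rewrite Rint_in; apply: eq_Rintegral => x _.
by rewrite !patchE; case: ifP => // _; rewrite mul0r.
Qed.

Lemma Cc_off U phi x : Cc_infty U phi -> ~ U x -> phi x = 0.
Proof. by move=> /Cc_inftyP[_ [K [_ KU p0]]] Ux; apply: p0 => /KU. Qed.

Lemma Rint_Cc U h phi : Cc_infty U phi ->
  \int[mu]_(x in U) (h x * phi x) = \int[mu]_x (h x * phi x).
Proof.
move=> hp; rewrite Rint_restrictM; apply: eq_Rintegral => x _.
rewrite patchE; case: ifPn => // /negP xU; rewrite (Cc_off hp) ?mulr0// => Ux.
by apply: xU; exact: mem_set.
Qed.

Lemma intg_restrictM U h phi : L1_loc U h -> Cc_infty U phi ->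
  intg mu (fun x => (h \_ U) x * phi x).
Proof.
move=> [_ ih] hp; have /Cc_inftyP[_ [K [cK KU p0]]] := hp.
have i1 : intg mu (h \_ K) by apply: (intg_in mu h (compact_measurable_rV cK)).1; exact: ih.
have [M _ pM] := Cc_sup hp.
have := intg_mull (Cc_measurable hp) pM i1; congr (intg mu _); apply/funext => x.
have [Kx|Kx] := pselect (K x); last by rewrite p0// mul0r mulr0.
by rewrite (restrict_in h Kx) (restrict_in h (KU _ Kx)) mulrC.
Qed.

Lemma wpartial_unique U i f g1 g2 : open U -> is_wpartial U i f g1 -> is_wpartial U i f g2 ->
  {ae mu, forall x, U x -> g1 x = g2 x}.
Proof.
move=> oU [_ l1 h1] [_ l2 h2]; have [m1 i1] := l1; have [m2 i2] := l2.
have := @fundamental_lemma R n U (fun x => g1 x - g2 x) oU.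
move=> /(_ (measurable_funB m1 m2)) H.
have {H} : {ae mu, forall x, U x -> g1 x - g2 x = 0}.
  apply: H => [K cK KU|phi hp].
    have := integrableB (compact_measurable_rV cK) (i1 _ cK KU) (i2 _ cK KU).
    by [].
  have := h2 _ hp; rewrite h1// => /oppr_inj.
  rewrite (Rint_restrictM U g1) (Rint_restrictM U g2) (Rint_restrictM U (fun x => g1 x - g2 x)).
  have -> : (fun x => ((fun x => g1 x - g2 x) \_ U) x * phi x) =
      (fun x => (g1 \_ U) x * phi x - (g2 \_ U) x * phi x).
    by apply/funext => x; rewrite !patchE; case: ifP => _; rewrite ?mulrBl// !mul0r subr0.
  by rewrite RintB; [move=> ->; rewrite subrr|exact: intg_restrictM|exact: intg_restrictM].
by apply: filterS => x H /H /eqP; rewrite subr_eq0 => /eqP.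
Qed.

Lemma wpartialP U i f : (exists h, is_wpartial U i f h) -> is_wpartial U i f (wpartial U i f).
Proof. by move=> /(xgetPex (fun=> 0)). Qed.

Lemma is_wpartial_subset U V i f h : V `<=` U -> measurable U -> measurable V ->
  is_wpartial U i f h -> is_wpartial V i f h.
Proof.
have L1S k : V `<=` U -> measurable U -> measurable V -> L1_loc U k -> L1_loc V k.
  move=> VU mU mV [mk ik]; split; first exact: measurable_funS VU mk.
  by move=> K cK KV; apply: ik => //; exact: subset_trans VU.
move=> VU mU mV [l1 l2 H]; split; [exact: L1S|exact: L1S|] => phi hp.
have hp' := Cc_subset VU hp; have := H _ hp'.
by rewrite (Rint_Cc _ hp') (Rint_Cc _ (Cc_partial i hp')) (Rint_Cc _ hp) (Rint_Cc _ (Cc_partial i hp)).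
Qed.

(** Membership in H^1 of the whole space with explicit representatives of the derivatives, in place
    of those selected by [wpartial]. *)
Definition weak_gradient f (g : 'I_n -> 'rV[R]_n -> R) :=
  [/\ sqi mu f, forall i, sqi mu (g i) & forall i, WD i f (g i)].

Lemma weak_gradient_is_wpartial U f g i : weak_gradient f g -> is_wpartial U i f (g i).
Proof.
move=> [sf sg fg]; split; [exact: sqi_L1_loc|exact: sqi_L1_loc|] => phi hp.
rewrite (Rint_Cc _ hp) (Rint_Cc _ (Cc_partial i hp)); apply: fg.
exact: Cc_subset hp.
Qed.

Lemma restrict_setT f : f \_ setT = f.
Proof. by apply/funext => x; rewrite restrict_in. Qed.

Lemma H1_setTP f : H1 setT f <-> exists g, weak_gradient f g.
Proof.
rewrite /H1 /L2 /= restrict_setT; split=> [[/Lfun2P sf H]|[g wg]].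
  have /choice[g gP] i : exists g, is_wpartial setT i f g /\ sqi mu g.
    by have [g h1] := H i; rewrite restrict_setT => /Lfun2P; exists g.
  by exists g; split=> // i; have [[_ _ wd] sg] := gP i.
have [sf sg fg] := wg; split; first exact/Lfun2P.
move=> i; exists (g i); first exact: weak_gradient_is_wpartial.
by rewrite restrict_setT; exact/Lfun2P.
Qed.

(** The bridge from the selected derivative in the statement to explicit ones: they agree almost
    everywhere on [U]. *)
Lemma wpartial_weak_gradient U f g i : open U -> weak_gradient f g ->
  measurable_fun U (wpartial U i f) /\ {ae mu, forall x, U x -> wpartial U i f x = g i x}.
Proof.
move=> oU wg; have h1 := weak_gradient_is_wpartial U i wg.
have h2 : is_wpartial U i f (wpartial U i f) by apply: wpartialP; exists (g i).
by split; [case: h2 => _ []|exact: wpartial_unique h2 h1].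
Qed.

Lemma H1_normE f g : weak_gradient f g ->
  H1_norm f = Num.sqrt (nrm2 mu f + \sum_i nrm2 mu (g i)).
Proof.
move=> wg; have [_ sg _] := wg; congr (Num.sqrt (_ + _)); apply: eq_bigr => i _.
have [m1 e1] := wpartial_weak_gradient i openT wg.
by apply: nrm2_ae_eq => //; [exact: (sg i).1|apply: filterS e1 => x; apply].
Qed.

(** On the open complement of [K] the derivative integrates to 0 against every test function, and
    the fundamental lemma applies. *)
Lemma weak_gradient_off K f g i : closed K -> weak_gradient f g ->
  {ae mu, forall x, ~ K x -> f x = 0} -> {ae mu, forall x, ~ K x -> g i x = 0}.
Proof.
move=> cK [sf sg fg] f0; apply: (@fundamental_lemma R n (~` K)) => //.
- exact: closed_openC.
- exact: measurable_funTS (sg i).1.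
- exact: (sqi_L1_loc (~` K) (sg i)).2.
- move=> phi hp; rewrite Rint_Cc//; apply/eqP; rewrite -oppr_eq0.
  rewrite -fg; last exact: Cc_subset hp.
  have hdp := Cc_partial i hp.
  rewrite (@Rint_ae_eq _ _ _ mu _ (fun=> 0)) /Rintegral ?integral0//.
    by apply: measurable_funM; [exact: sf.1|exact: Cc_measurable hdp].
  apply: filterS f0 => x f0; have [Kx|/f0 ->] := pselect (K x); last by rewrite mul0r.
  by rewrite (Cc_off hdp) ?mulr0.
Qed.

Lemma weak_gradient_ae f g f' g' : measurable_fun setT f' ->
  (forall i, measurable_fun setT (g' i)) -> {ae mu, forall x, f x = f' x} ->
  (forall i, {ae mu, forall x, g i x = g' i x}) -> weak_gradient f g -> weak_gradient f' g'.
Proof.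
move=> mf mg ef eg [sf sg fg]; split.
- exact: sqi_ae_eq mf ef sf.
- by move=> i; exact: sqi_ae_eq (mg i) (eg i) (sg i).
- by move=> i; apply: WD_ae (fg i) => //; [exact: sf.1|exact: (sg i).1].
Qed.

Lemma weak_gradient_linear (c : R) f g f' g' : weak_gradient f g -> weak_gradient f' g' ->
  weak_gradient (fun x => c * f x + f' x) (fun i x => c * g i x + g' i x).
Proof.
move=> [a1 a2 a3] [b1 b2 b3]; split=> [|i|i].
- by apply: sqiD => //; exact: sqiZ.
- by apply: sqiD => //; exact: sqiZ.
- by apply: WDD => //; [exact: sqiZ|exact: sqiZ|exact: WDZ].
Qed.

Lemma relatively_compact_nbhd K U : compact K -> open U -> K `<=` U ->
  exists V, [/\ open V, K `<=` V, compact (closure V) & closure V `<=` U].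
Proof.
move=> cK oU KU; have [d d0 [K' [cK' K'U K'P]]] := compact_enlarge cK oU KU.
have cl : closure (interior K') `<=` K'.
  apply: subset_trans (closure_subset (@interior_subset _ K')) _.
  exact: (compact_closed (@norm_hausdorff _ _) cK').
exists (interior K'); split.
- exact: open_interior.
- move=> x Kx; apply/nbhs_ballP; exists d => //= y; rewrite -ball_normE /= => xy.
  by apply: (K'P x) => //; rewrite distrC ltW.
- by apply: subclosed_compact cl => //; exact: closed_closure.
- exact: subset_trans K'U.
Qed.

Section locally_H1.
Variables (Omega : set 'rV[R]_n) (u : 'rV[R]_n -> R).
Hypotheses (oO : open Omega) (mu_u : measurable_fun setT u) (uH : H1_loc Omega u).
Let mO : measurable Omega := open_measurable_rV oO.

Lemma H1_loc_sqi K : compact K -> K `<=` Omega -> sqi mu (u \_ K).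
Proof.
move=> cK KO; have [V [oV KV cV VO]] := relatively_compact_nbhd cK oO KO.
have [/Lfun2P sV _] := uH oV cV VO.
rewrite (_ : u \_ K = (u \_ V) \_ K).
  by apply: sqi_restrict => //; exact: compact_measurable_rV.
apply/funext => x; rewrite !patchE; case: ifP => // /set_mem /KV Vx.
by rewrite mem_set.
Qed.

Lemma locally_sqi_L1_loc h : measurable_fun Omega h ->
  (forall K, compact K -> K `<=` Omega -> sqi mu (h \_ K)) -> L1_loc Omega h.
Proof.
move=> mh sh; split=> // K cK KO; apply: (intg_in mu h (compact_measurable_rV cK)).2.
have [r _ Kr] := compact_norm_bound cK; apply: (sqi_intg (r := r) (sh _ cK KO)) => x.
by rewrite patchE; case: ifP => [/set_mem /Kr//|_]; rewrite eqxx.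
Qed.

(* The weak derivatives on a sequence of relatively compact open sets exhausting Omega are glued. *)
Lemma H1_loc_is_wpartial i : exists h, is_wpartial Omega i u h /\
  forall K, compact K -> K `<=` Omega -> sqi mu (h \_ K).
Proof.
have [C [cC C_mono CO CP]] := compact_exhaustion oO.
have /choice[V VP] j := relatively_compact_nbhd (cC j) oO (CO j).
have /choice[h hP] j : exists h, is_wpartial (V j) i u h /\ sqi mu (h \_ (V j)).
  have [oV CV cV VO] := VP j; have [_ /(_ i)[h h1 h2]] := uH oV cV VO.
  by exists h; split => //; exact/Lfun2P.
have oV j : open (V j) by have [] := VP j.
have CV j : C j `<=` V j by have [] := VP j.
have mC j := compact_measurable_rV (cC j).
have mV j := open_measurable_rV (oV j).
(* Uniqueness on each overlap; there are countably many pairs, so one null set serves for all. *)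
have hh : {ae mu, forall x, forall j k, V j x -> V k x -> h j x = h k x}.
  apply: ae_forall_nat => j; apply: ae_forall_nat => k.
  have oVV : open (V j `&` V k) by exact: openI.
  have mVV := open_measurable_rV oVV.
  have := wpartial_unique oVV (is_wpartial_subset (@subIsetl _ _ _) (mV j) mVV (hP j).1)
    (is_wpartial_subset (@subIsetr _ _ _) (mV k) mVV (hP k).1).
  by apply: filterS => x H Vj Vk; exact: H.
(* The sets [seqDU C j] are disjoint, so at most one index is available at each point; where there
   is none the value is 0. *)
pose G x := if pselect (exists j, seqDU C j x) is left e then h (sval (cid e)) x else 0.
have GE j x : seqDU C j x -> G x = h j x.
  move=> Dx; rewrite /G; case: pselect => [e|[]]; last by exists j.
  suff -> : sval (cid e) = j by [].
  apply: (trivIset_seqDU C) => //; case: (cid e) => k /= Dk; by exists x.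
have DC j : seqDU C j `<=` C j by move=> x [].
have GC : {ae mu, forall x, forall j, C j x -> G x = h j x}.
  apply: filterS hh => x H j Cx.
  have : (\bigcup_k seqDU C k) x by rewrite -seqDU_bigcup_eq; exists j.
  move=> [k _ Dk]; rewrite (GE k)//; apply: H; apply: CV => //; exact: DC.
have OC : Omega = \bigcup_k C k.
  apply/seteqP; split=> [x Ox|x [k _]]; last exact: CO.
  have sO : [set x] `<=` Omega by move=> y ->.
  have [j jP] := CP _ (@compact_set1 _ x) sO; exists j => //; exact: jP.
have mG : measurable_fun Omega G.
  have mD j : measurable (seqDU C j).
    by apply: measurableD => //; apply: bigsetU_measurable.
  rewrite OC seqDU_bigcup_eq; apply/measurable_fun_bigcup => // j.
  apply: (@eq_measurable_fun _ _ _ _ _ (h j)).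
    by move=> x /set_mem Dx; rewrite (GE j).
  have [_ [mh _] _] := (hP j).1.
  by apply: measurable_funS mh => //; exact: subset_trans (DC j) (CV j).
have sG K : compact K -> K `<=` Omega -> sqi mu (G \_ K).
  move=> cK KO; have [j KC] := CP _ cK KO; have mK := compact_measurable_rV cK.
  apply: (@sqi_ae_eq _ _ _ mu ((h j \_ (V j)) \_ K)).
  - by apply/(measurable_restrictT _ mK); exact: measurable_funS mG.
  - apply: filterS GC => x H; rewrite !patchE; case: ifP => // /set_mem Kx.
    by rewrite mem_set; [rewrite (H j)//; exact: KC|exact/CV/KC].
  - exact: sqi_restrict (hP j).2.
exists G; split=> //; split.
- apply: locally_sqi_L1_loc; [exact: measurable_funTS mu_u|exact: H1_loc_sqi].
- exact: locally_sqi_L1_loc.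
- move=> phi hp; have /Cc_inftyP[sm [K [cK KO p0]]] := hp.
  have [j KC] := CP _ cK KO.
  have hpV : Cc_infty (V j) phi.
    by apply/Cc_inftyP; split=> //; exists K; split=> // x Kx; exact/CV/KC.
  have [_ _ /(_ _ hpV)] := (hP j).1.
  rewrite (Rint_Cc _ (Cc_partial i hp)) (Rint_Cc _ (Cc_partial i hpV)) => ->.
  rewrite (Rint_restrictM (V j) (h j)) (Rint_restrictM Omega G); congr (- _); apply: Rint_ae_eq.
  + apply: measurable_funM; last exact: Cc_measurable hp.
    by have [] := (hP j).2.
  + apply: measurable_funM; last exact: Cc_measurable hp.
    exact/(measurable_restrictT _ mO).
  + apply: filterS GC => x H; have [Kx|Kx] := pselect (K x); last by rewrite p0// !mulr0.
    by rewrite (restrict_in (h j) (CV _ _ (KC _ Kx))) (restrict_in G (KO _ Kx)) (H j)//; exact: KC.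
Qed.

(** Extended by 0 outside [Omega], which makes it measurable on the whole space. *)
Definition loc_partial i : 'rV[R]_n -> R := wpartial Omega i u \_ Omega.

Lemma measurable_loc_partial i : measurable_fun setT (loc_partial i).
Proof.
have [h [hP _]] := H1_loc_is_wpartial i.
have [_ [mw _] _] : is_wpartial Omega i u (wpartial Omega i u) by apply: wpartialP; exists h.
exact/(measurable_restrictT _ mO).
Qed.

Lemma loc_partial_sqi i K : compact K -> K `<=` Omega -> sqi mu (loc_partial i \_ K).
Proof.
move=> cK KO; have [h [hP sh]] := H1_loc_is_wpartial i.
have wP : is_wpartial Omega i u (wpartial Omega i u) by apply: wpartialP; exists h.
have mK := compact_measurable_rV cK.
apply: sqi_ae_eq (sh _ cK KO).
  apply/(measurable_restrictT _ mK); apply: measurable_funTS; exact: measurable_loc_partial.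
apply: filterS (wpartial_unique oO hP wP) => x H; rewrite /loc_partial !patchE.
by case: ifP => // /set_mem /KO Ox; rewrite mem_set// H.
Qed.

Lemma loc_partialP i phi : Cc_infty Omega phi ->
  \int[mu]_x (u x * partial i phi x) = - \int[mu]_x (loc_partial i x * phi x).
Proof.
move=> hp; have [h [hP _]] := H1_loc_is_wpartial i.
have [_ _ /(_ _ hp)] : is_wpartial Omega i u (wpartial Omega i u) by apply: wpartialP; exists h.
by rewrite (Rint_Cc _ (Cc_partial i hp)) (Rint_restrictM Omega (wpartial Omega i u)) => ->.
Qed.

Lemma sqi_cutoffM h eta : measurable_fun setT h ->
  (forall K, compact K -> K `<=` Omega -> sqi mu (h \_ K)) ->
  Cc_infty Omega eta -> sqi mu (fun x => eta x * h x).
Proof.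
move=> mh sh he; have /Cc_inftyP[_ [K [cK KO e0]]] := he; have [M _ eM] := Cc_sup he.
have := sqi_mull (Cc_measurable he) eM (sh _ cK KO); congr (sqi mu _); apply/funext => x.
have [Kx|Kx] := pselect (K x); first by rewrite (restrict_in h Kx).
by rewrite e0// !mul0r.
Qed.

(** The product rule: eta phi is a test function in [Omega], and the derivative of [u] is tested on
    it. *)
Lemma cutoff_weak_gradient eta : Cc_infty Omega eta ->
  weak_gradient (fun x => eta x * u x)
    (fun i x => eta x * loc_partial i x + partial i eta x * u x).
Proof.
move=> he; have [se _ _] := he.
have s1 := sqi_cutoffM mu_u H1_loc_sqi he.
have s2 i := sqi_cutoffM (measurable_loc_partial i) (loc_partial_sqi i) he.
have s3 i := sqi_cutoffM mu_u H1_loc_sqi (Cc_partial i he).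
split=> // [i|i phi hp]; first exact: sqiD.
have [sp _ _] := hp.
have hpe : Cc_infty Omega (fun x => phi x * eta x) by exact: Cc_mull.
have := loc_partialP i hpe; rewrite partialM; [|exact: sp|exact: se].
have sP := Cc_sqi hp; have sdP := Cc_sqi (Cc_partial i hp).
have i1 := sqi_mul (s1) sdP; have i2 := sqi_mul (s3 i) sP; have i3 := sqi_mul (s2 i) sP.
rewrite (_ : (fun x => u x * _) =
  (fun x => (eta x * u x) * partial i phi x + (partial i eta x * u x) * phi x)); last first.
  by apply/funext => x; ring.
rewrite RintD// => /(canRL (addrK _)) ->; rewrite -opprD; congr (- _).
rewrite -RintD//; last by have := i3; congr (intg mu _); apply/funext => x; ring.
by apply: eq_Rintegral => x _; ring.
Qed.

End locally_H1.
End sobolev_spaces.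

(** * The fractional seminorm *)

Section dyadic_integrability.
Context {R : realType} {n : nat}.
Local Notation mu := (lebesgue_rV n).
Implicit Types (W : 'rV[R]_n -> R) (z : 'rV[R]_n) (r q A : R).

Lemma geometric_sum_le A q k : 0 <= A -> 0 <= q < 1 ->
  \sum_(0 <= j < k) A * q ^+ j <= A / (1 - q).
Proof.
move=> A0 /andP[q0 q1]; have q1' : 0 < 1 - q by rewrite subr_gt0.
rewrite ler_pdivlMr//.
suff -> : (\sum_(0 <= j < k) A * q ^+ j) * (1 - q) = A - A * q ^+ k.
  by rewrite gerBl mulr_ge0// exprn_ge0.
elim: k => [|k IH]; first by rewrite big_geq// mul0r expr0 mulr1 subrr.
by rewrite big_nat_recr//= mulrDl IH exprS; ring.
Qed.

(** W is dominated by the sum of the functions equal to c_j on the cube of radius rho_j and 0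
    elsewhere, whose integrals are bounded by a geometric series. *)
Lemma intg_dyadic W (c rho : nat -> R) A q : measurable_fun setT W ->
  (forall z, 0 <= W z) -> (forall j, 0 <= c j) -> (forall j, 0 <= rho j) ->
  0 <= A -> 0 <= q < 1 -> (forall j, c j * (2 * rho j) ^+ n <= A * q ^+ j) ->
  (forall z, W z = 0 \/ exists j, `|z| <= rho j /\ W z <= c j) -> intg mu W.
Proof.
move=> mW W0 c0 r0 A0 q01 cA WP.
pose B j := [set z : 'rV[R]_n | `|z| <= rho j].
have BE j : B j = [set z : 'rV[R]_n | `|z - 0| <= rho j].
  by apply/seteqP; split => z /=; rewrite subr0.
have mB j : measurable (B j) by rewrite BE; exact: measurable_cball.
pose F j z := (c j * \1_(B j) z)%:E.
have mF j : measurable_fun setT (F j).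
  by apply/measurable_EFinP; apply: measurable_funM => //; exact: measurable_indic.
have F0 j z : (0 <= F j z)%E by rewrite lee_fin mulr_ge0 ?c0// indicE.
have WF z : ((W z)%:E <= \sum_(0 <= j <oo) F j z)%E.
  case: (WP z) => [->|[j [zj Wj]]]; first by apply: nneseries_ge0.
  apply: (@le_trans _ _ (F j z)).
    by rewrite lee_fin indicE mem_set//= mulr1.
  apply: (@le_trans _ _ (\sum_(0 <= i < j.+1) F i z)%E); last exact: nneseries_lim_ge.
  by rewrite big_nat_recr//= leeDr//; apply: sume_ge0.
apply/integrableP; split; first exact/measurable_EFinP.
rewrite (_ : (fun x => _) = (fun z => (W z)%:E)); last first.
  by apply/funext => z /=; rewrite ger0_norm.
apply: (@le_lt_trans _ _ (\int[mu]_z \sum_(0 <= j <oo) F j z)%E).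
  apply: ge0_le_integral => //.
  - by move=> z _; rewrite lee_fin.
  - exact/measurable_EFinP.
  - exact: ge0_emeasurable_sum.
rewrite integral_nneseries//.
apply: (@le_lt_trans _ _ (A / (1 - q))%:E); last by rewrite ltry.
apply: lime_le; first by apply: is_cvg_nneseries => k _ _; exact: integral_ge0.
apply: nearW => k; apply: (@le_trans _ _ (\sum_(0 <= j < k) (A * q ^+ j)%:E)%E); last first.
  by rewrite sumEFin lee_fin geometric_sum_le.
apply: lee_sum => j _; rewrite /F.
under eq_integral do rewrite EFinM.
rewrite ge0_integralZl//; last 2 first.
- by apply/measurable_EFinP; exact: measurable_indic.
- by rewrite lee_fin.
have -> : (\int[mu]_x (\1_(B j) x)%:E = ((2 * rho j) ^+ n)%:E)%E.
  by rewrite integral_indic// setIT BE; exact: measure_cball.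
by rewrite -EFinM lee_fin.
Qed.

End dyadic_integrability.

(** * The kernel |z|^(-n-2s) *)

Section fractional_kernel.
Context {R : realType} {n : nat}.
Variable s : R.
Hypotheses (s0 : 0 < s) (s1 : s < 1).
Local Notation mu := (lebesgue_rV n).
Implicit Types (x y z : 'rV[R]_n) (r : R).

Let p : R := n%:R + 2 * s.
Let p_gt0 : 0 < p. Proof. by rewrite ltr_wpDl// mulr_gt0. Qed.

Definition fker z : R := enorm z `^ (- (n%:R + 2 * s)).

Lemma fker_ge0 z : 0 <= fker z.
Proof. exact: powR_ge0. Qed.

(** The kernel uses the Euclidean norm and is decreasing in it, so comparison with the smaller sup
    norm bounds it from above. *)
Lemma enorm_ge z : `|z| <= enorm z.
Proof.
have e0 : 0 <= enorm z by exact: sqrtr_ge0.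
apply: rV_norm_le => // i; rewrite -sqrtr_sqr; apply: ler_wsqrtr.
by rewrite (bigD1 i)//= lerDl; apply: sumr_ge0 => j _; exact: sqr_ge0.
Qed.

Lemma enormN z : enorm (- z) = enorm z.
Proof. by congr Num.sqrt; apply: eq_bigr => i _; rewrite mxE sqrrN. Qed.

Lemma fkerN z : fker (- z) = fker z.
Proof. by rewrite /fker enormN. Qed.

Lemma measurable_enorm : measurable_fun setT (@enorm R n).
Proof.
apply: (measurableT_comp (continuous_measurable_fun (@sqrt_continuous R))).
by apply: measurable_sum => i; apply: measurable_funX; exact: measurable_coord.
Qed.

Lemma measurable_fker : measurable_fun setT fker.
Proof. exact: (measurableT_comp (measurable_powR _) measurable_enorm). Qed.

(** A nonzero power of 0 is 0 by convention, so the kernel is not singular at the origin itself. *)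
Lemma fker0 : fker 0 = 0.
Proof.
rewrite /fker /enorm big1 ?sqrtr0; last by move=> i _; rewrite mxE expr0n.
by rewrite powR0// oppr_eq0 gt_eqF.
Qed.

Lemma fker_le r z : 0 < r -> r <= `|z| -> fker z <= (r `^ p)^-1.
Proof.
move=> r0 rz; have re := le_trans rz (enorm_ge z).
rewrite /fker powRN lef_pV2 ?posrE ?powR_gt0//; last exact: lt_le_trans re.
by apply: ge0_ler_powR => //; rewrite ?nnegrE ltW//; exact: lt_le_trans re.
Qed.

(** With p = n + 2 s one has 2^p = 2^n c. The bounds c < 4 and c > 1, coming from s < 1 and s > 0,
    make the dyadic series converge near the origin and at infinity respectively. *)
Let c : R := 4 `^ s.
Let b : R := 2 ^+ n * c.

Let powR4_gt1 r : 0 < r -> 1 < 4 `^ r.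
Proof.
move=> r0; have := @gt0_ltr_powR R r r0 1 4; rewrite powR1; apply; rewrite ?nnegrE//; lra.
Qed.

Let c_gt1 : 1 < c. Proof. exact: powR4_gt1. Qed.

Let c_lt4 : c < 4.
Proof.
have : 1 < 4 `^ (1 - s) by apply: powR4_gt1; rewrite subr_gt0.
have E : c * 4 `^ (1 - s) = 4.
  rewrite /c -powRD; last by apply/implyP => _; apply/eqP; lra.
  by rewrite (_ : s + (1 - s) = 1) ?powRr1//; ring.
move=> h; rewrite -[X in _ < X]E ltr_pMr//; exact: lt_trans c_gt1.
Qed.

Let b_gt0 : 0 < b.
Proof. by rewrite mulr_gt0 ?exprn_gt0// (lt_trans _ c_gt1). Qed.

Let powR2 : 2 `^ p = b.
Proof.
rewrite /p powRD; last by apply/implyP => _; apply/eqP; lra.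
rewrite powR_mulrn// /b /c powRrM powR_mulrn//.
by congr (_ * _ `^ _); ring.
Qed.

Let powR2X j : (2 ^+ j) `^ p = b ^+ j.
Proof.
elim: j => [|j IH]; first by rewrite !expr0 powR1.
by rewrite exprS powRM ?exprn_ge0// IH powR2 exprS.
Qed.

Let powR2VX j : (2^-1 ^+ j) `^ p = b^-1 ^+ j.
Proof.
have V : (2^-1) `^ p = b^-1.
  apply: (mulIf (lt0r_neq0 b_gt0)); rewrite mulVf ?lt0r_neq0// -powR2 -powRM ?invr_ge0//.
  by rewrite mulVf ?powR1//; apply/eqP; lra.
elim: j => [|j IH]; first by rewrite !expr0 powR1.
by rewrite exprS powRM ?exprn_ge0 ?invr_ge0// IH V exprS.
Qed.

Let measurable_norm_le : measurable [set z : 'rV[R]_n | `|z| <= 1].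
Proof.
rewrite (_ : [set _ | _] = [set z : 'rV[R]_n | `|z - 0| <= 1]); first exact: measurable_cball.
by apply/seteqP; split => z /=; rewrite subr0.
Qed.

(** On the shell 2^(-j-1) < |z| <= 2^(-j) the integrand is at most 4^(-j) b^(j+1), and the enclosing
    cube has measure 2^n 2^(-jn); the product is 2^n b (c / 4)^j. *)
Let intg_inner : intg mu (fun z => `|z| ^+ 2 * fker z * \1_[set z : 'rV[R]_n | `|z| <= 1] z).
Proof.
have c0 : 0 < c := lt_trans ltr01 c_gt1.
apply: (@intg_dyadic R n _ (fun j => (2^-1 ^+ j) ^+ 2 * b ^+ j.+1) (fun j => 2^-1 ^+ j)
  (2 ^+ n * b) (c / 4)).
- apply: measurable_funM; last exact: measurable_indic.
  apply: measurable_funM; last exact: measurable_fker.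
  by apply: measurable_funX; apply: continuous_measurable_rV; exact: norm_continuous.
- by move=> z; rewrite !mulr_ge0 ?sqr_ge0 ?fker_ge0// indicE.
- by move=> j; rewrite mulr_ge0 ?sqr_ge0// exprn_ge0// ltW.
- by move=> j; rewrite exprn_ge0 ?invr_ge0.
- by rewrite mulr_ge0 ?exprn_ge0// ltW.
- by rewrite divr_ge0 ?(ltW c0)//= ltr_pdivrMr// mul1r.
- move=> j; rewrite le_eqVlt; apply/orP; left; apply/eqP.
  have h2 : (2^-1 : R) ^+ j ^+ n * 2 ^+ n ^+ j = 1.
    by rewrite -!exprM mulnC -exprMn mulVf ?expr1n//; apply/eqP; lra.
  have h4 : (2^-1 : R) ^+ j ^+ 2 = 4^-1 ^+ j by rewrite -exprM mulnC exprM; congr (_ ^+ _); field.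
  rewrite h4 exprS {2}/b !exprMn.
  rewrite [LHS](_ : _ = 2 ^+ n * b * (c ^+ j * 4^-1 ^+ j) * (2^-1 ^+ j ^+ n * 2 ^+ n ^+ j)).
    by rewrite h2 mulr1.
  by ring.
- move=> z; have [->|z0] := eqVneq z 0; first by left; rewrite fker0 mulr0 mul0r.
  rewrite indicE; case: (leP `|z| 1) => z1; last first.
    by left; rewrite memNset ?mulr0//=; apply/negP; rewrite -ltNge.
  right; have zp : 0 < `|z| by rewrite normr_gt0.
  (* The least such k is some j + 1, as |z| <= 1 excludes 0; minimality gives the upper bound of the
     shell. *)
  have ex : exists k, 2^-1 ^+ k < `|z|.
    have /cvgrPdist_lt/(_ _ zp)[k _ /(_ k (leqnn _))] := @cvg_pow2 R.
    rewrite sub0r normrN ger0_norm ?exprn_ge0 ?invr_ge0//; by exists k.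
  case: (ex_minnP ex) => -[|j] jz jmin; first by move: jz; rewrite expr0 ltNge z1.
  exists j; have zj : `|z| <= 2^-1 ^+ j by rewrite leNgt; apply/negP => /jmin; rewrite ltnn.
  split=> //; rewrite mem_set//= mulr1; apply: ler_pM.
  + exact: sqr_ge0.
  + exact: fker_ge0.
  + by rewrite lerXn2r ?nnegrE ?exprn_ge0 ?invr_ge0.
  + have := @fker_le (2^-1 ^+ j.+1) z _ (ltW jz); rewrite powR2VX -[X in (_ -> _ <= X) -> _]exprVn invrK; apply.
    by rewrite exprn_gt0 ?invr_gt0.
Qed.

(** On the shell 2^j <= |z| <= 2^(j+1) the kernel is at most b^(-j), and the enclosing cube has
    measure 4^n 2^(jn); the product is 4^n c^(-j). *)
Let intg_outer : intg mu (fun z => fker z * \1_(~` [set z : 'rV[R]_n | `|z| <= 1]) z).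
Proof.
have c0 : 0 < c := lt_trans ltr01 c_gt1.
apply: (@intg_dyadic R n _ (fun j => b^-1 ^+ j) (fun j => 2 ^+ j.+1) (4 ^+ n) c^-1).
- apply: measurable_funM; first exact: measurable_fker.
  by apply: measurable_indic; exact: measurableC.
- by move=> z; rewrite mulr_ge0 ?fker_ge0// indicE.
- by move=> j; rewrite exprn_ge0// invr_ge0 ltW.
- by move=> j; rewrite exprn_ge0.
- by rewrite exprn_ge0.
- by rewrite invr_ge0 (ltW c0)/= invf_lt1.
- move=> j; rewrite le_eqVlt; apply/orP; left; apply/eqP.
  have h2 : (2 ^+ n ^+ j : R) != 0 by rewrite !expf_neq0//; apply/eqP; lra.
  have h3 : c ^+ j != 0 by rewrite expf_neq0// gt_eqF.
  rewrite /b !exprVn exprMn exprS mulrA exprMn -[2 ^+ j ^+ n]exprM mulnC exprM.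
  rewrite [in RHS](_ : 4 = 2 * 2); last by ring.
  by field; rewrite h3.
- move=> z; rewrite indicE; case: (leP `|z| 1) => z1.
    by left; rewrite memNset ?mulr0//= => /(_ z1).
  right; have ex : exists k, `|z| <= 2 ^+ k.
    have zp : 0 < `|z|^-1 by rewrite invr_gt0 (lt_trans ltr01).
    have /cvgrPdist_le/(_ _ zp)[k _ /(_ k (leqnn _))] := @cvg_pow2 R.
    rewrite sub0r normrN ger0_norm ?exprn_ge0 ?invr_ge0// exprVn => h; exists k.
    by move: h; rewrite lef_pV2// posrE ?exprn_gt0// (lt_trans ltr01).
  case: (ex_minnP ex) => -[|j] jz jmin; first by move: jz; rewrite expr0 leNgt z1.
  exists j; have zj : 2 ^+ j <= `|z|.
    by apply: ltW; rewrite ltNge; apply/negP => /jmin; rewrite ltnn.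
  split=> //; rewrite mem_set/= ?mulr1; last by apply/negP; rewrite -ltNge.
  by have := @fker_le (2 ^+ j) z _ zj; rewrite powR2X exprVn; apply; rewrite exprn_gt0.
Qed.

(** The weight is the size in z of the squared translation modulus of an H^1 function: |z|^2 for
    small z, bounded for large z. *)
Lemma intg_fker : intg mu (fun z => Num.min (`|z| ^+ 2) 1 * fker z).
Proof.
have := intgD intg_inner intg_outer; congr (intg mu _); apply/funext => z.
rewrite !indicE; case: (leP `|z| 1) => z1.
  rewrite mem_set// memNset; last by move=> /(_ z1).
  by rewrite mulr1 mulr0 addr0 min_l// exprn_ile1.
rewrite memNset; last by apply/negP; rewrite -ltNge.
rewrite mem_set; last by apply/negP; rewrite -ltNge.
by rewrite mulr0 mulr1 add0r min_r ?mul1r// exprn_ege1// ltW.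
Qed.

Lemma fker_bound r : 0 < r -> exists2 C, 0 <= C & forall z, r <= `|z| -> fker z <= C.
Proof.
by move=> r0; exists (r `^ p)^-1; [rewrite invr_ge0 powR_ge0|move=> z; exact: fker_le].
Qed.

End fractional_kernel.

(** * Null sets, measurability and tensor products for the product measure *)

Section product_measure_toolkit.
Context {R : realType} {n : nat}.
Local Notation mu := (lebesgue_rV n).
Local Notation mu2 := (lebesgue_rV n \x lebesgue_rV n)%E.
Implicit Types (f g h : 'rV[R]_n -> R) (x y z : 'rV[R]_n) (p : 'rV[R]_n * 'rV[R]_n).

Lemma ae_fst (P : 'rV[R]_n -> Prop) :
  {ae mu, forall x, P x} -> {ae mu2, forall p, P p.1}.
Proof.
move=> [N [mN N0 PN]]; exists (N `*` setT); split.
- exact: measurableX.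
- rewrite product_measure1E// [X in (X * _)%E](_ : _ = 0%E) ?mul0e//; exact: N0.
- by move=> p /= Pp; split => //; apply: PN.
Qed.

Lemma ae_snd (P : 'rV[R]_n -> Prop) :
  {ae mu, forall x, P x} -> {ae mu2, forall p, P p.2}.
Proof.
move=> [N [mN N0 PN]]; exists (setT `*` N); split.
- exact: measurableX.
- rewrite product_measure1E// [X in (_ * X)%E](_ : _ = 0%E) ?mule0//; exact: N0.
- by move=> p /= Pp; split => //; apply: PN.
Qed.

Lemma measurable_add_pair : measurable_fun setT (fun p : 'rV[R]_n * 'rV[R]_n => p.1 + p.2).
Proof.
apply/measurable_fun_rVP => i; under eq_fun do rewrite mxE.
apply: measurable_funD; first exact: (measurableT_comp (measurable_coord i) measurable_fst).
exact: (measurableT_comp (measurable_coord i) measurable_snd).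
Qed.

Lemma measurable_sub_pair : measurable_fun setT (fun p : 'rV[R]_n * 'rV[R]_n => p.1 - p.2).
Proof.
apply/measurable_fun_rVP => i; under eq_fun do rewrite !mxE.
apply: measurable_funB; first exact: (measurableT_comp (measurable_coord i) measurable_fst).
exact: (measurableT_comp (measurable_coord i) measurable_snd).
Qed.

Lemma measurable_comp_fst f : measurable_fun setT f -> measurable_fun setT (fun p => f p.1 : R).
Proof. by move=> mf; exact: (measurableT_comp mf measurable_fst). Qed.

Lemma measurable_comp_snd f : measurable_fun setT f -> measurable_fun setT (fun p => f p.2 : R).
Proof. by move=> mf; exact: (measurableT_comp mf measurable_snd). Qed.

Lemma intg_tensor f g : intg mu f -> intg mu g ->
  intg mu2 (fun p => f p.1 * g p.2) /\
  \int[mu2]_p `|f p.1 * g p.2| = (\int[mu]_x `|f x|) * (\int[mu]_y `|g y|).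
Proof.
move=> hf hg; have mf := intg_measurable hf; have mg := intg_measurable hg.
have mF : measurable_fun setT (fun p => f p.1 * g p.2).
  by apply: measurable_funM; [exact: measurable_comp_fst|exact: measurable_comp_snd].
pose F (p : 'rV[R]_n * 'rV[R]_n) := (`|f p.1 * g p.2|)%:E.
have mEF : measurable_fun setT F.
  by apply/measurable_EFinP; exact: measurableT_comp.
have F0 p : (0 <= F p)%E by rewrite lee_fin.
have g0 : 0 <= \int[mu]_y `|g y| by apply: Rintegral_ge0.
have E : (\int[mu2]_p F p = ((\int[mu]_x `|f x|) * (\int[mu]_y `|g y|))%:E)%E.
  rewrite (fubini_tonelli1 F mEF F0) /fubini_F.
  under eq_integral => x _.
    under eq_integral do rewrite /F /= normrM EFinM.
    rewrite ge0_integralZl_EFin//; last first.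
      by apply/measurable_EFinP; exact: measurableT_comp.
    rewrite -(EFin_Rint (intg_abs hg)) muleC.
    over.
  rewrite ge0_integralZl_EFin//; last first.
    by apply/measurable_EFinP; exact: measurableT_comp.
  by rewrite -(EFin_Rint (intg_abs hf)) -EFinM mulrC.
have iF : intg mu2 (fun p => f p.1 * g p.2).
  apply/integrableP; split; first exact/measurable_EFinP.
  by under eq_integral do rewrite /=; rewrite E ltry.
by split=> //; apply: EFin_inj; rewrite -E EFin_Rint//; exact: intg_abs.
Qed.

End product_measure_toolkit.

(** * The fractional seminorm is controlled by the H^1 norm *)

Section gagliardo_seminorm.
Context {R : realType} {n : nat}.
Variable s : R.
Hypotheses (s0 : 0 < s) (s1 : s < 1).
Local Notation mu := (lebesgue_rV n).
Local Notation mu2 := (lebesgue_rV n \x lebesgue_rV n)%E.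
Implicit Types (f h : 'rV[R]_n -> R) (x y z : 'rV[R]_n) (p : 'rV[R]_n * 'rV[R]_n).

(* Each difference carries the square root of the kernel, so that the nonlocal bilinear form
   is an L2 inner product on the product space. *)
Definition frac_diff f p : R :=
  (f p.1 - f p.2) * enorm (p.1 - p.2) `^ (- (n%:R + 2 * s) / 2).

Lemma frac_diffM f h p :
  frac_diff f p * frac_diff h p = (f p.1 - f p.2) * (h p.1 - h p.2) * fker s (p.1 - p.2).
Proof.
have <- : enorm (p.1 - p.2) `^ (- (n%:R + 2 * s) / 2) ^+ 2 = fker s (p.1 - p.2).
  rewrite -powR_mulrn ?powR_ge0// -powRrM /fker; by congr (_ `^ _); field.
by rewrite /frac_diff; ring.
Qed.

Lemma measurable_frac_diff f : measurable_fun setT f -> measurable_fun setT (frac_diff f).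
Proof.
move=> mf; apply: measurable_funM.
  by apply: measurable_funB; [exact: measurable_comp_fst|exact: measurable_comp_snd].
apply: (measurableT_comp (measurable_powR _)).
exact: (measurableT_comp measurable_enorm measurable_sub_pair).
Qed.

Definition fker_mass : R := \int[mu]_z (Num.min (`|z| ^+ 2) 1 * fker s z).

(** Substituting y = x + z and exchanging the integrals leaves the integral over z of the kernel
    times the squared translation modulus. The latter is bounded by the gradient when |z| <= 1 and
    by 4 times the squared norm of f otherwise. *)
Lemma gagliardo_bound f (g : 'I_n -> 'rV[R]_n -> R) r : weak_gradient f g ->
  (forall x, f x != 0 -> `|x| <= r) -> (forall i x, g i x != 0 -> `|x| <= r) ->
  sqi mu2 (frac_diff f) /\ nrm2 mu2 (frac_diff f) <=
    fker_mass * (8 * 2 ^+ n * \sum_i nrm2 mu (g i) + 4 * nrm2 mu f).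
Proof.
move=> [sf sg fg] fr gr; have mf := sf.1.
set B := 8 * _ * _ + _.
have S0 : 0 <= \sum_i nrm2 mu (g i) by apply: sumr_ge0 => i _; exact: nrm2_ge0.
have N0 := nrm2_ge0 mu f.
have a0 : 0 <= 8 * 2 ^+ n * \sum_i nrm2 mu (g i) by rewrite !mulr_ge0// exprn_ge0.
have B0 : 0 <= B by rewrite addr_ge0// mulr_ge0.
pose m z := Num.min (`|z| ^+ 2) 1 * fker s z.
have im : intg mu m by exact: intg_fker.
have bd z : nrm2 mu (fun x => f (x + z) - f x) * fker s z <= B * m z.
  rewrite /m mulrA; apply: ler_wpM2r; first exact: fker_ge0.
  case: (leP (`|z| ^+ 2) 1) => z1.
    apply: (le_trans (nrm2_translate_vec sf sg fr gr fg z)).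
    by rewrite mulrAC; apply: ler_wpM2r; rewrite ?sqr_ge0// lerDl mulr_ge0.
  rewrite mulr1; apply: (le_trans (nrm2B (sqi_translate z sf) sf)).
  by rewrite nrm2_translate// /B; lra.
pose F p := ((f (p.1 + p.2) - f p.1) ^+ 2 * fker s p.2)%:E.
have mF : measurable_fun setT F.
  apply/measurable_EFinP; apply: measurable_funM; last first.
    exact: (measurable_comp_snd (@measurable_fker R n s)).
  apply: measurable_funX; apply: measurable_funB; last exact: measurable_comp_fst.
  exact: (measurableT_comp mf measurable_add_pair).
have F0 p : (0 <= F p)%E by rewrite lee_fin mulr_ge0 ?sqr_ge0 ?fker_ge0.
have mB := measurable_frac_diff mf.
pose G p := (frac_diff f p ^+ 2)%:E.
have mG : measurable_fun setT G by apply/measurable_EFinP; exact: measurable_funX.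
have G0 p : (0 <= G p)%E by rewrite lee_fin sqr_ge0.
have E : (\int[mu2]_p G p <= (fker_mass * B)%:E)%E.
  rewrite (fubini_tonelli1 G mG G0) /fubini_F.
  have -> : (\int[mu]_x \int[mu]_y G (x, y) = \int[mu]_x \int[mu]_z F (x, z))%E.
    apply: eq_integral => x _.
    rewrite -(ge0_integral_translate x); [|exact: (measurableT_comp mG (measurable_pair1 x))|by []].
    apply: eq_integral => z _; rewrite /G /F expr2 frac_diffM /= [z + x]addrC.
    by rewrite opprD addrA subrr add0r fkerN -expr2 -[f x - _]opprB sqrrN.
  rewrite (fubini_tonelli F mF F0).
  apply: (@le_trans _ _ (\int[mu]_z (B * m z)%:E)%E); last first.
    rewrite -EFin_Rint; last exact: intgZ.
    by rewrite RintZ// mulrC.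
  apply: ge0_le_integral => //.
  - by move=> z _; apply: integral_ge0.
  - exact: (measurable_fun_fubini_tonelli_G F mF F0).
  - by apply/measurable_EFinP; apply: measurable_funM => //; exact: intg_measurable im.
  - move=> z _; rewrite /F /=; under eq_integral do rewrite mulrC EFinM.
    rewrite ge0_integralZl_EFin ?fker_ge0//; last 2 first.
    + by move=> x _; rewrite lee_fin sqr_ge0.
    + by apply/measurable_EFinP; apply: measurable_funX; exact: (sqi_diff_translate z sf).1.
    rewrite -EFin_Rint; last by have [] := sqi_diff_translate z sf.
    by rewrite -EFinM lee_fin mulrC; exact: bd.
have iB : intg mu2 (fun p => frac_diff f p ^+ 2).
  apply/integrableP; split; first exact/measurable_EFinP/measurable_funX.
  rewrite (eq_integral G) => [|p _ /=]; first exact: le_lt_trans E (ltry _).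
  by rewrite ger0_norm// sqr_ge0.
by split=> //; rewrite -lee_fin /nrm2 EFin_Rint.
Qed.

Lemma fker_mass_ge0 : 0 <= fker_mass.
Proof.
by apply: Rintegral_ge0 => z _; rewrite mulr_ge0 ?fker_ge0// le_min sqr_ge0/=.
Qed.

End gagliardo_seminorm.

(** * The energy form *)

Section finite_ae.
Context d (T : measurableType d) (R : realType).
Variable mu : {measure set T -> \bar R}.

Lemma ae_forall_fin (I : finType) (P : I -> T -> Prop) :
  (forall i, {ae mu, forall x, P i x}) -> {ae mu, forall x, forall i, P i x}.
Proof.
move=> H; have S (r : seq I) : {ae mu, forall x, forall i, i \in r -> P i x}.
  elim: r => [|i r IH]; first exact: nearW.
  apply: filterS2 (H i) IH => x Pi IH j; rewrite inE => /orP[/eqP ->//|]; exact: IH.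
by apply: filterS (S (index_enum I)) => x Px i; apply: Px; rewrite mem_index_enum.
Qed.

End finite_ae.

Section energy.
Context {R : realType} {n : nat}.
Local Notation mu := (lebesgue_rV n).
Local Notation mu2 := (lebesgue_rV n \x lebesgue_rV n)%E.
Variables (s : R) (Omega : set 'rV[R]_n) (u : 'rV[R]_n -> R).
Hypotheses (s0 : 0 < s) (s1 : s < 1) (oO : open Omega) (mu_u : measurable_fun setT u)
  (uH : H1_loc Omega u) (iu : intg mu u).
Implicit Types (psi phi : 'rV[R]_n -> R) (g : 'I_n -> 'rV[R]_n -> R) (x y z : 'rV[R]_n)
  (p : 'rV[R]_n * 'rV[R]_n) (e c C : R).

Definition nonlocal_density psi p : R :=
  (u p.1 - u p.2) * (psi p.1 - psi p.2) * fker s (p.1 - p.2).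

Definition H1_norm2 psi g : R := nrm2 mu psi + \sum_i nrm2 mu (g i).

Lemma H1_norm2_ge0 psi g : 0 <= H1_norm2 psi g.
Proof. by rewrite addr_ge0 ?nrm2_ge0// sumr_ge0// => i _; exact: nrm2_ge0. Qed.

Section on_compact.
Variable K : set 'rV[R]_n.
Hypotheses (cK : compact K) (KO : K `<=` Omega).

(** Vanishing off [K] is required at every point, so that the decomposition of the nonlocal density
    is a pointwise identity. *)
Definition supported_gradient psi g :=
  [/\ weak_gradient psi g, forall x, ~ K x -> psi x = 0 & forall i x, ~ K x -> g i x = 0].

Lemma supported_gradient_linear c psi g psi' g' : supported_gradient psi g ->
  supported_gradient psi' g' ->
  supported_gradient (fun x => c * psi x + psi' x) (fun i x => c * g i x + g' i x).
Proof.
move=> [w a b] [w' a' b']; split; first exact: weak_gradient_linear.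
- by move=> x Kx; rewrite a// a'// mulr0 addr0.
- by move=> i x Kx; rewrite b// b'// mulr0 addr0.
Qed.

(** Restriction to [K] changes the function and its derivatives only on null sets, the derivatives
    because of [weak_gradient_off]. *)
Lemma supported_restrict psi g : weak_gradient psi g ->
  {ae mu, forall x, ~ K x -> psi x = 0} ->
  [/\ weak_gradient psi (fun i => g i \_ K), {ae mu, forall x, psi x = (psi \_ K) x} &
    supported_gradient (psi \_ K) (fun i => g i \_ K)].
Proof.
move=> wg p0; have [sp sg _] := wg; have mK := compact_measurable_rV cK.
have clK := compact_closed (@norm_hausdorff _ _) cK.
have ae1 : {ae mu, forall x, psi x = (psi \_ K) x}.
  apply: filterS p0 => x h; have [Kx|Kx] := pselect (K x); first by rewrite (restrict_in psi Kx).
  by rewrite (restrict_out psi Kx) h.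
have ae2 i : {ae mu, forall x, g i x = (g i \_ K) x}.
  apply: filterS (weak_gradient_off i clK wg p0) => x h.
  have [Kx|Kx] := pselect (K x); first by rewrite (restrict_in (g i) Kx).
  by rewrite (restrict_out (g i) Kx) h.
have m1 : measurable_fun setT (psi \_ K) by have [] := sqi_restrict mK sp.
have m2 i : measurable_fun setT (g i \_ K) by have [] := sqi_restrict mK (sg i).
split=> //.
  apply: weak_gradient_ae wg => //; [exact: sp.1|exact: nearW].
split; first exact: weak_gradient_ae wg.
- by move=> x Kx; rewrite (restrict_out psi Kx).
- by move=> i x Kx; rewrite (restrict_out (g i) Kx).
Qed.

Variables (eta : 'rV[R]_n -> R) (d : R).
Hypotheses (he : Cc_infty Omega eta) (d0 : 0 < d)
  (eK : forall x y, K x -> `|y - x| <= d -> eta y = 1).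

(** u = f + v, where f is in H^1 of the whole space with compact support, and v is merely integrable
    but vanishes within distance [d] of [K]. *)
Let f x := eta x * u x.
Let gf i x := eta x * loc_partial Omega u i x + partial i eta x * u x.
Let v x := u x - eta x * u x.
Let wf : weak_gradient f gf. Proof. exact: cutoff_weak_gradient. Qed.

Let iv : intg mu v.
Proof.
by apply: intgB => //; have [M _ eM] := Cc_sup he; exact: intg_mull (Cc_measurable he) eM iu.
Qed.

Lemma eta_eq1 x : K x -> eta x = 1.
Proof. by move=> Kx; apply: (eK Kx); rewrite subrr normr0 ltW. Qed.

Lemma partial_eta0 i x : K x -> partial i eta x = 0.
Proof.
move=> Kx; apply: partialE; apply: (near_eq_is_derive _ (is_derive_cst (1 : R) _ _)).
apply/nbhs_ballP; exists d => //= y; rewrite -ball_normE /= distrC => xy.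
by rewrite (eK Kx)// ltW.
Qed.

Lemma cutoff_gradient_on i x : K x -> gf i x = loc_partial Omega u i x.
Proof. by move=> Kx; rewrite /gf eta_eq1// partial_eta0// mul1r mul0r addr0. Qed.

Let v0 x : K x -> v x = 0.
Proof. by move=> Kx; rewrite /v eta_eq1// mul1r subrr. Qed.

Let far_set : set 'rV[R]_n := ~` [set z | `|z - 0| <= d].
Let fark z : R := fker s z * \1_far_set z.
Let far psi p := (v p.1 * psi p.2 + psi p.1 * v p.2) * fark (p.1 - p.2).

Let mfark : measurable_fun setT fark.
Proof.
apply: measurable_funM; first exact: measurable_fker.
by apply: measurable_indic; apply: measurableC; exact: measurable_cball.
Qed.

(** Since v psi = 0, the product of the increments of v and psi reduces to minus the cross terms.
    These vanish when |x - y| <= d, which allows the kernel to be truncated. *)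
Let nonlocalE psi p : (forall x, ~ K x -> psi x = 0) ->
  nonlocal_density psi p = frac_diff s f p * frac_diff s psi p - far psi p.
Proof.
move=> p0; rewrite frac_diffM /nonlocal_density /far.
have vp x : v x * psi x = 0.
  by have [/v0 ->|/p0 ->] := pselect (K x); rewrite ?mul0r ?mulr0.
have vk x y (z : 'rV[R]_n) : `|z| = `|x - y| ->
    v x * psi y * fark z = v x * psi y * fker s z.
  move=> zxy; rewrite /fark indicE.
  have [Ky|/p0 ->] := pselect (K y); last by rewrite !mulr0 !mul0r.
  case: (leP `|z| d) => zd; last first.
    have fz : far_set z by rewrite /far_set /= subr0; apply/negP; rewrite -ltNge.
    by rewrite mem_set// mulr1.
  rewrite memNset; last by rewrite /far_set /= subr0 => /(_ zd).
  by rewrite /v (eK Ky) -?zxy// mul1r subrr !mul0r.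
have u1 x : u x = f x + v x by rewrite /f /v; ring.
rewrite [X in _ = _ - X]mulrDl [psi p.1 * v p.2]mulrC (vk p.1 p.2)// (vk p.2 p.1); last exact: distrC.
rewrite (u1 p.1) (u1 p.2); move: (vp p.1) (vp p.2).
move: (f p.1) (f p.2) (v p.1) (v p.2) (psi p.1) (psi p.2) (fker s _) => a b c e a' b' k h1 h2.
rewrite [LHS](_ : _ = (a - b) * (a' - b') * k + (c * a' + e * b') * k - (c * b' * k + e * a' * k)).
  by rewrite h1 h2 addr0 mul0r addr0.
by ring.
Qed.

(** A radius common to [K], [f] and [gf], fixed once for the following lemmas; [rP] shows that one
    exists, so the default 0 is not what [xget] returns by lack of a candidate. *)
Let r := xget 0 [set r : R | (forall x, K x -> `|x| <= r) /\
  (forall x, f x != 0 -> `|x| <= r) /\ (forall i x, gf i x != 0 -> `|x| <= r)].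
Let rP : (forall x, K x -> `|x| <= r) /\
  (forall x, f x != 0 -> `|x| <= r) /\ (forall i x, gf i x != 0 -> `|x| <= r).
Proof.
apply: (@xgetPex _ 0 [set r : R | (forall x, K x -> `|x| <= r) /\
  (forall x, f x != 0 -> `|x| <= r) /\ (forall i x, gf i x != 0 -> `|x| <= r)]).
have [r1 r10 h1] := compact_norm_bound cK.
have /Cc_inftyP[_ [L [cL _ L0]]] := he; have [r2 r20 h2] := compact_norm_bound cL.
have clL := compact_closed (@norm_hausdorff _ _) cL.
have L2 x : L x -> `|x| <= r1 + r2 by move=> /h2; lra.
exists (r1 + r2); split; first by move=> x /h1; lra.
split=> [x|i x] h; apply: L2; apply: contrapT => Lx; move: h.
  by rewrite /f L0// mul0r eqxx.
by rewrite /gf L0// (partial_off_support i clL L0 Lx) !mul0r addr0 eqxx.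
Qed.

Let f_gagliardo : sqi mu2 (frac_diff s f).
Proof. by have [_ [h1 h2]] := rP; exact: (gagliardo_bound s0 s1 wf h1 h2).1. Qed.

Let supp_r (h : 'rV[R]_n -> R) : (forall x, ~ K x -> h x = 0) -> forall x, h x != 0 -> `|x| <= r.
Proof.
move=> h0 x hx; apply: rP.1; apply: contrapT => /h0 h1; by rewrite h1 eqxx in hx.
Qed.

Let psi_gagliardo psi g : supported_gradient psi g -> sqi mu2 (frac_diff s psi) /\
  nrm2 mu2 (frac_diff s psi) <= @fker_mass R n s * ((8 * 2 ^+ n + 4) * H1_norm2 psi g).
Proof.
move=> [wp p0 g0].
have [h1 h2] := gagliardo_bound s0 s1 wp (supp_r p0) (fun i => supp_r (g0 i)).
split=> //; apply: (le_trans h2); apply: ler_wpM2l; first exact: fker_mass_ge0.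
have a1 := nrm2_ge0 mu psi.
have a2 : 0 <= \sum_i nrm2 mu (g i) by apply: sumr_ge0 => i _; exact: nrm2_ge0.
have a3 : 0 <= 2 ^+ n :> R by rewrite exprn_ge0.
rewrite /H1_norm2; move: (2 ^+ n) (nrm2 _ _) (\sum_i _) a1 a2 a3 => a b c hb hc ha.
by have := mulr_ge0 ha hb; lra.
Qed.

Let psi_intg psi g : supported_gradient psi g -> intg mu psi.
Proof. by move=> [[sp _ _] p0 _]; exact: sqi_intg sp (supp_r p0). Qed.

Let farC : exists2 C, 0 <= C & forall z, `|fark z| <= C.
Proof.
have [C C0 CP] := @fker_bound R n s s0 d d0; exists C => // z.
rewrite /fark indicE; have [zd|zd] := pselect (far_set z).
  rewrite mem_set// mulr1 ger0_norm ?fker_ge0//; apply: CP.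
  by move: zd; rewrite /far_set /= subr0 => /negP; rewrite -ltNge => /ltW.
by rewrite memNset// mulr0 normr0.
Qed.

(** The truncated kernel is bounded, so the far part is at most a constant times the product of the
    L1 norms of v and psi. As psi is supported in [K], its L1 norm is its absolute value tested on
    the indicator of [K]. *)
Let far_bound : exists2 C, 0 <= C & forall psi g, supported_gradient psi g ->
  intg mu2 (far psi) /\ forall e, 0 < e ->
    `|\int[mu2]_p far psi p| <= C * (e + e^-1 * H1_norm2 psi g).
Proof.
have [C C0 CP] := farC.
have V0 : 0 <= \int[mu]_x `|v x| by apply: Rintegral_ge0.
have mK := compact_measurable_rV cK.
have sK : sqi mu (\1_K : 'rV[R]_n -> R).
  apply: (@sqi_bounded R n _ r 1); first exact: measurable_indic.
    by move=> x; rewrite indicE normr_nat; case: (_ \in _).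
  by apply: supp_r => x Kx; rewrite indicE memNset.
have N0 := nrm2_ge0 mu (\1_K : 'rV[R]_n -> R).
exists (C * 2 * (\int[mu]_x `|v x|) * (nrm2 mu (\1_K : 'rV[R]_n -> R) + 1)).
  by rewrite !mulr_ge0// addr_ge0.
move=> psi g sp; have ip := psi_intg sp; have [[sqp sg _] p0 _] := sp.
have [t1 t1E] := intg_tensor iv ip; have [t2 t2E] := intg_tensor ip iv.
have iD := intgD t1 t2.
have if_ : intg mu2 (far psi).
  rewrite /far; under eq_fun do rewrite mulrC.
  apply: (@intg_mull _ _ R mu2 (fun p => fark (p.1 - p.2)) _ C) => //.
  exact: (measurableT_comp mfark measurable_sub_pair).
split=> // e e0.
have b1 : `|\int[mu2]_p far psi p| <= C * 2 * (\int[mu]_x `|v x|) * \int[mu]_x `|psi x|.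
  apply: (le_trans (Rint_norm if_)).
  rewrite [leRHS](_ : _ = \int[mu2]_p (C * (`|v p.1 * psi p.2| + `|psi p.1 * v p.2|))).
    apply: Rint_le; [exact: intg_abs|by apply: intgZ; apply: intgD; exact: intg_abs|].
    move=> p; rewrite /far normrM mulrC; apply: ler_pM => //; exact: ler_normD.
  rewrite RintZ; last by apply: intgD; exact: intg_abs.
  by rewrite RintD ?t1E ?t2E; [ring|exact: intg_abs|exact: intg_abs].
have nE : nrm2 mu (fun x => `|psi x|) = nrm2 mu psi.
  by apply: eq_Rintegral => x _; rewrite real_normK ?num_real.
have b2 : \int[mu]_x `|psi x| <= e * nrm2 mu (\1_K : 'rV[R]_n -> R) + e^-1 * nrm2 mu psi.
  have sa : sqi mu (fun x => `|psi x|).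
    by apply: (sqi_le _ _ sqp) => [|x]; [apply: measurableT_comp => //; exact: sqp.1|rewrite normr_id].
  rewrite -nE; apply: (le_trans _ (ip_bound e0 sK sa)).
  rewrite le_eqVlt; apply/orP; left; apply/eqP.
  rewrite -[LHS]ger0_norm; last by apply: Rintegral_ge0.
  congr (`|_|); apply: eq_Rintegral => x _; rewrite indicE.
  have [Kx|Kx] := pselect (K x); first by rewrite mem_set// mul1r.
  by rewrite p0// normr0 mulr0.
apply: (le_trans b1); rewrite -[leRHS]mulrA; apply: ler_wpM2l; first by rewrite !mulr_ge0.
apply: (le_trans b2).
have S0 : 0 <= \sum_i nrm2 mu (g i) by apply: sumr_ge0 => i _; exact: nrm2_ge0.
have M0 := nrm2_ge0 mu psi; have ei : 0 < e^-1 by rewrite invr_gt0.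
rewrite /H1_norm2; move: (e^-1) ei (nrm2 _ _) (nrm2 _ _) (\sum_i _) N0 M0 S0 => e' e'0 a b c a0 b0 c0.
have := mulr_ge0 (ltW e'0) b0; have := mulr_ge0 (ltW e'0) c0; have := mulr_ge0 (ltW e0) a0.
by have := mulr_ge0 a0 (mulr_ge0 (ltW e'0) b0); have := mulr_ge0 a0 (mulr_ge0 (ltW e'0) c0); lra.
Qed.

Lemma nonlocal_intg psi g : supported_gradient psi g -> intg mu2 (nonlocal_density psi).
Proof.
move=> sp; have [_ p0 _] := sp; have [C C0 /(_ _ _ sp)[h1 _]] := far_bound.
have [h2 _] := psi_gagliardo sp.
rewrite (_ : nonlocal_density psi = fun p => frac_diff s f p * frac_diff s psi p - far psi p).
  by apply: intgB => //; exact: sqi_mul.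
by apply/funext => p; exact: nonlocalE.
Qed.

Lemma local_intg psi g i : supported_gradient psi g -> intg mu (fun x => gf i x * g i x).
Proof. by move=> [[_ sg _] _ _]; have [_ sgf _] := wf; exact: sqi_mul. Qed.

(** Replaces the selected derivatives in [energy] by the explicit [gf] and [g]: on [K] the cut-off
    does not alter the gradient of [u], and off [K] the gradient of the test function vanishes. *)
Lemma energyE psi psi' g : weak_gradient psi g -> {ae mu, forall x, psi x = psi' x} ->
  supported_gradient psi' g -> energy s Omega u psi =
  \int[mu]_x (\sum_i gf i x * g i x) + \int[mu2]_p nonlocal_density psi' p.
Proof.
move=> wp ae1 sp'; have [wp' p0 g0] := sp'; have [sp sg _] := wp; have [_ sgf _] := wf.
have mO := open_measurable_rV oO.
congr (_ + _).
- rewrite Rint_in; apply: Rint_ae_eq.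
  + apply/(measurable_restrictT _ mO); apply: measurable_sum => i; apply: measurable_funM.
      by apply/(measurable_restrictT _ mO); exact: measurable_loc_partial.
    exact: (wpartial_weak_gradient i oO wp).1.
  + by apply: measurable_sum => i; apply: measurable_funM; [exact: (sgf i).1|exact: (sg i).1].
  + have := ae_forall_fin (fun i => (wpartial_weak_gradient i oO wp).2).
    apply: filterS => x H; have [Kx|Kx] := pselect (K x).
      rewrite (restrict_in _ (KO Kx)); apply: eq_bigr => i _.
      by rewrite cutoff_gradient_on// /loc_partial (restrict_in _ (KO Kx)) H//; exact: KO.
    rewrite [RHS]big1; last by move=> i _; rewrite g0// mulr0.
    have [Ox|Ox] := pselect (Omega x); last by rewrite (restrict_out _ Ox).
    by rewrite (restrict_in _ Ox) big1// => i _; rewrite H// g0// mulr0.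
- have md h : measurable_fun setT h -> measurable_fun setT (nonlocal_density h).
    move=> mh; apply: measurable_funM; last first.
      exact: (measurableT_comp (@measurable_fker R n s) measurable_sub_pair).
    by apply: measurable_funM; apply: measurable_funB;
      [exact: measurable_comp_fst|exact: measurable_comp_snd|
       exact: measurable_comp_fst|exact: measurable_comp_snd].
  apply: Rint_ae_eq.
  + exact: md sp.1.
  + by have [[m _] _ _] := wp'; exact: md.
  + apply: filterS2 (ae_fst ae1) (ae_snd ae1) => p h1 h2.
    by rewrite /nonlocal_density h1 h2.
Qed.

(** The bound keeps the free parameter e of Young's inequality, common to the local, near and far
    parts; it is optimised once in [energy_bounded]. *)
Lemma energy_param_bound : exists2 C, 0 <= C & forall psi psi' g, weak_gradient psi g ->
  {ae mu, forall x, psi x = psi' x} -> supported_gradient psi' g -> forall e, 0 < e ->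
  `|energy s Omega u psi| <= C * (e + e^-1 * H1_norm2 psi g).
Proof.
have [C C0 CP] := far_bound; have M0 := @fker_mass_ge0 R n s.
pose A := \sum_i nrm2 mu (gf i); pose B := nrm2 mu2 (frac_diff s f).
pose D := @fker_mass R n s * (8 * 2 ^+ n + 4) : R.
have A0 : 0 <= A by apply: sumr_ge0 => i _; exact: nrm2_ge0.
have B0 : 0 <= B by exact: nrm2_ge0.
have D0 : 0 <= D by rewrite mulr_ge0// addr_ge0// mulr_ge0// exprn_ge0.
exists (A + 1 + B + D + C); first by rewrite !addr_ge0.
move=> psi psi' g wp ae1 sp e e0.
have [[sp' sg' _] p0 g0] := sp; have [_ sgf _] := wf.
rewrite (energyE wp ae1 sp).
have -> : H1_norm2 psi g = H1_norm2 psi' g.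
  by congr (_ + _); apply: nrm2_ae_eq => //; [have [[]] := wp|exact: sp'.1].
have N0 := H1_norm2_ge0 psi' g; have ei : 0 < e^-1 by rewrite invr_gt0.
have b1 : `|\int[mu]_x (\sum_i gf i x * g i x)| <= e * A + e^-1 * H1_norm2 psi' g.
  rewrite Rint_sum; last by move=> i; exact: local_intg sp.
  apply: (le_trans (ler_norm_sum _ _ _)).
  apply: (@le_trans _ _ (\sum_i (e * nrm2 mu (gf i) + e^-1 * nrm2 mu (g i)))).
    by apply: ler_sum => i _; exact: ip_bound.
  rewrite big_split /= -!mulr_sumr lerD2l ler_pM2l// lerDr; exact: nrm2_ge0.
have [h2 b2] := psi_gagliardo sp; have [h3 /(_ _ e0) b3] := CP _ _ sp.
have b4 : `|\int[mu2]_p nonlocal_density psi' p| <=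
    e * B + e^-1 * (D * H1_norm2 psi' g) + C * (e + e^-1 * H1_norm2 psi' g).
  under eq_Rintegral do rewrite nonlocalE//.
  rewrite RintB//; last exact: sqi_mul.
  apply: (le_trans (ler_normB _ _)); apply: lerD => //.
  apply: (le_trans (ip_bound e0 f_gagliardo h2)).
  by rewrite lerD2l ler_pM2l// /D -mulrA.
apply: (le_trans (ler_normD _ _)); apply: (le_trans (lerD b1 b4)).
move: (H1_norm2 _ _) (e^-1) N0 ei => N e' N0 e'0.
have := mulr_ge0 A0 (mulr_ge0 (ltW e'0) N0); have := mulr_ge0 B0 (mulr_ge0 (ltW e'0) N0).
have := mulr_ge0 (ltW e'0) N0; have := mulr_ge0 D0 (ltW e0).
by lra.
Qed.

End on_compact.

Lemma H1_supported K psi : compact K -> H1 setT psi ->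
  {ae mu, forall x, ~ K x -> psi x = 0} ->
  exists psi' g, [/\ weak_gradient psi g, {ae mu, forall x, psi x = psi' x} &
    supported_gradient K psi' g].
Proof.
move=> cK /H1_setTP[g wg] p0; have [h1 h2 h3] := supported_restrict cK wg p0.
by exists (psi \_ K), (fun i => g i \_ K).
Qed.

Lemma energy_linear K c psi1 psi2 : compact K -> K `<=` Omega ->
  H1 setT psi1 -> {ae mu, forall x, ~ K x -> psi1 x = 0} ->
  H1 setT psi2 -> {ae mu, forall x, ~ K x -> psi2 x = 0} ->
  energy s Omega u (fun x => c * psi1 x + psi2 x) =
  c * energy s Omega u psi1 + energy s Omega u psi2.
Proof.
move=> cK KO h1 z1 h2 z2.
have [p1 [g1 [w1 a1 s1']]] := H1_supported cK h1 z1.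
have [p2 [g2 [w2 a2 s2']]] := H1_supported cK h2 z2.
have [eta [d [he _ d0 eK]]] := cutoff_exists cK oO KO.
pose gf i x := eta x * loc_partial Omega u i x + partial i eta x * u x.
rewrite (energyE KO he d0 eK w1 a1 s1') (energyE KO he d0 eK w2 a2 s2').
have a12 : {ae mu, forall x, c * psi1 x + psi2 x = c * p1 x + p2 x}.
  by apply: filterS2 a1 a2 => x -> ->.
have s12 := supported_gradient_linear c s1' s2'.
rewrite (energyE KO he d0 eK (weak_gradient_linear c w1 w2) a12 s12).
have L1 i : intg mu (fun x => gf i x * g1 i x) := local_intg he i s1'.
have L2 i : intg mu (fun x => gf i x * g2 i x) := local_intg he i s2'.
have N1 := nonlocal_intg cK he d0 eK s1'.
have N2 := nonlocal_intg cK he d0 eK s2'.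
have -> : (fun x => \sum_i gf i x * (c * g1 i x + g2 i x)) =
    (fun x => c * (\sum_i gf i x * g1 i x) + \sum_i gf i x * g2 i x).
  by apply/funext => x; rewrite mulr_sumr -big_split; apply: eq_bigr => i _ /=; ring.
have -> : nonlocal_density (fun x => c * p1 x + p2 x) =
    (fun p => c * nonlocal_density p1 p + nonlocal_density p2 p).
  by apply/funext => p; rewrite /nonlocal_density; ring.
have S1 := intg_sum (index_enum 'I_n) L1; have S2 := intg_sum (index_enum 'I_n) L2.
rewrite !RintD//; [|exact: intgZ|exact: intgZ].
by rewrite !RintZ//; ring.
Qed.

(** Take e = sqrt N, or let e tend to 0 when N = 0. *)
Lemma le_sqrt_of_param (X C N : R) : 0 <= C -> 0 <= N ->
  (forall e, 0 < e -> X <= C * (e + e^-1 * N)) -> X <= 2 * C * Num.sqrt N.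
Proof.
move=> C0 N0 H; have [N00|Np] := eqVneq N 0.
  rewrite N00 sqrtr0 mulr0; apply/ler_addgt0Pr => e e0; rewrite add0r.
  have C1 : 0 < C + 1 by lra.
  apply: (le_trans (H (e / (C + 1)) _)); first by rewrite divr_gt0.
  rewrite N00 mulr0 addr0 mulrA ler_pdivrMr//.
  by have := mulr_ge0 C0 (ltW e0); lra.
have Np' : 0 < N by rewrite lt_neqAle eq_sym Np.
have q0 : 0 < Num.sqrt N by rewrite sqrtr_gt0.
have E : (Num.sqrt N)^-1 * N = Num.sqrt N by rewrite -{2}(sqr_sqrtr N0) expr2 mulKf ?gt_eqF.
by have := H _ q0; rewrite E; lra.
Qed.

Lemma energy_bounded K : compact K -> K `<=` Omega -> exists2 C, 0 <= C & forall psi,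
  H1 setT psi -> {ae mu, forall x, ~ K x -> psi x = 0} ->
  `|energy s Omega u psi| <= C * H1_norm psi.
Proof.
move=> cK KO; have [eta [d [he _ d0 eK]]] := cutoff_exists cK oO KO.
have [C C0 CP] := energy_param_bound cK KO he d0 eK.
exists (2 * C); first by rewrite mulr_ge0.
move=> psi h z; have [p [g [w a s']]] := H1_supported cK h z.
rewrite (H1_normE w); apply: le_sqrt_of_param => //.
  exact: (H1_norm2_ge0 psi g).
exact: (CP _ _ _ w a s').
Qed.

End energy.

(** * Extension of linear identities from test functions to bounded functions *)

Section extension_by_density.
Context {R : realType} {n : nat}.
Local Notation mu := (lebesgue_rV n).
Implicit Types (f a psi phi : 'rV[R]_n -> R) (K U : set 'rV[R]_n) (x : 'rV[R]_n) (c C M : R).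

Lemma Lfun_infty_bounded f : f \in Lfun mu +oo%E ->
  exists2 M, 0 <= M & {ae mu, forall x, `|f x| <= M}.
Proof.
rewrite inE => /andP[_]; rewrite inE /= /finite_norm unlock /=; case: ifPn => [_ h|mu0 _].
  have [M fM] := @ess_sup_inf.ess_supr_bounded _ _ _ mu (Num.Def.normr \o f) h.
  by exists `|M| => //; apply: filterS fM => x /le_trans; apply; exact: ler_norm.
(* The supremum norm is 0 by convention when the whole space is null; any bound then holds almost
   everywhere. *)
exists 0 => //; exists setT; split=> //.
by apply/eqP; rewrite eq_le measure_ge0 andbT leNgt.
Qed.

Lemma bounded_Lfun_infty f M : measurable_fun setT f ->
  {ae mu, forall x, `|f x| <= M} -> f \in Lfun mu +oo%E.
Proof.
move=> mf fM; rewrite inE; apply/andP; split; rewrite inE//= /finite_norm unlock /=.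
case: ifPn => // _; apply: (@le_lt_trans _ _ M%:E); last by rewrite ltry.
by apply/ess_sup_inf.ess_supP; apply: filterS fM => x; rewrite /= lee_fin.
Qed.

Lemma measurable_norm_le_set psi M : measurable_fun setT psi ->
  measurable [set x | `|psi x| <= M].
Proof.
move=> mp; rewrite -[X in measurable X]setTI.
have -> : [set x | `|psi x| <= M] = (fun x => `|psi x|) @^-1` `]-oo, M].
  by apply/seteqP; split => x /=; rewrite in_itv.
by apply: (measurableT_comp _ mp) => //; exact: measurable_itv.
Qed.

(** The bound on [psi] holds only almost everywhere; multiplying by the indicator of the set where
    it holds gives an equivalent function bounded at every point. *)
Lemma intg_bounded_mul U a psi K M : L1_loc U a -> compact K -> K `<=` U ->
  measurable_fun setT psi -> {ae mu, forall x, ~ K x -> psi x = 0} ->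
  {ae mu, forall x, `|psi x| <= M} -> measurable U ->
  intg mu (fun x => (a \_ U) x * psi x).
Proof.
move=> [ma ia] cK KU mpsi p0 pM mU; have mK := compact_measurable_rV cK.
have i1 : intg mu (a \_ K) by apply: (intg_in mu a mK).1; exact: ia.
pose b x := psi x * \1_[set x | `|psi x| <= `|M|] x.
have mb : measurable_fun setT b.
  apply: measurable_funM => //; apply: measurable_indic; exact: measurable_norm_le_set.
have bM x : `|b x| <= `|M|.
  rewrite /b indicE; case: (boolP (_ \in _)) => [/set_mem /= h|_]; rewrite ?mulr1// mulr0 normr0//.
apply: intg_ae_eq (intg_mull mb bM i1).
  by apply: measurable_funM => //; exact/(measurable_restrictT _ mU).
apply: filterS2 p0 pM => x h0 hM.
have [Kx|Kx] := pselect (K x); last by rewrite (restrict_out a Kx) h0// !mulr0.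
rewrite (restrict_in a Kx) (restrict_in a (KU _ Kx)) mulrC /b indicE mem_set ?mulr1//=.
exact: le_trans hM (ler_norm _).
Qed.

(* Approximation by mollification: the test functions converge in H1 with supports in a fixed
   compact set, a.e., and within a fixed bound. *)
Lemma H1_extension U Lam a : open U ->
  (forall K, compact K -> K `<=` U -> exists C, forall psi, H1 setT psi ->
    {ae mu, forall x, ~ K x -> psi x = 0} -> `|Lam psi| <= C * H1_norm psi) ->
  (forall K c psi1 psi2, compact K -> K `<=` U ->
    H1 setT psi1 -> {ae mu, forall x, ~ K x -> psi1 x = 0} ->
    H1 setT psi2 -> {ae mu, forall x, ~ K x -> psi2 x = 0} ->
    Lam (fun x => c * psi1 x + psi2 x) = c * Lam psi1 + Lam psi2 :> R) ->
  L1_loc U a ->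
  (forall phi, Cc_infty U phi -> Lam phi = \int[mu]_(x in U) (a x * phi x)) ->
  forall psi, H1 setT psi -> Linfty_c U psi -> Lam psi = \int[mu]_(x in U) (a x * psi x).
Proof.
move=> oU hB hL la LE psi hpsi [Linf [K [cK KU p0]]].
have [M M0 pM] := Lfun_infty_bounded Linf.
have [psi' [g [wg ae1 [w' z' gz]]]] := H1_supported cK hpsi p0.
have mK := compact_measurable_rV cK; have mU := open_measurable_rV oU.
have [sp' sg' _] := w'; have [sp sg _] := wg.
(* A representative bounded by [M] at every point, so that its mollifications are bounded by [M] as
   well. *)
pose b x := psi' x * \1_[set x | `|psi' x| <= M] x.
have mb : measurable_fun setT b.
  apply: measurable_funM; first exact: sp'.1.
  apply: measurable_indic; exact: measurable_norm_le_set sp'.1.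
have bM x : `|b x| <= M.
  by rewrite /b indicE; case: (boolP (_ \in _)) => [/set_mem /= h|_]; rewrite ?mulr1// mulr0 normr0.
have b0 x : ~ K x -> b x = 0 by move=> Kx; rewrite /b z'// mul0r.
have ae2 : {ae mu, forall x, psi x = b x}.
  apply: filterS2 ae1 pM => x e1 h; rewrite /b indicE mem_set ?mulr1//= -e1//.
have wb : weak_gradient b g.
  apply: weak_gradient_ae ae2 _ wg => //; [by move=> i; exact: (sg i).1|by move=> i; exact: nearW].
have [sb _ db] := wb.
have [d d0 [K' [cK' K'U K'P]]] := compact_enlarge cK oU KU.
have KK' : K `<=` K' by move=> x Kx; apply: (K'P x) => //; rewrite subrr normr0 ltW.
have [r r0 Kr] := compact_norm_bound cK.
(* The square serves two purposes: its root 2^(-k) is the rate in the H^1 norm, and it is below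
   2^(-k), hence summable for almost everywhere convergence. *)
pose e k : R := (2^-1 ^+ k) ^+ 2.
have p2 k : 0 < 2^-1 ^+ k :> R by rewrite exprn_gt0// invr_gt0.
have e0 k : 0 < e k by rewrite exprn_gt0.
have ele k : e k <= 2^-1 ^+ k.
  by rewrite /e expr2 ger_pMr// exprn_ile1// ?invr_ge0// invf_le1//; lra.
have /choice[phi phiP] k := smooth_approximation Kr (e0 k) d0 sb sg b0 gz db.
have hp k : Cc_infty U (phi k).
  have [[sm _ _] h _ _ _] := phiP k; apply/Cc_inftyP; split=> //; exists K'; split=> // x Kx.
  by apply/eqP/negP => /negP /h[y Ky xy]; apply: Kx; apply: (K'P y) => //; rewrite distrC.
have hpT k : Cc_infty setT (phi k) by have [] := phiP k.
have wphi k : weak_gradient (phi k) (fun i => partial i (phi k)).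
  split; [exact: Cc_sqi (hpT k)|by move=> i; exact: Cc_sqi (Cc_partial i (hpT k))|].
  by move=> i; exact: WD_smooth.
have K'0 k : {ae mu, forall x, ~ K' x -> phi k x = 0}.
  have [_ h _ _ _] := phiP k; apply: nearW => x Kx.
  by apply/eqP/negP => /negP /h[y Ky xy]; apply: Kx; apply: (K'P y) => //; rewrite distrC.
have K'psi : {ae mu, forall x, ~ K' x -> psi x = 0}.
  by apply: filterS p0 => x h Kx; apply: h => /KK'.
have H1phi k : H1 setT (phi k) by apply/H1_setTP; exists (fun i => partial i (phi k)).
have [C CP] := hB K' cK' K'U.
(* The squared H^1 norm has n + 1 terms, each at most [e k] for the approximation error. *)
pose q : R := Num.sqrt n.+1%:R.
have close k : `|Lam psi - Lam (phi k)| <= `|C| * q * 2^-1 ^+ k.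
  have wD := weak_gradient_linear (-1) wg (wphi k).
  have hD : H1 setT (fun x => -1 * psi x + phi k x) by apply/H1_setTP; eexists; exact: wD.
  have zD : {ae mu, forall x, ~ K' x -> -1 * psi x + phi k x = 0}.
    by apply: filterS2 K'psi (K'0 k) => x h1 h2 Kx; rewrite h1// h2// mulr0 addr0.
  have := CP _ hD zD; rewrite (hL K')// mulN1r addrC distrC => /le_trans; apply.
  rewrite (H1_normE wD) -mulrA; apply: (le_trans (ler_wpM2r (sqrtr_ge0 _) (ler_norm C))).
  apply: ler_wpM2l => //.
  have -> : 2^-1 ^+ k = Num.sqrt (e k) by rewrite sqrtr_sqr ger0_norm// ltW.
  rewrite -sqrtrM//; apply: ler_wsqrtr.
  rewrite -natr1 addrC mulrDl mul1r mulr_natl; have [_ _ h1 h2 _] := phiP k.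
  have -> : nrm2 mu (fun x => -1 * psi x + phi k x) = nrm2 mu (fun x => phi k x - b x).
    apply: nrm2_ae_eq.
    - by have [[]] := wD.
    - by apply: measurable_funB => //; exact: Cc_measurable (hp k).
    - by apply: filterS ae2 => x ->; ring.
  apply: lerD => //; rewrite -[X in _ *+ X](card_ord n) -sumr_const.
  apply: ler_sum => i _; apply: le_trans (h2 i).
  by rewrite le_eqVlt; apply/orP; left; apply/eqP; congr (nrm2 mu _); apply/funext => x; ring.
have LamC : Lam (phi k) @[k --> \oo] --> Lam psi.
  have z : (`|C| * q * 2^-1 ^+ k : R) @[k --> \oo] --> 0.
    by rewrite -(mulr0 (`|C| * q)); apply: cvgMr; exact: cvg_pow2.
  apply/cvgrPdist_le => e' e'0; move/cvgrPdist_le : z => /(_ _ e'0).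
  apply: filterS => k; rewrite sub0r normrN => h.
  exact: le_trans (close k) (le_trans (ler_norm _) h).
have ae3 : {ae mu, forall x, phi k x @[k --> \oo] --> b x}.
  have : {ae mu, forall x, phi k x - b x @[k --> \oo] --> 0}.
    apply: (@ae_cvg0_summable _ _ R mu (fun k x => phi k x - b x)) => k.
      by apply: sqiB => //; exact: Cc_sqi (hp k).
    by have [_ _ h1 _ _] := phiP k; exact: le_trans h1 (ele k).
  apply: filterS => x h; rewrite -[b x]add0r.
  rewrite (_ : (fun k => phi k x) = (fun k => phi k x - b x + b x)); last first.
    by apply/funext => k; rewrite subrK.
  by apply: cvgD => //; exact: cvg_cst.
have maU : measurable_fun setT (a \_ U) by have [ma _] := la; exact/(measurable_restrictT _ mU).
have ia : intg mu (a \_ K').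
  by apply: (intg_in mu a (compact_measurable_rV cK')).1; have [_] := la; apply.
have domF k x : `|(a \_ U) x * phi k x| <= M * `|(a \_ K') x|.
  have [_ h _ _ hM] := phiP k; have [Kx|Kx] := pselect (K' x).
    by rewrite (restrict_in a Kx) (restrict_in a (K'U _ Kx)) normrM mulrC ler_wpM2r// hM.
  rewrite (_ : phi k x = 0) ?mulr0 ?normr0 ?mulr_ge0//.
  by apply/eqP/negP => /negP /h[y Ky xy]; apply: Kx; apply: (K'P y) => //; rewrite distrC.
have cF : {ae mu, forall x, (a \_ U) x * phi k x @[k --> \oo] --> (a \_ U) x * b x}.
  by apply: filterS ae3 => x h; exact: cvgMr.
have [_ dct] := Rint_dct (fun k => measurable_funM maU (Cc_measurable (hp k)))
  (measurable_funM maU mb) cF (intgZ M (intg_abs ia)) (nearW _ (fun x k => domF k x)).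
have LamF : Lam (phi k) @[k --> \oo] --> \int[mu]_x ((a \_ U) x * b x).
  apply: cvg_trans dct; apply: near_eq_cvg; apply: nearW => k.
  by rewrite LE// (Rint_restrictM U a).
rewrite (Rint_restrictM U a) -(cvg_lim _ LamC)// (cvg_lim _ LamF)//.
apply: Rint_ae_eq; [exact: measurable_funM|by apply: measurable_funM => //; exact: sp.1|].
by apply: filterS ae2 => x ->.
Qed.

End extension_by_density.

(** * The singular problem *)

Section singular_problem.
Context {R : realType} {n : nat}.
Local Notation mu := (lebesgue_rV n).
Local Notation mu2 := (lebesgue_rV n \x lebesgue_rV n)%E.
Variables (s gamma : R) (Omega : set 'rV[R]_n) (w : ('rV[R]_n -> R) -> R) (u : 'rV[R]_n -> R).
Hypotheses (s0 : 0 < s) (s1 : s < 1) (oO : open Omega) (wHm1 : Hm1 Omega w)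
  (mu_u : measurable_fun setT u) (uH : H1_loc Omega u) (uL1 : mu.-integrable Omega (EFin \o u)).
Implicit Types (phi psi : 'rV[R]_n -> R) (K : set 'rV[R]_n) (x : 'rV[R]_n) (t c : R).

Let a x : R := u x `^ (- gamma).
Let mO : measurable Omega := open_measurable_rV oO.

Let iu : nonpos_on_boundary Omega u -> intg mu u.
Proof.
move=> [u0 _]; apply: (@intg_ae_eq _ _ R mu (u \_ Omega)) => //.
  apply: filterS u0 => x h; have [Ox|Ox] := pselect (Omega x).
    by rewrite (restrict_in u Ox).
  by rewrite (restrict_out u Ox) h.
by apply: (intg_in mu u mO).1.
Qed.

Let H10_supported K psi : K `<=` Omega -> H1 setT psi ->
  {ae mu, forall x, ~ K x -> psi x = 0} -> H10 Omega psi.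
Proof. by move=> KO h z; split=> //; apply: filterS z => x H Ox; apply: H => /KO. Qed.

Let w_linear K c psi1 psi2 : compact K -> K `<=` Omega ->
  H1 setT psi1 -> {ae mu, forall x, ~ K x -> psi1 x = 0} ->
  H1 setT psi2 -> {ae mu, forall x, ~ K x -> psi2 x = 0} ->
  w (fun x => c * psi1 x + psi2 x) = c * w psi1 + w psi2.
Proof.
move=> cK KO h1 z1 h2 z2; have [lin _] := wHm1.
exact: lin (H10_supported KO h1 z1) (H10_supported KO h2 z2).
Qed.

Let w_bounded K : compact K -> K `<=` Omega -> exists C, forall psi, H1 setT psi ->
  {ae mu, forall x, ~ K x -> psi x = 0} -> `|w psi| <= C * H1_norm psi.
Proof.
move=> cK KO; have [_ [C CP]] := wHm1; exists C => psi h z.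
exact: CP (H10_supported KO h z).
Qed.

Let Lam psi := energy s Omega u psi - w psi.

Let Lam_linear : nonpos_on_boundary Omega u -> forall K c psi1 psi2, compact K -> K `<=` Omega ->
  H1 setT psi1 -> {ae mu, forall x, ~ K x -> psi1 x = 0} ->
  H1 setT psi2 -> {ae mu, forall x, ~ K x -> psi2 x = 0} ->
  Lam (fun x => c * psi1 x + psi2 x) = c * Lam psi1 + Lam psi2.
Proof.
move=> bd K c psi1 psi2 cK KO h1 z1 h2 z2; rewrite /Lam (w_linear c cK KO h1 z1 h2 z2).
by rewrite (energy_linear s0 s1 oO mu_u uH (iu bd) c cK KO h1 z1 h2 z2); ring.
Qed.

Let Lam_bounded : nonpos_on_boundary Omega u -> forall K, compact K -> K `<=` Omega ->
  exists C, forall psi, H1 setT psi ->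
  {ae mu, forall x, ~ K x -> psi x = 0} -> `|Lam psi| <= C * H1_norm psi.
Proof.
move=> bd K cK KO; have [C1 C1P] := w_bounded cK KO.
have [C2 _ C2P] := energy_bounded s0 s1 oO mu_u uH (iu bd) cK KO.
exists (C2 + C1) => psi h z; rewrite mulrDl; apply: (le_trans (ler_normB _ _)).
by apply: lerD; [exact: C2P|exact: C1P].
Qed.

(** The extension by density yields the equation itself for v - u, so the inequality holds with
    equality. *)
Lemma weak_solution_variational : problemG s gamma Omega w u -> problemH s gamma Omega w u.
Proof.
move=> [pos eqn bd]; split=> // v [[hv _] lv] _.
have LE phi : Cc_infty Omega phi -> Lam phi = \int[mu]_(x in Omega) (a x * phi x).
  by move=> hp; rewrite /Lam -(eqn _ hp); ring.
have := H1_extension oO (Lam_bounded bd) (Lam_linear bd) pos.2 LE hv lv.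
by rewrite /Lam /a => /eqP; rewrite subr_eq => /eqP ->; rewrite addrC addKr.
Qed.

Section test_function.
Variable phi : 'rV[R]_n -> R.
Hypotheses (hp : Cc_infty Omega phi) (bd : nonpos_on_boundary Omega u)
  (pos : positive_singular gamma Omega u).

Let hpT : Cc_infty setT phi. Proof. exact: Cc_subset hp. Qed.

Let wphi : weak_gradient phi (fun i => partial i phi).
Proof.
split=> [|i|i]; [exact: Cc_sqi hp|exact: Cc_sqi (Cc_partial i hp)|exact: WD_smooth].
Qed.

Let u_ge0 : {ae mu, forall x, 0 <= u x /\ (Omega x -> 0 < u x)}.
Proof.
apply: filterS2 pos.1 bd.1 => x h1 h2; split=> //.
by have [/h1/ltW|/h2 ->] := pselect (Omega x).
Qed.

Section cutoff.
Variables (K : set 'rV[R]_n) (eta : 'rV[R]_n -> R) (d : R).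
Hypotheses (cK : compact K) (KO : K `<=` Omega) (p0 : forall x, ~ K x -> phi x = 0)
  (he : Cc_infty Omega eta) (e01 : forall x, 0 <= eta x <= 1) (d0 : 0 < d)
  (eK : forall x y, K x -> `|y - x| <= d -> eta y = 1).

Let gf i x := eta x * loc_partial Omega u i x + partial i eta x * u x.
(** [u] is only locally in H^1, so its cut-off is used to have a weak gradient on the whole space.
    The negative part is unaffected where u >= 0: on [K] the cut-off is 1, and off [K] both negative
    parts are 0 ([chiE]). *)
Let W t x := t * phi x + eta x * u x.
Let chi t := negp (W t).

Let wf : weak_gradient (fun x => eta x * u x) gf.
Proof. exact: (cutoff_weak_gradient oO mu_u uH he). Qed.

Let support_bound : exists r, [/\ forall x, phi x != 0 -> `|x| <= r,
  forall i x, partial i phi x != 0 -> `|x| <= r, forall x, eta x * u x != 0 -> `|x| <= r &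
  forall i x, gf i x != 0 -> `|x| <= r].
Proof.
have [r1 r10 h1] := compact_norm_bound cK.
have /Cc_inftyP[_ [L [cL _ L0]]] := he; have [r2 r20 h2] := compact_norm_bound cL.
have clL := compact_closed (@norm_hausdorff _ _) cL.
have clK := compact_closed (@norm_hausdorff _ _) cK.
have K2 x : K x -> `|x| <= r1 + r2 by move=> /h1; lra.
have L2 x : L x -> `|x| <= r1 + r2 by move=> /h2; lra.
exists (r1 + r2); split=> [x|i x|x|i x] h.
- by apply: K2; apply: contrapT => /p0 h'; rewrite h' eqxx in h.
- by apply: K2; apply: contrapT => Kx; rewrite (partial_off_support i clK p0 Kx) eqxx in h.
- by apply: L2; apply: contrapT => /L0 h'; rewrite h' mul0r eqxx in h.
- apply: L2; apply: contrapT => Lx.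
  by rewrite /gf L0// (partial_off_support i clL L0 Lx) !mul0r addr0 eqxx in h.
Qed.

Let chi_gradient t :
  weak_gradient (chi t) (fun i x => - (neg_ind (W t) x * (t * partial i phi x + gf i x))).
Proof.
have wW : weak_gradient (W t) (fun i x => t * partial i phi x + gf i x).
  exact: weak_gradient_linear wphi wf.
have [sW sgW dW] := wW; have [r [h1 h2 h3 h4]] := support_bound.
have r1 x : W t x != 0 -> `|x| <= r.
  rewrite /W; have [->|/h1//] := eqVneq (phi x) 0; rewrite mulr0 add0r; exact: h3.
have r2 i x : t * partial i phi x + gf i x != 0 -> `|x| <= r.
  have [->|/h2//] := eqVneq (partial i phi x) 0; rewrite mulr0 add0r; exact: h4.
split=> [|i|i]; [exact: sqi_negp|exact: (sqi_neg_ind sW sgW)|].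
exact: (WD_negp sW sgW r1 r2 dW).
Qed.

Let chi_H1 t : H1 setT (chi t).
Proof. by apply/H1_setTP; eexists; exact: chi_gradient. Qed.

Let phi_H1 : H1 setT phi.
Proof. by apply/H1_setTP; eexists; exact: wphi. Qed.

Let phi_off : {ae mu, forall x, ~ K x -> phi x = 0}.
Proof. exact: nearW. Qed.

Let chiE t x : 0 <= u x -> chi t x = negp (fun x => t * phi x + u x) x.
Proof.
move=> ux; rewrite /chi /negp /W; have [Kx|/p0 ->] := pselect (K x).
  by rewrite (eK Kx) ?mul1r// subrr normr0 ltW.
rewrite mulr0 !add0r !max_r// oppr_le0//.
by have /andP[e0 _] := e01 x; rewrite mulr_ge0.
Qed.

Let chi_off_pt t x : 0 <= u x -> ~ K x -> chi t x = 0.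
Proof. by move=> ux Kx; rewrite chiE// /negp p0// mulr0 add0r max_r// oppr_le0. Qed.

Let chi_off t : {ae mu, forall x, ~ K x -> chi t x = 0}.
Proof. by apply: filterS u_ge0 => x [ux _]; exact: chi_off_pt. Qed.

Let chi_le t x : 0 <= t -> 0 <= u x -> `|chi t x| <= t * `|phi x|.
Proof.
move=> t0 ux; rewrite ger0_norm ?negp_ge0// chiE// /negp ge_max mulr_ge0// andbT.
have := ler_norm (- (t * phi x)); rewrite normrN normrM (ger0_norm t0); lra.
Qed.

Let dirichlet : R := \int[mu]_x (\sum_i partial i phi x ^+ 2) + nrm2 mu2 (frac_diff s phi).

(* On the set where t phi + u < 0 the test function chi is - (t phi + u); completing the square
   bounds the bilinear form at (u, chi) by (t / 2)^2 times the quadratic form at phi. *)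
Let energy_chi t : energy s Omega u (chi t) <= t ^+ 2 / 4 * dirichlet.
Proof.
have [h1 h2 h3] := supported_restrict cK (chi_gradient t) (chi_off t).
rewrite (energyE s oO mu_u uH KO he d0 eK h1 h2 h3) mulrDr.
have [r [r1 r2 _ _]] := support_bound.
have [[mphi _] sdphi _] := wphi; have [sphi2 _] := gagliardo_bound s0 s1 wphi r1 r2.
have i1 : intg mu (fun x => \sum_i partial i phi x ^+ 2).
  by apply: intg_sum => i; exact: (sdphi i).2.
apply: lerD.
- rewrite -RintZ//; apply: Rint_le; [|exact: intgZ|].
    by apply: intg_sum => i; exact: (local_intg oO mu_u uH he i h3).
  move=> x; rewrite mulr_sumr; apply: ler_sum => i _; rewrite -/(gf i x).
  have q0 : 0 <= t ^+ 2 / 4 * partial i phi x ^+ 2 by rewrite mulr_ge0 ?sqr_ge0// divr_ge0 ?sqr_ge0.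
  rewrite patchE; case: ifP => _; last by rewrite mulr0.
  rewrite neg_indE; case: (W t x < 0); last by rewrite mul0r oppr0 mulr0.
  rewrite mul1r; move: (gf i x) (partial i phi x) => q p.
  by have := sqr_ge0 (q + t * p / 2); nra.
- rewrite -RintZ; last exact: sphi2.2.
  apply: Rint_ae_le; [exact: (nonlocal_intg s0 s1 oO mu_u uH (iu bd) cK he d0 eK h3)|
    exact: intgZ sphi2.2|].
  have N : {ae mu, forall x, (chi t \_ K) x = negp (fun x => t * phi x + u x) x}.
    apply: filterS2 h2 u_ge0 => x <- [ux _]; exact: chiE.
  apply: filterS2 (ae_fst N) (ae_snd N) => p e1 e2.
  rewrite /nonlocal_density e1 e2 [frac_diff s phi p ^+ 2]expr2 frac_diffM mulrA.
  apply: ler_wpM2r; first exact: fker_ge0.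
  rewrite /negp; move: (u p.1) (u p.2) (phi p.1) (phi p.2) => b c f g.
  (* With W = t phi + u and N its negative part, (W(x) - W(y)) (N(x) - N(y)) <= - (N(x) - N(y))^2
     whatever the signs; subtracting t phi and completing the square gives the bound. *)
  have := sqr_ge0 (Num.max (- (t * f + b)) 0 - Num.max (- (t * g + c)) 0 + t * (f - g) / 2).
  case: (leP (- (t * f + b)) 0) => hf; case: (leP (- (t * g + c)) 0) => hg; nra.
Qed.

(** Added to [u], it gives (u + t phi)^+ almost everywhere, which is nonnegative. *)
Let perturbation t x := t * phi x + chi t x.

Let perturbation_Linfty_c t : 0 <= t -> Linfty_c Omega (perturbation t).
Proof.
move=> t0; have [M M0 pM] := Cc_sup hp; have [[mc _] _ _] := chi_gradient t.
split; last first.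
  exists K; split=> //; apply: filterS (chi_off t) => x h Kx.
  by rewrite /perturbation h// p0// mulr0 addr0.
apply: (@bounded_Lfun_infty R n _ (2 * (t * M))).
  by apply: measurable_funD => //; apply: measurable_funM => //; exact: Cc_measurable hp.
apply: filterS u_ge0 => x [ux _]; apply: (le_trans (ler_normD _ _)).
rewrite normrM (ger0_norm t0); have := chi_le t0 ux.
by have := ler_wpM2l t0 (pM x); lra.
Qed.

Let perturbation_H1 t : H1 setT (perturbation t).
Proof.
by apply/H1_setTP; exact: (ex_intro _ _ (weak_gradient_linear t wphi (chi_gradient t))).
Qed.

Let intg_mul_chi b t : L1_loc Omega b -> 0 <= t -> intg mu (fun x => (b \_ Omega) x * chi t x).
Proof.
move=> lb t0; have [M M0 pM] := Cc_sup hp; have [[mc _] _ _] := chi_gradient t.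
apply: (@intg_bounded_mul R n Omega b (chi t) K (t * M)) => //.
apply: filterS u_ge0 => x [ux _]; apply: (le_trans (chi_le t0 ux)).
exact: ler_wpM2l.
Qed.

(** The o(t) estimate along t = 1 / (k + 1): chi / t is at most |phi|, and at almost every point of
    [K] it is 0 from some k on. *)
Let quotient_cvg b : L1_loc Omega b ->
  (k.+1%:R * \int[mu]_(x in Omega) (b x * chi k.+1%:R^-1 x) : R) @[k --> \oo] --> 0.
Proof.
move=> lb; have [M M0 pM] := Cc_sup hp.
have t0 k : 0 <= k.+1%:R^-1 :> R by rewrite invr_ge0.
have [mb ib] := lb; have mK := compact_measurable_rV cK.
have mbO : measurable_fun setT (b \_ Omega) by exact/(measurable_restrictT _ mO).
have i1 : intg mu (b \_ K) by apply: (intg_in mu b mK).1; exact: ib.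
have mc t : measurable_fun setT (chi t) by have [[]] := chi_gradient t.
have -> : (fun k => k.+1%:R * \int[mu]_(x in Omega) (b x * chi k.+1%:R^-1 x)) =
    (fun k => \int[mu]_x (k.+1%:R * ((b \_ Omega) x * chi k.+1%:R^-1 x)) : R).
  by apply/funext => k; rewrite RintZ ?(Rint_restrictM Omega b)//; exact: intg_mul_chi.
have mF k : measurable_fun setT (fun x => k.+1%:R * ((b \_ Omega) x * chi k.+1%:R^-1 x)).
  by apply: measurable_funM => //; exact: measurable_funM.
have [|||_] := @Rint_dct _ _ R mu _ (fun=> 0) (fun x => M * `|(b \_ K) x|) mF (measurable_cst _).
- apply: filterS u_ge0 => x [ux uO]; have [Kx|Kx] := pselect (K x); last first.
    rewrite (_ : (fun k => _) = fun=> 0); first exact: cvg_cst.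
    by apply/funext => k; rewrite chi_off_pt// !mulr0.
  have up : 0 < u x by apply: uO; exact: KO.
  have tc : (k.+1%:R^-1 * `|phi x| : R) @[k --> \oo] --> 0.
    by rewrite -(mul0r `|phi x|); apply: cvgMl; exact: cvg_harmonic.
  move/cvgrPdist_lt : tc => /(_ _ up) tc.
  apply: cvg_near_cst; apply: filterS tc => k; rewrite sub0r normrN normrM normr_id (ger0_norm (t0 k)).
  move=> h; rewrite chiE// /negp max_r ?mulr0// oppr_le0.
  have := ler_norm (- (k.+1%:R^-1 * phi x)); rewrite normrN normrM (ger0_norm (t0 k)).
  by move: (k.+1%:R^-1) h => t h; lra.
- by apply: intgZ; exact: intg_abs.
- apply: filterS u_ge0 => x [ux _] k; have [Kx|Kx] := pselect (K x); last first.
    by rewrite chi_off_pt// !mulr0 normr0 mulr_ge0.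
  rewrite (restrict_in b Kx) (restrict_in b (KO Kx)) mulrCA normrM mulrC.
  apply: ler_wpM2r => //; rewrite normrM ger0_norm//.
  have k0 : 0 < k.+1%:R :> R by rewrite ltr0n.
  rewrite -ler_pdivlMl//; apply: (le_trans (chi_le (t0 k) ux)).
  exact: ler_wpM2l.
- by rewrite /Rintegral integral0.
Qed.

Lemma variational_test_ge0 : in_L1_loc Omega w -> problemH s gamma Omega w u ->
  \int[mu]_(x in Omega) (a x * phi x) <= Lam phi.
Proof.
move=> [f0 lf0 wf0] [_ ineq _].
(* The variational inequality for v = (u + t phi)^+, from which the nonnegative integral of a chi is
   dropped. *)
have step t : 0 < t -> t * \int[mu]_(x in Omega) (a x * phi x) +
    \int[mu]_(x in Omega) (f0 x * chi t x) <= t * Lam phi + t ^+ 2 / 4 * dirichlet.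
  move=> tp; have t0 := ltW tp.
  have vE : (u \+ perturbation t) \- u = perturbation t.
    by apply/funext => x /=; rewrite addrC addKr.
  have lp := perturbation_Linfty_c t0; have [_ [K' [cK' K'O z']]] := lp.
  have := ineq (u \+ perturbation t); rewrite vE.
  have h10 : H10 Omega (perturbation t) by exact: H10_supported K'O (perturbation_H1 t) z'.
  have v0 : {ae mu, forall x, Omega x -> 0 <= (u \+ perturbation t) x}.
    apply: filterS u_ge0 => x [ux uO] Ox /=; rewrite /perturbation chiE// /negp.
    have : - (t * phi x + u x) <= Num.max (- (t * phi x + u x)) 0 by rewrite le_max lexx.
    by lra.
  move=> /(_ (conj h10 lp) v0).
  have -> : energy s Omega u (perturbation t) =
      t * energy s Omega u phi + energy s Omega u (chi t).
    exact: (energy_linear s0 s1 oO mu_u uH (iu bd) t cK KO phi_H1 phi_off (chi_H1 t) (chi_off t)).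
  have -> : w (perturbation t) = t * w phi + w (chi t).
    exact: (w_linear t cK KO phi_H1 phi_off (chi_H1 t) (chi_off t)).
  have chiL : Linfty_c Omega (chi t).
    split; last by exists K; split=> //; exact: chi_off.
    have [M M0 pM] := Cc_sup hp; have [[mc _] _ _] := chi_gradient t.
    apply: (@bounded_Lfun_infty R n _ (t * M)) => //.
    apply: filterS u_ge0 => x [ux _]; apply: (le_trans (chi_le t0 ux)); exact: ler_wpM2l.
  have -> : w (chi t) = \int[mu]_(x in Omega) (f0 x * chi t x).
    exact: (H1_extension oO w_bounded w_linear lf0 wf0 (chi_H1 t) chiL).
  have -> : \int[mu]_(x in Omega) (u x `^ (- gamma) * ((u \+ perturbation t) x - u x)) =
      t * \int[mu]_(x in Omega) (a x * phi x) + \int[mu]_(x in Omega) (a x * chi t x).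
    have -> : (fun x => u x `^ (- gamma) * ((u \+ perturbation t) x - u x)) =
        (fun x => a x * perturbation t x).
      by apply/funext => x; rewrite /= [u x + _]addrC addrK.
    rewrite (Rint_restrictM Omega a phi) (Rint_restrictM Omega a (chi t)).
    rewrite (Rint_restrictM Omega a (perturbation t)).
    have i1 : intg mu (fun x => (a \_ Omega) x * phi x) by exact: intg_restrictM pos.2 hp.
    have i2 : intg mu (fun x => (a \_ Omega) x * chi t x) by exact: intg_mul_chi pos.2 t0.
    rewrite -RintZ// -RintD//; last exact: intgZ.
    by apply: eq_Rintegral => x _; rewrite /perturbation; ring.
  have a_ge0 : 0 <= \int[mu]_(x in Omega) (a x * chi t x).
    by apply: Rintegral_ge0 => x _; rewrite mulr_ge0 ?powR_ge0 ?negp_ge0.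
  have := energy_chi t; rewrite /Lam; lra.
pose t (k : nat) : R := k.+1%:R^-1.
have tp k : 0 < t k by rewrite invr_gt0 ltr0n.
pose I := \int[mu]_(x in Omega) (a x * phi x).
pose J k := \int[mu]_(x in Omega) (f0 x * chi (t k) x).
have c1 : I + k.+1%:R * J k @[k --> \oo] --> I + 0.
  by apply: cvgD; [exact: cvg_cst|exact: quotient_cvg].
have c2 : Lam phi + t k * (dirichlet / 4) @[k --> \oo] --> Lam phi + 0 * (dirichlet / 4).
  by apply: cvgD; [exact: cvg_cst|apply: cvgMl; exact: cvg_harmonic].
rewrite mul0r !addr0 in c1 c2; apply: (cvg_seq_le _ c1 c2) => k.
have tk : t k * k.+1%:R = 1 by rewrite mulVf ?pnatr_eq0.
have tJ : t k * (I + k.+1%:R * J k) = t k * I + J k by rewrite mulrDr mulrA tk mul1r.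
rewrite -(ler_pM2l (tp k)) tJ.
apply: (le_trans (step _ (tp k))); rewrite le_eqVlt; apply/orP; left; apply/eqP.
by ring.
Qed.

End cutoff.
End test_function.

Lemma variational_weak_solution : in_L1_loc Omega w ->
  problemH s gamma Omega w u -> problemG s gamma Omega w u.
Proof.
move=> wL pH; have [pos _ bd] := pH; split=> // phi hp.
have ge0 psi : Cc_infty Omega psi -> \int[mu]_(x in Omega) (a x * psi x) <= Lam psi.
  move=> hpsi; have /Cc_inftyP[_ [K [cK KO p0]]] := hpsi.
  have [eta [d [he e01 d0 eK]]] := cutoff_exists cK oO KO.
  exact: (variational_test_ge0 hpsi bd pos cK KO p0 he e01 d0 eK wL pH).
have /Cc_inftyP[_ [K [cK KO p0]]] := hp.
have hN := CcZ (-1) hp; have l1 := ge0 _ hp; have l2 := ge0 _ hN.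
have H1Cc psi : Cc_infty Omega psi -> H1 setT psi.
  move=> hpsi; have hT : Cc_infty setT psi by exact: Cc_subset hpsi.
  apply/H1_setTP; exists (fun i => partial i psi).
  split=> [|i|i]; [exact: Cc_sqi hT|exact: Cc_sqi (Cc_partial i hT)|exact: WD_smooth].
have z1 : {ae mu, forall x, ~ K x -> phi x = 0} by exact: nearW.
have z2 : {ae mu, forall x, ~ K x -> -1 * phi x = 0}.
  by apply: nearW => x Kx; rewrite p0// mulr0.
(* Linearity is available only in the form c psi1 + psi2; evaluating - phi + phi in two ways gives
   Lam (- phi) = - Lam phi. *)
have e1 := Lam_linear bd (-1) cK KO (H1Cc _ hp) z1 (H1Cc _ hp) z1.
have e2 := Lam_linear bd 1 cK KO (H1Cc _ hN) z2 (H1Cc _ hp) z1.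
have E : (fun x => 1 * (-1 * phi x) + phi x) = (fun x => -1 * phi x + phi x).
  by apply/funext => x; rewrite mul1r.
rewrite E e1 in e2.
have l3 : \int[mu]_(x in Omega) (a x * (-1 * phi x)) = - \int[mu]_(x in Omega) (a x * phi x).
  rewrite (Rint_restrictM Omega a phi) (Rint_restrictM Omega a (fun x => -1 * phi x)).
  rewrite -RintN; last exact: intg_restrictM pos.2 hp.
  by apply: eq_Rintegral => x _; ring.
rewrite l3 in l2; rewrite -/a.
have : Lam phi = \int[mu]_(x in Omega) (a x * phi x) by lra.
by rewrite /Lam /a => /eqP; rewrite subr_eq => /eqP ->; rewrite addrC addKr.
Qed.

End singular_problem.

Unset Implicit Arguments.

Theorem theorem5p2 (R : realType) (n : nat) (n_ge3 : (3 <= n)%N)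
    (s gamma : R) (s_gt0 : 0 < s) (s_lt1 : s < 1) (gamma_gt0 : 0 < gamma)
    (Omega : set 'rV[R]_n) (domO : bounded_C11_domain Omega)
    (w : ('rV[R]_n -> R) -> R) (wHm1 : Hm1 Omega w)
    (u : 'rV[R]_n -> R) (u_meas : measurable_fun setT u)
    (uH1 : H1_loc Omega u) (uL1 : (lebesgue_rV n).-integrable Omega (EFin \o u)) :
  (problemG s gamma Omega w u -> problemH s gamma Omega w u) /\
  (in_L1_loc Omega w -> problemH s gamma Omega w u -> problemG s gamma Omega w u).
Proof.
have [_ oO _ _ _] := domO; split.
  exact: (weak_solution_variational s_gt0 s_lt1 oO wHm1 u_meas uH1 uL1).
exact: (variational_weak_solution s_gt0 s_lt1 oO wHm1 u_meas uH1 uL1).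
Qed.
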